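(* Let $(M,g)$ be a screen real null submanifold of a normal indefinite complex contact manifold $\overline M$, and let $a\in\{1,2,3\}$. Then the radical distribution $\mathrm{Rad}\,TM$ is integrable if and only if $B_ah^s(\xi_1,J_a\xi_2)=B_ah^s(\xi_2,J_a\xi_1)$ for all $\xi_1,\xi_2\in\Gamma(\mathrm{Rad}\,TM)$.
   Context: **Ambient manifold.** $\overline{M}$ is a complex contact manifold of complex dimension $2n+1$ (real dimension $4n+2$): it has an open cover with holomorphic 1-forms $\theta_i$ satisfying $\theta_i\wedge(d\theta_i)^n\neq 0$ and $\theta_i=f_{ij}\theta_j$ on overlaps, $f_{ij}$ holomorphic and non-vanishing. $J$ is its complex structure, $\overline{g}$ a Hermitian semi-Riemannian metric of index $4q$, $0<q<n$, with Levi-Civita connection $\overline\nabla$. On each set of the cover there are 1-forms $u$, $v=u\circ J$ (with $\theta=u-iv$ up to a nonvanishing complex-valued function), orthogonal dual vector fields $U$ and $V=-JU$, and (1,1)-tensors $G$, $H=GJ$ with $G^2=H^2=-I+u\otimes U+v\otimes V$, $\overline g(GX,Y)=-\overline g(X,GY)$, $\overline g(U,X)=u(X)$, $GJ=-JG$, $GU=0$, $u(U)=1$; on overlaps $u'=au-bv$, $v'=bu+av$, $G'=aG-bH$, $H'=bG+aH$ with $a^2+b^2=1$. Moreover $du(X,Y)=\overline g(X,GY)+(\sigma\wedge v)(X,Y)$ and $dv(X,Y)=\overline g(X,HY)-(\sigma\wedge u)(X,Y)$, where $\sigma(X)=\overline g(\overline\nabla_XU,V)$. $\mathcal V=\mathrm{Span}\{U,V\}$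 is the (global) characteristic subbundle, $\mathcal{H}=\mathcal V^\perp$ the horizontal one. $\overline M$ is *normal* if $S(X,Y)=T(X,Y)=0$ for $X,Y\in\Gamma(\mathcal H)$ and $S(U,X)=T(V,X)=0$ for all $X$, where, with $[\cdot,\cdot]$ of a tensor denoting its Nijenhuis tensor, $S(X,Y)=[G,G](X,Y)+2\overline g(X,GY)U-2\overline g(X,HY)V+2\{v(Y)HX-v(X)HY\}+\sigma(GY)HX-\sigma(GX)HY+\sigma(X)GHY-\sigma(Y)GHX$, $T(X,Y)=[H,H](X,Y)-2\overline g(X,GY)U+2\overline g(X,HY)V+2\{u(Y)GX-u(X)GY\}+\sigma(HX)GY-\sigma(HY)GX+\sigma(X)GHY-\sigma(Y)GHX$. (Conventions for $d$ and $\wedge$ are those for which, on a normal manifold, $\overline\nabla_XU=-GX+\sigma(X)V$ and $\overline\nabla_XV=-HX-\sigma(X)U$.) Put $J_1=J$, $J_2=G$, $J_3=H$. **Null submanifolds.** A submanifold $M$ of $\overline M$ with induced (degenerate) metric $g$ is *null* if $\mathrm{Rad}\,TM=TM\cap TM^\perp$ is a smooth distribution of constant rank $r>0$. Fix a screen distribution $S(TM)$ (nondegenerate, $TM=\mathrm{Rad}\,TM\perp S(TM)$), a screen transversal bundle $S(TM^\perp)$ (nondegenerate, $TM^\perp=\mathrm{Rad}\,TM\perp S(TM^\perp)$), and the null transversal bundle $l\mathrm{tr}(TM)$, locally spanned by null sections $N_i$ of the orthogonal complement of $S(TM^\perp)$ in $S(TM)^\perp$ with $\overline g(\xi_i,N_j)=\delta_{ij}$,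 $\overline g(N_i,N_j)=0$ for a local basis $\{\xi_i\}$ of $\mathrm{Rad}\,TM$. Then $T\overline M|_M=TM\oplus \mathrm{tr}(TM)$ with $\mathrm{tr}(TM)=l\mathrm{tr}(TM)\perp S(TM^\perp)$. For $X,Y\in\Gamma(TM)$ write $\overline\nabla_XY=\nabla_XY+h^l(X,Y)+h^s(X,Y)$ with components in $TM$, $l\mathrm{tr}(TM)$, $S(TM^\perp)$ respectively. **Screen real null submanifold.** $\mathcal V\subset S(TM^\perp)$ along $M$, and $J_a\mathrm{Rad}\,TM=\mathrm{Rad}\,TM$ and $J_aS(TM)\subset S(TM^\perp)$ for all $a=1,2,3$. For $W\in\Gamma(S(TM^\perp))$ write $J_aW=B_aW+C_aW$ with $B_aW$ the tangential part (in $TM$) and $C_aW$ the transversal part (in $\mathrm{tr}(TM)$). *)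

(* Defs.v *)
From HB Require Import structures.
From mathcomp Require Import all_boot all_order all_algebra all_fingroup.
From mathcomp Require Import all_classical all_reals all_analysis.
From mathcomp Require Import complex.

Set Implicit Arguments.
Unset Strict Implicit.
Unset Printing Implicit Defensive.

Import Order.TTheory GRing.Theory Num.Theory.
Import numFieldNormedType.Exports.

Local Open Scope classical_set_scope.
Local Open Scope ring_scope.

Section Calculus.
Context {R : realType}.

(* Class C^k; [A] is meant to be open. *)
Fixpoint ck (k : nat) {V W : normedModType R} (A : set V) (f : V -> W) : Prop :=
  match k with
  | 0%N => forall x, A x -> {for x, continuous f}
  | k'.+1 => (forall x, A x -> differentiable f x) /\
             (forall v : V, ck k' A (fun x => 'D_v f x : W))
  end.

Definition smooth {V W : normedModType R} (A : set V) (f : V -> W) : Prop :=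
  forall k, ck k A f.

Definition jac {a b : nat} (f : 'cV[R]_a -> 'cV[R]_b) (x : 'cV[R]_a) : 'M[R]_(b, a) :=
  \matrix_(i, j) ('D_(delta_mx j 0) f x : 'cV[R]_b) i 0.

End Calculus.

(* [cinv] is total, but only its values on the image of [cdom] matter. *)
Record chart (R : realType) (m : nat) (M : topologicalType) := Chart {
  cdom : set M;
  cmap : M -> 'cV[R]_m;
  cinv : 'cV[R]_m -> M;
  cdom_open : open cdom;
  cimg_open : open (cmap @` cdom);
  cmapK : forall p, cdom p -> cinv (cmap p) = p;
  cmap_cont : forall p, cdom p -> {for p, continuous cmap};
  cinv_cont : forall x, (cmap @` cdom) x -> {for x, continuous cinv} }.

(* A smooth atlas, indexed by the points of M so that every point comes with a
   preferred chart around it.  A tangent vector at p is the column of its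
   components in the preferred chart at p, so T_p M = 'cV[R]_m. *)
Record manifold (R : realType) (m : nat) (M : topologicalType) := Manifold {
  chart_at : M -> chart R m M;
  chart_atP : forall p, cdom (chart_at p) p;
  chart_compat : forall p q,
    smooth (cmap (chart_at p) @` (cdom (chart_at p) `&` cdom (chart_at q)))
           (cmap (chart_at q) \o cinv (chart_at p));
  manifold_hausdorff : hausdorff_space M;
  manifold_countable : @second_countable M }.

(* Multiplication by i on C^k = R^k x R^k, (x, y) |-> (- y, x). *)
Definition stdJ (R : realType) (k : nat) : 'M[R]_(k + k) :=
  block_mx 0 (- 1%:M) 1%:M 0.

(* Holomorphic atlas: the transition maps satisfy the Cauchy-Riemann equations.
   As preferred charts are holomorphic, the complex structure of T_p M is
   [stdJ] at every point p. *)
Record complex_manifold (R : realType) (k : nat) (M : topologicalType) :=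
  ComplexManifold {
  real_manifold :> manifold R (k + k) M;
  transition_holo : forall p q x,
    (cmap (chart_at real_manifold p) @`
       (cdom (chart_at real_manifold p) `&` cdom (chart_at real_manifold q))) x ->
    let D := jac (cmap (chart_at real_manifold q) \o cinv (chart_at real_manifold p)) x in
    D *m stdJ R k = stdJ R k *m D }.

Section Fields.
Context {R : realType} {m : nat} {M : topologicalType} (A : manifold R m M).

(* From components in the preferred chart at q to components in that at p. *)
Definition to_chart (p q : M) : 'M[R]_m :=
  jac (cmap (chart_at A p) \o cinv (chart_at A q)) (cmap (chart_at A q) q).

(* The coordinate vector field d/dx_j of the preferred chart at p. *)
Definition coord_field (p : M) (j : 'I_m) (q : M) : 'cV[R]_m :=
  col j (jac (cmap (chart_at A q) \o cinv (chart_at A p)) (cmap (chart_at A p) q)).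

Definition smooth_fun {V : normedModType R} (W : set M) (F : M -> V) : Prop :=
  forall p, W p ->
    smooth (cmap (chart_at A p) @` (cdom (chart_at A p) `&` W))
           (F \o cinv (chart_at A p)).

Definition dir {V : normedModType R} (F : M -> V) (p : M) (v : 'cV[R]_m) : V :=
  'D_v (F \o cinv (chart_at A p)) (cmap (chart_at A p) p).

End Fields.

Section Along.
Context {R : realType} {d m : nat} {N M : topologicalType}
        (B : manifold R d N) (A : manifold R m M) (f : N -> M).

Definition smooth_map : Prop :=
  continuous f /\
  forall p, smooth (cmap (chart_at B p) @`
                      (cdom (chart_at B p) `&` f @^-1` cdom (chart_at A (f p))))
                   (cmap (chart_at A (f p)) \o f \o cinv (chart_at B p)).

(* df_p : T_p N -> T_(f p) M *)
Definition tmap (p : N) : 'M[R]_(m, d) :=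
  jac (cmap (chart_at A (f p)) \o f \o cinv (chart_at B p)) (cmap (chart_at B p) p).

(* A section Y of f^* TM in the trivialisation given by the chart at f p. *)
Definition rep (Y : N -> 'cV[R]_m) (p q : N) : 'cV[R]_m :=
  to_chart A (f p) (f q) *m Y q.

Definition smooth_along (W : set N) (Y : N -> 'cV[R]_m) : Prop :=
  forall p, W p ->
    smooth (cmap (chart_at B p) @`
              (cdom (chart_at B p) `&` W `&` f @^-1` cdom (chart_at A (f p))))
           (rep Y p \o cinv (chart_at B p)).

Definition smooth_bundle (E : N -> {vspace 'cV[R]_m}) (k : nat) : Prop :=
  forall p, exists (W : set N) (e : 'I_k -> N -> 'cV[R]_m),
    [/\ open W, W p, (forall i, smooth_along W (e i)) &
        forall q, W q -> basis_of (E q) [seq e i q | i <- enum 'I_k]].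

End Along.

Definition smooth_field {R : realType} {m : nat} {M : topologicalType}
    (A : manifold R m M) (W : set M) (X : M -> 'cV[R]_m) : Prop :=
  smooth_along A A id W X.

Definition bracket {R : realType} {m : nat} {M : topologicalType}
    (A : manifold R m M) (X Y : M -> 'cV[R]_m) (p : M) : 'cV[R]_m :=
  dir A (rep A id Y p) p (X p) - dir A (rep A id X p) p (Y p).

Definition ev {R : realType} {m : nat} (a : 'rV[R]_m) (x : 'cV[R]_m) : R :=
  (a *m x) 0 0.

(* Convention: da(X,Y) = (X a(Y) - Y a(X) - a([X,Y])) / 2 and
   (a /\ b)(X,Y) = (a(X) b(Y) - a(Y) b(X)) / 2. *)
Definition ext_d {R : realType} {m : nat} {M : topologicalType}
    (A : manifold R m M) (a : M -> 'rV[R]_m) (X Y : M -> 'cV[R]_m) (p : M) : R :=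
  2^-1 * (dir A (fun q => ev (a q) (Y q) : R^o) p (X p)
        - dir A (fun q => ev (a q) (X q) : R^o) p (Y p)
        - ev (a p) (bracket A X Y p)).

Definition wedge1 {R : realType} {T : Type} (a b : T -> R) (x y : T) : R :=
  2^-1 * (a x * b y - a y * b x).

Definition smooth_form {R : realType} {m : nat} {M : topologicalType}
    (A : manifold R m M) (W : set M) (a : M -> 'rV[R]_m) : Prop :=
  forall W' X, open W' -> W' `<=` W -> smooth_field A W' X ->
    smooth_fun A W' (fun q => ev (a q) (X q) : R^o).

Definition smooth_endo {R : realType} {m : nat} {M : topologicalType}
    (A : manifold R m M) (W : set M) (G : M -> 'M[R]_m) : Prop :=
  forall W' X, open W' -> W' `<=` W -> smooth_field A W' X ->
    smooth_field A W' (fun q => G q *m X q).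

Definition nijenhuis {R : realType} {m : nat} {M : topologicalType}
    (A : manifold R m M) (G : M -> 'M[R]_m) (X Y : M -> 'cV[R]_m) (p : M) : 'cV[R]_m :=
  let GX := fun q => G q *m X q in
  let GY := fun q => G q *m Y q in
  G p *m (G p *m bracket A X Y p) + bracket A GX GY p
  - G p *m bracket A GX Y p - G p *m bracket A X GY p.

Definition gdot {R : realType} {m : nat} (b : 'M[R]_m) (x y : 'cV[R]_m) : R :=
  (x^T *m b *m y) 0 0.

Definition perp {R : realType} {m : nat} (b : 'M[R]_m) (E : {vspace 'cV[R]_m}) :
    {vspace 'cV[R]_m} :=
  (\bigcap_(i < \dim E)
     lker (linfun (mulmx ((tnth (vbasis E) i)^T *m b) : 'cV[R]_m -> 'cV[R]_1)))%VS.

Definition nondegenerate {R : realType} {m : nat} (b : 'M[R]_m)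
    (E : {vspace 'cV[R]_m}) : Prop :=
  (E :&: perp b E)%VS = 0%VS.

Definition negative_on {R : realType} {m : nat} (b : 'M[R]_m)
    (E : {vspace 'cV[R]_m}) : Prop :=
  forall x, x \in E -> x != 0 -> gdot b x x < 0.

Definition has_index {R : realType} {m : nat} (b : 'M[R]_m) (s : nat) : Prop :=
  (exists2 E, negative_on b E & \dim E = s) /\
  (forall E, negative_on b E -> (\dim E <= s)%N).

Record semi_riemannian {R : realType} {m : nat} {M : topologicalType}
    (A : manifold R m M) (g : M -> 'M[R]_m) (s : nat) : Prop := {
  metric_sym : forall p, (g p)^T = g p;
  metric_nondeg : forall p, g p \in unitmx;
  metric_index : forall p, has_index (g p) s;
  metric_smooth : forall W X Y, open W -> smooth_field A W X -> smooth_field A W Y ->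
    smooth_fun A W (fun q => gdot (g q) (X q) (Y q) : R^o) }.

Definition hermitian_metric {R : realType} {k : nat} {M : topologicalType}
    (g : M -> 'M[R]_(k + k)) : Prop :=
  forall p x y, gdot (g p) (stdJ R k *m x) (stdJ R k *m y) = gdot (g p) x y.

Section LeviCivita.
Context {R : realType} {m : nat} {M : topologicalType}
        (A : manifold R m M) (g : M -> 'M[R]_m).

(* Gamma^k_ij at p, in the preferred chart at p. *)
Definition christoffel (p : M) (k i j : 'I_m) : R :=
  let gc := fun a b : 'I_m =>
    (fun q => gdot (g q) (coord_field A p a q) (coord_field A p b q) : R^o) in
  let d := fun (c a b : 'I_m) => dir A (gc a b) p (delta_mx c 0) : R in
  2^-1 * \sum_l invmx (g p) k l * (d i j l + d j i l - d l i j).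

(* The Levi-Civita connection of g, pulled back by f : N -> M: the derivative at
   p in the direction v \in T_p N of a section Y of f^* TM. *)
Definition nabla_along {d : nat} {N : topologicalType} (B : manifold R d N)
    (f : N -> M) (v : 'cV[R]_d) (Y : N -> 'cV[R]_m) (p : N) : 'cV[R]_m :=
  dir B (rep A f Y p) p v +
  \col_k \sum_i \sum_j
     christoffel (f p) k i j * (tmap B A f p *m v) i 0 * Y p j 0.

Definition nabla (v : 'cV[R]_m) (Y : M -> 'cV[R]_m) (p : M) : 'cV[R]_m :=
  nabla_along A id v Y p.

End LeviCivita.

Section Holomorphic.
Context {R : realType} {k : nat} {M : topologicalType} (A : complex_manifold R k M).

Definition cdir (h : M -> complex R) (p : M) (v : 'cV[R]_(k + k)) : complex R :=
  Complex (dir A (fun q => complex.Re (h q) : R^o) p v)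
          (dir A (fun q => complex.Im (h q) : R^o) p v).

Definition holomorphic (W : set M) (h : M -> complex R) : Prop :=
  [/\ smooth_fun A W (fun q => complex.Re (h q) : R^o),
      smooth_fun A W (fun q => complex.Im (h q) : R^o) &
      forall p v, W p -> cdir h p (stdJ R k *m v) = Complex 0 1 * cdir h p v].

(* A complex-valued 1-form is given by its values on the real tangent vectors. *)
Definition cev (t : 'rV[complex R]_(k + k)) (x : 'cV[R]_(k + k)) : complex R :=
  Complex (ev (map_mx (@complex.Re R) t) x) (ev (map_mx (@complex.Im R) t) x).

Definition cext_d (t : M -> 'rV[complex R]_(k + k)) (X Y : M -> 'cV[R]_(k + k))
    (p : M) : complex R :=
  Complex (ext_d A (fun q => map_mx (@complex.Re R) (t q)) X Y p)
          (ext_d A (fun q => map_mx (@complex.Im R) (t q)) X Y p).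

(* Type (1,0), with holomorphic components in holomorphic charts. *)
Definition holomorphic_form (W : set M) (t : M -> 'rV[complex R]_(k + k)) : Prop :=
  (forall p x, W p -> cev (t p) (stdJ R k *m x) = Complex 0 1 * cev (t p) x) /\
  (forall p j, holomorphic (W `&` cdom (chart_at A p))
                 (fun q => cev (t q) (coord_field A p j q))).

End Holomorphic.

(* t /\ (dt)^n evaluated on 2n+1 vector fields, up to a positive constant. *)
Definition contact_volume {R : realType} {n : nat} {M : topologicalType}
    (A : complex_manifold R n.*2.+1 M)
    (t : M -> 'rV[complex R]_(n.*2.+1 + n.*2.+1))
    (X : 'I_n.*2.+1 -> M -> 'cV[R]_(n.*2.+1 + n.*2.+1)) (p : M) : complex R :=
  \sum_(s : 'S_n.*2.+1) (-1) ^+ s * cev (t p) (X (s ord0) p) *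
    \prod_(j < n) cext_d A t (X (s (inord j.*2.+1))) (X (s (inord j.*2.+2))) p.

(* An open cover together with, on each member [cover_set i], the holomorphic
   contact form theta_i, the 1-form u_i, the vector field U_i and the tensor G_i.
   Values outside [cover_set i] are irrelevant. *)
Record contact_data (R : realType) (k : nat) (M : topologicalType) := ContactData {
  cover_index : Type;
  cover_set : cover_index -> set M;
  theta : cover_index -> M -> 'rV[complex R]_(k + k);
  form_u : cover_index -> M -> 'rV[R]_(k + k);
  field_U : cover_index -> M -> 'cV[R]_(k + k);
  tensor_G : cover_index -> M -> 'M[R]_(k + k) }.

Section ContactTensors.
Context {R : realType} {k : nat} {M : topologicalType}
        (A : complex_manifold R k M) (g : M -> 'M[R]_(k + k))
        (C : contact_data R k M) (i : cover_index C).

Definition form_v (p : M) : 'rV[R]_(k + k) := form_u i p *m stdJ R k.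
Definition field_V (p : M) : 'cV[R]_(k + k) := - (stdJ R k *m field_U i p).
Definition tensor_H (p : M) : 'M[R]_(k + k) := tensor_G i p *m stdJ R k.

Definition sigma (p : M) (x : 'cV[R]_(k + k)) : R :=
  gdot (g p) (nabla A g x (field_U i) p) (field_V p).

Definition tensor_S (X Y : M -> 'cV[R]_(k + k)) (p : M) : 'cV[R]_(k + k) :=
  let G := tensor_G i p in let H := tensor_H p in
  let x := X p in let y := Y p in
  nijenhuis A (tensor_G i) X Y p
  + (2 * gdot (g p) x (G *m y)) *: field_U i p
  - (2 * gdot (g p) x (H *m y)) *: field_V p
  + 2 *: (ev (form_v p) y *: (H *m x) - ev (form_v p) x *: (H *m y))
  + sigma p (G *m y) *: (H *m x) - sigma p (G *m x) *: (H *m y)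
  + sigma p x *: (G *m (H *m y)) - sigma p y *: (G *m (H *m x)).

Definition tensor_T (X Y : M -> 'cV[R]_(k + k)) (p : M) : 'cV[R]_(k + k) :=
  let G := tensor_G i p in let H := tensor_H p in
  let x := X p in let y := Y p in
  nijenhuis A tensor_H X Y p
  - (2 * gdot (g p) x (G *m y)) *: field_U i p
  + (2 * gdot (g p) x (H *m y)) *: field_V p
  + 2 *: (ev (form_u i p) y *: (G *m x) - ev (form_u i p) x *: (G *m y))
  + sigma p (H *m x) *: (G *m y) - sigma p (H *m y) *: (G *m x)
  + sigma p x *: (G *m (H *m y)) - sigma p y *: (G *m (H *m x)).

Definition horizontal (p : M) (x : 'cV[R]_(k + k)) : Prop :=
  gdot (g p) x (field_U i p) = 0 /\ gdot (g p) x (field_V p) = 0.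

End ContactTensors.

Record complex_contact {R : realType} {n : nat} {M : topologicalType}
    (A : complex_manifold R n.*2.+1 M) (C : contact_data R n.*2.+1 M) : Prop := {
  cover_open : forall i : cover_index C, open (cover_set i);
  cover_all : forall p, exists i : cover_index C, cover_set i p;
  theta_holo : forall i : cover_index C, holomorphic_form A (cover_set i) (theta i);
  theta_nondeg : forall (i : cover_index C) p, cover_set i p ->
    exists W X, [/\ open W, W p, W `<=` cover_set i,
                    (forall j, smooth_field A W (X j)) &
                    contact_volume A (theta i) X p != 0];
  theta_overlap : forall i j : cover_index C, exists f : M -> complex R,
    holomorphic A (cover_set i `&` cover_set j) f /\
    forall p, cover_set i p -> cover_set j p -> f p != 0 /\ theta i p = f p *: theta j p }.

Record contact_metric {R : realType} {k : nat} {M : topologicalType}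
    (A : complex_manifold R k M) (g : M -> 'M[R]_(k + k))
    (C : contact_data R k M) : Prop := {
  u_smooth : forall i : cover_index C, smooth_form A (cover_set i) (form_u i);
  U_smooth : forall i : cover_index C, smooth_field A (cover_set i) (field_U i);
  G_smooth : forall i : cover_index C, smooth_endo A (cover_set i) (tensor_G i);
  theta_uv : forall (i : cover_index C) p, cover_set i p ->
    exists2 l : complex R, l != 0 &
      forall x, cev (theta i p) x = l * Complex (ev (form_u i p) x) (- ev (form_v i p) x);
  UV_dual : forall (i : cover_index C) p, cover_set i p ->
    [/\ ev (form_u i p) (field_U i p) = 1, ev (form_u i p) (field_V i p) = 0,
        ev (form_v i p) (field_U i p) = 0, ev (form_v i p) (field_V i p) = 1 &
        gdot (g p) (field_U i p) (field_V i p) = 0];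
  U_metric_dual : forall (i : cover_index C) p x, cover_set i p ->
    gdot (g p) (field_U i p) x = ev (form_u i p) x;
  G_square : forall (i : cover_index C) p, cover_set i p ->
    tensor_G i p *m tensor_G i p =
      - 1%:M + field_U i p *m form_u i p + field_V i p *m form_v i p;
  H_square : forall (i : cover_index C) p, cover_set i p ->
    tensor_H i p *m tensor_H i p =
      - 1%:M + field_U i p *m form_u i p + field_V i p *m form_v i p;
  G_skew : forall (i : cover_index C) p x y, cover_set i p ->
    gdot (g p) (tensor_G i p *m x) y = - gdot (g p) x (tensor_G i p *m y);
  GJ_anticomm : forall (i : cover_index C) p, cover_set i p ->
    tensor_G i p *m stdJ R k = - (stdJ R k *m tensor_G i p);
  G_U : forall (i : cover_index C) p, cover_set i p -> tensor_G i p *m field_U i p = 0;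
  contact_overlap : forall i j : cover_index C, exists a b : M -> R,
    [/\ smooth_fun A (cover_set i `&` cover_set j) (a : M -> R^o),
        smooth_fun A (cover_set i `&` cover_set j) (b : M -> R^o) &
        forall p, cover_set i p -> cover_set j p ->
        [/\ a p ^+ 2 + b p ^+ 2 = 1,
            form_u j p = a p *: form_u i p - b p *: form_v i p,
            form_v j p = b p *: form_u i p + a p *: form_v i p,
            tensor_G j p = a p *: tensor_G i p - b p *: tensor_H i p &
            tensor_H j p = b p *: tensor_G i p + a p *: tensor_H i p]];
  du_eq : forall (i : cover_index C) W X Y p, open W -> W `<=` cover_set i ->
    smooth_field A W X -> smooth_field A W Y -> W p ->
    ext_d A (form_u i) X Y p = gdot (g p) (X p) (tensor_G i p *m Y p)
      + wedge1 (sigma A g i p) (ev (form_v i p)) (X p) (Y p);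
  dv_eq : forall (i : cover_index C) W X Y p, open W -> W `<=` cover_set i ->
    smooth_field A W X -> smooth_field A W Y -> W p ->
    ext_d A (form_v i) X Y p = gdot (g p) (X p) (tensor_H i p *m Y p)
      - wedge1 (sigma A g i p) (ev (form_u i p)) (X p) (Y p) }.

Definition normal_contact {R : realType} {k : nat} {M : topologicalType}
    (A : complex_manifold R k M) (g : M -> 'M[R]_(k + k))
    (C : contact_data R k M) : Prop :=
  forall (i : cover_index C) (W : set M), open W -> W `<=` cover_set i ->
  (forall X Y, smooth_field A W X -> smooth_field A W Y ->
     (forall q, W q -> horizontal g i q (X q)) ->
     (forall q, W q -> horizontal g i q (Y q)) ->
     forall p, W p -> tensor_S A g i X Y p = 0 /\ tensor_T A g i X Y p = 0) /\
  (forall X, smooth_field A W X ->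
     forall p, W p -> tensor_S A g i (field_U i) X p = 0 /\
                      tensor_T A g i (field_V i) X p = 0).

(* The submanifold is the image of [f], with the topology of [N]. *)
Definition submanifold {R : realType} {d m : nat} {N M : topologicalType}
    (B : manifold R d N) (A : manifold R m M) (f : N -> M) : Prop :=
  [/\ smooth_map B A f, injective f & forall p, \rank (tmap B A f p) = d].

Section NullSubmanifold.
Context {R : realType} {d m : nat} {N M : topologicalType}
        (B : manifold R d N) (A : manifold R m M) (g : M -> 'M[R]_m) (f : N -> M).

(* TM, TM^perp and Rad TM at p, as subspaces of the ambient tangent space at f p. *)
Definition tangent (p : N) : {vspace 'cV[R]_m} :=
  limg (linfun (mulmx (tmap B A f p) : 'cV[R]_d -> 'cV[R]_m)).
Definition normal_bundle (p : N) : {vspace 'cV[R]_m} := perp (g (f p)) (tangent p).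
Definition radical (p : N) : {vspace 'cV[R]_m} := (tangent p :&: normal_bundle p)%VS.

Definition null_submanifold (r : nat) : Prop :=
  [/\ submanifold B A f, (0 < r)%N & smooth_bundle B A f radical r].

(* S(TM), S(TM^perp) and ltr(TM). *)
Record screen_data := ScreenData {
  screen : N -> {vspace 'cV[R]_m};
  screen_tr : N -> {vspace 'cV[R]_m};
  null_tr : N -> {vspace 'cV[R]_m} }.

(* E = Rad TM (+) F, orthogonality being automatic when E is TM or TM^perp. *)
Definition complements_radical (E F : {vspace 'cV[R]_m}) (p : N) : Prop :=
  (radical p + F)%VS = E /\ (radical p :&: F)%VS = 0%VS.

Record is_screen (r : nat) (D : screen_data) : Prop := {
  screen_smooth : smooth_bundle B A f (screen D) (d - r);
  screen_nondeg : forall p, nondegenerate (g (f p)) (screen D p);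
  screen_compl : forall p, complements_radical (tangent p) (screen D p) p;
  screen_tr_smooth : smooth_bundle B A f (screen_tr D) (m - d - r);
  screen_tr_nondeg : forall p, nondegenerate (g (f p)) (screen_tr D p);
  screen_tr_compl : forall p, complements_radical (normal_bundle p) (screen_tr D p) p;
  null_tr_frame : forall p, exists (W : set N) (xi nu : 'I_r -> N -> 'cV[R]_m),
    [/\ open W, W p,
        (forall i, smooth_along B A f W (xi i)),
        (forall i, smooth_along B A f W (nu i)) &
        forall q, W q ->
        [/\ basis_of (radical q) [seq xi i q | i <- enum 'I_r],
            basis_of (null_tr D q) [seq nu i q | i <- enum 'I_r],
            (forall i, nu i q \in
               (perp (g (f q)) (screen D q) :&: perp (g (f q)) (screen_tr D q))%VS),
            (forall i j, gdot (g (f q)) (xi i q) (nu j q) = (i == j)%:R) &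
            (forall i j, gdot (g (f q)) (nu i q) (nu j q) = 0)]] }.

(* Projections along T Mbar|_M = TM (+) ltr(TM) (+) S(TM^perp). *)
Definition tangential_part (D : screen_data) (p : N) (x : 'cV[R]_m) : 'cV[R]_m :=
  daddv_pi (tangent p) (null_tr D p + screen_tr D p)%VS x.
Definition screen_tr_part (D : screen_data) (p : N) (x : 'cV[R]_m) : 'cV[R]_m :=
  daddv_pi (screen_tr D p) (tangent p + null_tr D p)%VS x.

(* h^s(X, Y), for X a vector field on N and Y a field of ambient vectors along N. *)
Definition h_s (D : screen_data) (X : N -> 'cV[R]_d) (Y : N -> 'cV[R]_m) (p : N) :
    'cV[R]_m :=
  screen_tr_part D p (nabla_along A g B f (X p) Y p).

Definition push (X : N -> 'cV[R]_d) (p : N) : 'cV[R]_m := tmap B A f p *m X p.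

(* Gamma(Rad TM), as vector fields on N. *)
Definition radical_section (X : N -> 'cV[R]_d) : Prop :=
  smooth_field B setT X /\ forall p, push X p \in radical p.

(* Integrability of a distribution is closure under brackets. *)
Definition radical_integrable : Prop :=
  forall X Y, radical_section X -> radical_section Y ->
  forall p, push (bracket B X Y) p \in radical p.

End NullSubmanifold.

(* J_1 = J, J_2 = G, J_3 = H, with a shifted to {0, 1, 2}. *)
Definition tensor_J {R : realType} {k : nat} {M : topologicalType}
    (C : contact_data R k M) (i : cover_index C) (a : 'I_3) (p : M) : 'M[R]_(k + k) :=
  tnth [tuple stdJ R k; tensor_G i p; tensor_H i p] a.

Definition screen_real {R : realType} {d k : nat} {N M : topologicalType}
    (B : manifold R d N) (A : complex_manifold R k M) (g : M -> 'M[R]_(k + k))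
    (C : contact_data R k M) (f : N -> M) (D : screen_data) : Prop :=
  forall (i : cover_index C) (p : N), cover_set i (f p) ->
  [/\ field_U i (f p) \in screen_tr D p, field_V i (f p) \in screen_tr D p &
      forall a : 'I_3,
        let Ja := linfun (mulmx (tensor_J i a (f p)) : 'cV[R]_(k + k) -> 'cV[R]_(k + k)) in
        (Ja @: radical B A g f p)%VS = radical B A g f p /\
        (Ja @: screen D p <= screen_tr D p)%VS].

(* B_a h^s(X, J_a Y), on the part of N lying in [cover_set i]. *)
Definition B_hs {R : realType} {d k : nat} {N M : topologicalType}
    (B : manifold R d N) (A : complex_manifold R k M) (g : M -> 'M[R]_(k + k))
    (C : contact_data R k M) (f : N -> M) (D : screen_data) (i : cover_index C)
    (a : 'I_3) (X Y : N -> 'cV[R]_d) (p : N) : 'cV[R]_(k + k) :=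
  let JY := fun q => tensor_J i a (f q) *m push B A f Y q in
  tangential_part B A f D p (tensor_J i a (f p) *m h_s B A g f D X JY p).

(* Main.v *)
Require Import Defs.
From mathcomp Require Import all_boot all_order all_algebra.
From mathcomp Require Import all_classical all_reals all_analysis.
From mathcomp Require Import ring lra.

Set Implicit Arguments.
Unset Strict Implicit.
Unset Printing Implicit Defensive.

Import Order.TTheory GRing.Theory Num.Theory.
Import numFieldNormedType.Exports.

Local Open Scope classical_set_scope.
Local Open Scope ring_scope.

(** Write P for a point of M, xi_1 and xi_2 for sections of Rad TM, and split the
    bracket [xi_1, xi_2] at P, which is tangent to M, as rho + s with rho in
    Rad TM and s in S(TM).  The connection is torsion-free, so
      nabla_(xi_1) (J_a xi_2) - nabla_(xi_2) (J_a xi_1)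
        = J_a (rho + s) + (nabla_(xi_1) J_a) xi_2 - (nabla_(xi_2) J_a) xi_1.
    The crux is that the two last terms lie in Rad TM.  Granted this, the
    S(TM^perp)-part of the right-hand side is J_a s, because J_a preserves Rad TM
    and maps S(TM) into S(TM^perp); applying J_a again gives - s, which is
    tangent.  Hence B_a h^s(xi_1, J_a xi_2) - B_a h^s(xi_2, J_a xi_1) = - s
    (B_hs_sub), and s vanishes for all xi_1, xi_2 exactly when Rad TM is
    integrable.

    Rad TM is horizontal, totally null and stable under J, G and H.  So the crux
    (nabla_tensor_J_null) follows from the values of nabla J, nabla G and nabla H
    on horizontal vectors of a normal complex contact manifold: for x and y
    orthogonal to U and V,
      (nabla_x J) y = 0,
      (nabla_x G) y = sigma(x) H y + g(x, y) U - g(x, H G y) V,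
      (nabla_x H) y = - sigma(x) G y + g(x, y) V - g(x, G H y) U.
    Only pairs with g(x, y) = g(x, H G y) = 0 matter here.  To prove the formulas,
    differentiate the structure equations.  Differentiating
    du = g(., G .) + sigma /\ v shows that the cyclic sum of g(y, (nabla_x G) z)
    is that of sigma(x) g(y, H z); the vanishing of S gives the Nijenhuis tensor
    of G on horizontal vectors, and a tensor with the symmetries of nabla G for
    which both quantities vanish is zero (nabla_tensor_horizontal).  The
    components along U and V follow from g(nabla_x U, y) = g(x, G y) and
    g(nabla_x V, y) = g(x, H y).  Indeed du is the skew part of
    (x, y) |-> g(nabla_x U, y), and this form is skew on horizontal vectors
    because S(U, .) = 0 (nabla_char_horizontal).  Exchanging (G, U, u) with
    (H, V, v) and changing the sign of sigma exchanges the hypotheses on S with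
    those on T, so each of these steps is done once, for half of the structure
    (half_contact).

    The tensors S and T, the exterior derivatives and the connection are
    defined by derivatives of components in charts.  All computations are done
    in the chart at P: the objects become matrix-valued functions of the
    coordinates, the covariant derivatives become matrices, and the equations
    satisfied by G, H, U, V, u, v near P are differentiated once
    (half_contact_at).  The chart at P also carries enough fields to use the
    hypotheses, namely those with constant components and their horizontal
    projections. *)

(** * Derivatives of matrix-valued functions, and functions of class C^k *)

Section Differentiability.
Context {R : realType}.

(** The remainder in the definition of the differential only matters near x. *)
Lemma differentiable_near {V W : normedModType R} (f g : V -> W) (x : V) :
  (\near x, f x = g x) -> differentiable f x -> differentiable g x.
Proof.
move=> fg [[dfc fE]].
have fgx : f x = g x := nbhs_singleton fg.
rewrite lim_id // in fE.
have gE : g = cst (g x) + 'd f x \o center x +o_x (center x).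
  apply/eqaddoP => e e0.
  have := (eqaddoP _ _ _ _).1 fE e e0.
  by apply: filterS2 fg => y /= fgy; rewrite /= !fctE /= fgx fgy.
apply/diffP => /=.
apply: (@getPex _ (fun (df : {linear V -> W}) => continuous df /\
  forall y, g y = g (lim (nbhs x)) + df (y - lim (nbhs x))
                  +o_(y \near x) (y - lim (nbhs x)))).
exists ('d f x); split=> // y; rewrite !lim_id //.
by have := congr1 (@^~ y) gE.
Qed.


Lemma differentiable_mxP {V : normedModType R} {a b : nat}
    (F : V -> 'M[R]_(a, b)) (x : V) :
  differentiable F x <-> forall i j, differentiable (fun y => F y i j : R^o) x.
Proof.
split=> [dF i j|dF].
  exact: (differentiable_comp dF (differentiable_coord (F x) i j)).
have -> : F = \sum_i \sum_j (fun y => F y i j *: (delta_mx i j : 'M[R]_(a, b))).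
  apply/funext => y; rewrite {1}(matrix_sum_delta (F y)) fct_sumE.
  by apply: eq_bigr => i _; rewrite fct_sumE.
apply: differentiable_sum => i; apply: differentiable_sum => j.
exact: differentiableZl.
Qed.

Lemma derive_mxE {V : normedModType R} {a b : nat}
    (F : V -> 'M[R]_(a, b)) (x v : V) i j :
  differentiable F x -> ('D_v F x) i j = 'D_v (fun y => F y i j : R^o) x.
Proof. by move=> dF; rewrite derive_mx ?mxE//; exact: diff_derivable. Qed.

Lemma differentiable_mulmx {V : normedModType R} {a b c : nat}
    (F : V -> 'M[R]_(a, b)) (G : V -> 'M[R]_(b, c)) (x : V) :
  differentiable F x -> differentiable G x ->
  differentiable (fun y => F y *m G y) x.
Proof.
move=> /differentiable_mxP dF /differentiable_mxP dG.
apply/differentiable_mxP => i j.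
have -> : (fun y => (F y *m G y) i j : R^o)
    = \sum_k ((fun y => F y i k : R^o) * (fun y => G y k j : R^o)).
  by apply/funext => y; rewrite mxE fct_sumE.
by apply: differentiable_sum => k; exact: differentiableM.
Qed.

Lemma derive_mulmx {V : normedModType R} {a b c : nat}
    (F : V -> 'M[R]_(a, b)) (G : V -> 'M[R]_(b, c)) (x v : V) :
  differentiable F x -> differentiable G x ->
  'D_v (fun y => F y *m G y) x = 'D_v F x *m G x + F x *m 'D_v G x.
Proof.
move=> dF dG; apply/matrixP => i j.
rewrite derive_mxE; last exact: differentiable_mulmx.
have -> : (fun y => (F y *m G y) i j : R^o)
    = \sum_k ((fun y => F y i k : R^o) * (fun y => G y k j : R^o)).
  by apply/funext => y; rewrite mxE fct_sumE.
have dFc := (differentiable_mxP _ _).1 dF; have dGc := (differentiable_mxP _ _).1 dG.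
rewrite derive_sum; last first.
  by move=> k; apply: derivableM; exact: diff_derivable.
rewrite !mxE -big_split /=; apply: eq_bigr => k _.
rewrite deriveM; [|exact: diff_derivable..].
by rewrite !derive_mxE// addrC; congr (_ + _); rewrite [LHS]mulrC.
Qed.

Lemma differentiable_trmx {V : normedModType R} {a b : nat}
    (F : V -> 'M[R]_(a, b)) (x : V) :
  differentiable F x -> differentiable (fun y => (F y)^T) x.
Proof.
move=> /differentiable_mxP dF; apply/differentiable_mxP => i j.
by under eq_fun do rewrite mxE.
Qed.

Lemma derive_trmx {V : normedModType R} {a b : nat}
    (F : V -> 'M[R]_(a, b)) (x v : V) :
  differentiable F x -> 'D_v (fun y => (F y)^T) x = ('D_v F x)^T.
Proof.
move=> dF; apply/matrixP => i j.
rewrite derive_mxE; last exact: differentiable_trmx.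
by rewrite mxE derive_mxE//; under eq_fun do rewrite mxE.
Qed.

Lemma derive_coord {W : normedModType R} {a : nat} (F : 'cV[R]_a -> W) x v :
  differentiable F x -> 'D_v F x = \sum_i v i 0 *: 'D_(delta_mx i 0) F x.
Proof.
move=> dF; rewrite deriveE// {1}(matrix_sum_delta v) linear_sum.
by apply: eq_bigr => i _; rewrite big_ord1 linearZ /= deriveE.
Qed.

Lemma derive_comp {U V W : normedModType R} (F : U -> V) (G : V -> W) (x v : U) :
  differentiable F x -> differentiable G (F x) ->
  'D_v (fun y => G (F y)) x = 'D_('D_v F x) G (F x).
Proof.
move=> dF dG; rewrite !deriveE//; last exact: (differentiable_comp dF dG).
by rewrite -[fun y => _]/(G \o F) diff_comp.
Qed.

Lemma jacE {a b : nat} (F : 'cV[R]_a -> 'cV[R]_b) x v :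
  differentiable F x -> jac F x *m v = 'D_v F x.
Proof.
move=> dF; rewrite (derive_coord _ dF); apply/matrixP => i j.
rewrite !mxE summxE ord1; apply: eq_bigr => k _.
by rewrite !mxE mulrC.
Qed.

End Differentiability.

Section SmoothFunctions.
Context {R : realType}.

Lemma ck_sub k {V W : normedModType R} (A B : set V) (F : V -> W) :
  A `<=` B -> ck k B F -> ck k A F.
Proof.
move=> AB; elim: k F => [|k IH] F /=; first by move=> h x /AB/h.
by move=> [d h]; split=> [x /AB/d//|v]; apply: IH.
Qed.

Lemma ck_pred k {V W : normedModType R} (A : set V) (F : V -> W) :
  ck k.+1 A F -> ck k A F.
Proof.
elim: k F => [|k IH] F /=.
  by move=> [d _] x /d; exact: differentiable_continuous.
by move=> [d h]; split=> // v; apply: IH; exact: h.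
Qed.

Lemma open_near {V : topologicalType} (A : set V) (x : V) :
  open A -> A x -> nbhs x A.
Proof. by rewrite openE => oA /oA. Qed.

(** The class of a function on an open set is a local matter; this is how a
    derivative is replaced by a formula for it that holds only on A. *)
Lemma ck_eq k {V W : normedModType R} (A : set V) (F G : V -> W) :
  open A -> (forall x, A x -> F x = G x) -> ck k A F -> ck k A G.
Proof.
move=> oA; elim: k F G => [|k IH] F G FG /=.
  move=> h x Ax; have nFG : \near x, F x = G x by apply: filterS (open_near oA Ax).
  have : G y @[y --> x] --> F x.
    apply: cvg_trans (h _ Ax); apply: near_eq_cvg.
    by apply: filterS nFG => y ->.
  by rewrite FG.
have nFG x : A x -> \near x, F x = G x.
  by move=> Ax; apply: filterS (open_near oA Ax).
move=> [d h]; split=> [x Ax|v]; first exact: differentiable_near (nFG x Ax) (d x Ax).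
by apply: IH (h v) => x Ax; exact: near_eq_derive (nFG x Ax).
Qed.

Lemma ck_cst k {V W : normedModType R} (A : set V) (c : W) : ck k A (cst c).
Proof.
elim: k c => [|k IH] c /=; first by move=> x _; exact: cst_continuous.
split=> // v; have -> : (fun x => 'D_v (cst c) x) = cst (0 : W) :> (V -> W); last exact: IH.
by apply/funext => x; rewrite derive_cst.
Qed.

Lemma ckD k {V W : normedModType R} (A : set V) (F G : V -> W) : open A ->
  ck k A F -> ck k A G -> ck k A (fun x => F x + G x).
Proof.
move=> oA; elim: k F G => [|k IH] F G /=.
  by move=> cF cG x Ax; apply: cvgD; [exact: cF|exact: cG].
move=> [dF hF] [dG hG]; split=> [x Ax|v].
  by apply: differentiableD; [exact: dF|exact: dG].
apply: ck_eq (IH _ _ (hF v) (hG v)) => // x Ax.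
by rewrite -[in RHS]/(F + G) deriveD//; apply: diff_derivable; [exact: dF|exact: dG].
Qed.

Lemma ckM k {V : normedModType R} (A : set V) (F G : V -> R^o) : open A ->
  ck k A F -> ck k A G -> ck k A (fun x => F x * G x : R^o).
Proof.
move=> oA; elim: k F G => [|k IH] F G.
  by move=> cF cG x Ax; apply: cvgM; [exact: cF|exact: cG].
move=> cF cG; have cF' := ck_pred cF; have cG' := ck_pred cG.
move: cF cG => /= [dF hF] [dG hG]; split=> [x Ax|v].
  by apply: (@differentiableM _ _ F G); [exact: dF|exact: dG].
apply: (ck_eq oA _ (ckD oA (IH _ _ cF' (hG v)) (IH _ _ (hF v) cG'))) => x Ax.
rewrite -[in RHS]/((F : V -> R) * G) deriveM//; last first.
- by apply: diff_derivable; exact: dG.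
- by apply: diff_derivable; exact: dF.
by congr (_ + _); rewrite [LHS]mulrC.
Qed.

Lemma ck_sum k {V W : normedModType R} (A : set V) n (F : 'I_n -> V -> W) : open A ->
  (forall i, ck k A (F i)) -> ck k A (fun x => \sum_i F i x).
Proof.
move=> oA; elim: n F => [|n IH] F cF.
  by apply: ck_eq (@ck_cst k V W A 0) => // x _; rewrite big_ord0.
apply: (ck_eq oA _ (ckD oA (IH (fun i => F (widen_ord (leqnSn n) i)) _) (cF ord_max))).
  by move=> x _; rewrite big_ord_recr.
by move=> i; exact: cF.
Qed.

Lemma ck_mxP k {V : normedModType R} (A : set V) {a b : nat} (F : V -> 'M[R]_(a, b)) :
  open A -> ck k A F <-> forall i j, ck k A (fun x => F x i j : R^o).
Proof.
move=> oA; split.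
  elim: k F => [|k IH] F /=.
    move=> cF i j x Ax.
    by apply: (@continuous_comp _ _ _ F (fun M : 'M[R]_(a, b) => M i j));
      [exact: cF|exact: coord_continuous].
  move=> [dF hF] i j; split=> [x Ax|v].
    by move: i j; apply/differentiable_mxP; exact: dF.
  apply: ck_eq (IH _ (hF v) i j) => // x Ax; rewrite derive_mxE//; exact: dF.
elim: k F => [|k IH] F /=.
  move=> cF.
  have cE : ck 0 A (fun y => \sum_i \sum_j F y i j *: (delta_mx i j : 'M[R]_(a, b))).
    apply: ck_sum => // i; apply: ck_sum => // j x Ax.
    by apply: continuousZr_tmp; exact: cF.
  by apply: ck_eq cE => // x _; rewrite -matrix_sum_delta.
move=> h; have dF x : A x -> differentiable F x.
  by move=> Ax; apply/differentiable_mxP => i j; exact: (h i j).1.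
split=> // v; apply: IH => i j.
by apply: ck_eq ((h i j).2 v) => // x Ax; rewrite derive_mxE//; exact: dF.
Qed.

(** By induction on k: a derivative of the composite is a sum of products of
    components of a derivative of F with partial derivatives of G composed
    with F. *)
Lemma ck_comp k {V : normedModType R} {b : nat} (A : set V) (B : set 'cV[R]_b)
    (F : V -> 'cV[R]_b) (G : 'cV[R]_b -> R^o) : open A -> open B ->
  (forall x, A x -> B (F x)) -> ck k A F -> ck k B G -> ck k A (fun x => G (F x)).
Proof.
move=> oA oB AB; elim: k F G AB => [|k IH] F G AB.
  move=> cF cG x Ax; apply: (@continuous_comp _ _ _ F G); first exact: cF.
  by apply: cG; exact: AB.
move=> cF cG; have cF' := ck_pred cF; case: cF cG => [dF hF] [dG hG].
split=> [x Ax|v].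
  by apply: differentiable_comp; [exact: dF|apply: dG; exact: AB].
have hi i : ck k A (fun x => 'D_v F x i 0 * 'D_(delta_mx i 0) G (F x) : R^o).
  apply: ckM => //; first exact: ((ck_mxP _ _ oA).1 (hF v)).
  exact: (IH F (fun z => 'D_(delta_mx i 0) G z) AB cF' (hG _)).
apply: (ck_eq oA _ (ck_sum oA hi)) => x Ax.
rewrite (derive_comp _ (dF _ Ax) (dG _ (AB _ Ax))).
by rewrite (derive_coord _ (dG _ (AB _ Ax))).
Qed.

End SmoothFunctions.

Section Schwarz.
Context {R : realType} {V : normedModType R}.

Lemma is_derive_line (F : V -> R^o) (a u : V) (s : R) :
  differentiable F (a + s *: u) ->
  is_derive s 1 (fun t : R => F (a + t *: u) : R^o) ('D_u F (a + s *: u)).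
Proof.
move=> dF.
have dl : is_diff s (fun t : R => a + t *: u) (fun t => t *: u).
  rewrite -[X in is_diff _ _ X]/(fun t => t *: u) -[X in is_diff _ _ X]add0r.
  exact: is_diffD.
have dc : differentiable (fun t : R => F (a + t *: u) : R^o) s.
  by apply: (@differentiable_comp _ _ _ _ (fun t : R => a + t *: u) F).
split; first exact: diff_derivable.
have dlE : 'D_1 (fun t : R => a + t *: u) s = u.
  by rewrite deriveE// (@diff_val _ _ _ _ _ _ _ dl) scale1r.
by rewrite (@derive_comp _ _ _ _ (fun t : R => a + t *: u))// dlE.
Qed.

Lemma mvt_line (F : V -> R^o) (a u : V) (h : R) : 0 < h ->
  (forall s, 0 <= s <= h -> differentiable F (a + s *: u)) ->
  exists2 c, 0 <= c <= h & F (a + h *: u) - F a = 'D_u F (a + c *: u) * h.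
Proof.
move=> h0 dF.
have [||c] := @MVT R (fun t => F (a + t *: u)) (fun t => 'D_u F (a + t *: u)) 0 h h0.
- move=> s; rewrite in_itv /= => /andP[/ltW s0 /ltW sh].
  by apply: is_derive_line; apply: dF; rewrite s0.
- apply: derivable_within_continuous => s; rewrite in_itv /= => sh.
  by have [] := is_derive_line (dF s sh).
rewrite in_itv /= => /andP[/ltW c0 /ltW ch] E; exists c; first by rewrite c0.
by rewrite scale0r addr0 subr0 in E.
Qed.

(** The mean value theorem, used along u for y |-> F (y + h v) - F y and then
    along v for D_u F. *)
Lemma second_difference (A : set V) (F : V -> R^o) (x u v : V) (h : R) : 0 < h ->
  (forall s t, 0 <= s <= h -> 0 <= t <= h -> A (x + s *: u + t *: v)) ->
  ck 2 A F ->
  exists s t, [/\ 0 <= s <= h, 0 <= t <= h &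
    F (x + h *: u + h *: v) - F (x + h *: u) - F (x + h *: v) + F x =
    'D_v (fun y => 'D_u F y : R^o) (x + s *: u + t *: v) * (h * h)].
Proof.
move=> h0 hA [dF hF].
have h00 : 0 <= (0 : R) <= h by rewrite lexx ltW.
have hh : 0 <= h <= h by rewrite lexx ltW.
pose P y : R^o := F (y + h *: v) - F y.
have dFv s : 0 <= s <= h -> differentiable (fun y => F (y + h *: v) : R^o) (x + s *: u).
  move=> sh; apply: (@differentiable_comp _ _ _ _ (fun y => y + h *: v) F) => //.
  by apply: dF; exact: hA.
have dF0 s : 0 <= s <= h -> differentiable F (x + s *: u).
  by move=> sh; apply: dF; rewrite -[_ + _]addr0 -(scale0r v); exact: hA.
have [s sh E1] := @mvt_line P x u h h0 (fun s sh => differentiableB (dFv s sh) (dF0 s sh)).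
have dDF t : 0 <= t <= h -> differentiable (fun y => 'D_u F y : R^o) (x + s *: u + t *: v).
  by move=> th; apply: (hF u).1; exact: hA.
have [t th E2] := @mvt_line (fun y => 'D_u F y) (x + s *: u) v h h0 dDF.
exists s, t; split => //.
have -> : F (x + h *: u + h *: v) - F (x + h *: u) - F (x + h *: v) + F x
   = P (x + h *: u) - P x by rewrite /P; ring.
rewrite E1 mulrA -E2; congr (_ * _).
rewrite -[in LHS]/((fun y => F (y + h *: v) : R^o) - F) deriveB; first last.
- by apply: diff_derivable; exact: dF0.
- by apply: diff_derivable; exact: dFv.
congr (_ - _).
rewrite (@derive_comp _ _ _ _ (fun y => y + h *: v)) //; last by apply: dF; exact: hA.
have -> : 'D_u (fun y => y + h *: v) (x + s *: u) = u; last by [].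
rewrite -[fun y => _]/(id + cst (h *: v)) deriveD; last first.
- exact: derivable_cst.
- exact: derivable_id.
by rewrite derive_id derive_cst addr0.
Qed.

Lemma eq_at_limit (D1 D2 : V -> R^o) (x : V) :
  {for x, continuous D1} -> {for x, continuous D2} ->
  (forall r, 0 < r -> exists p q, [/\ ball x r p, ball x r q & D1 p = D2 q]) ->
  D1 x = D2 x.
Proof.
move=> c1 c2 H; apply/subr0_eq/eqP; rewrite -normr_le0; apply/ler_addgt0Pl => e e0.
rewrite addr0.
have e2 : 0 < e / 2 by rewrite divr_gt0.
have near1 : \forall y \near x, `|D1 x - D1 y| <= e / 2.
  by move/cvgrPdist_le : c1 => /(_ _ e2).
have near2 : \forall y \near x, `|D2 x - D2 y| <= e / 2.
  by move/cvgrPdist_le : c2 => /(_ _ e2).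
have : nbhs x [set y | `|D1 x - D1 y| <= e / 2 /\ `|D2 x - D2 y| <= e / 2].
  exact: filterI near1 near2.
move=> /nbhs_ballP[r /= r0 hr].
have [p [q [/hr[B1 _] /hr[_ B2] E]]] := H r r0.
apply: le_trans (ler_distD (D1 p) _ _) _.
by rewrite (splitr e) lerD// E distrC.
Qed.

(** Schwarz's theorem.  The second difference of F over a small parallelogram
    with sides u and v is, up to the same factor, a value of D_v (D_u F) and a
    value of D_u (D_v F) near x; continuity concludes. *)
Lemma derive_sym (A : set V) (F : V -> R^o) (x u v : V) : open A -> A x ->
  ck 2 A F ->
  'D_u (fun y => 'D_v F y : R^o) x = 'D_v (fun y => 'D_u F y : R^o) x.
Proof.
move=> oA Ax cF.
have cD a b : {for x, continuous (fun y => 'D_a (fun z => 'D_b F z : R^o) y : R^o)}.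
  exact: (cF.2 b).2.
apply: eq_at_limit (cD u v) (cD v u) _ => r r0.
have : nbhs x (A `&` ball x r).
  exact: filterI (open_near oA Ax) (nbhsx_ballx x r r0).
move=> /nbhs_ballP[r' /= r'0 hr].
pose k : R := `|u| + `|v| + 1; have k0 : 0 < k by rewrite ltr_wpDl ?addr_ge0.
pose h := r' / 2 / k; have h0 : 0 < h by rewrite !divr_gt0.
have near_h s t : 0 <= s <= h -> 0 <= t <= h -> ball x r' (x + s *: u + t *: v).
  move=> /andP[s0 sh] /andP[t0 th].
  rewrite -ball_normE /ball_ /= -addrA opprD addNKr normrN.
  apply: le_lt_trans (ler_normD _ _) _; rewrite !normrZ !ger0_norm//.
  apply: (@le_lt_trans _ _ (h * k)); last first.
    by rewrite /h divfK ?gt_eqF// ltr_pdivrMr// ltr_pMr// ltr1n.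
  rewrite /k !mulrDr mulr1; apply: ler_wpDr; first exact: ltW.
  by apply: lerD; apply: ler_wpM2r.
have near_h' s t : 0 <= s <= h -> 0 <= t <= h -> ball x r' (x + s *: v + t *: u).
  by move=> sh th; rewrite addrAC; exact: near_h.
have [s [t [sh th E1]]] :=
  second_difference h0 (fun s t sh th => (hr _ (near_h' s t sh th)).1) cF.
have [s' [t' [sh' th' E2]]] :=
  second_difference h0 (fun s t sh th => (hr _ (near_h s t sh th)).1) cF.
exists (x + s *: v + t *: u), (x + s' *: u + t' *: v); split.
- exact: (hr _ (near_h' s t sh th)).2.
- exact: (hr _ (near_h s' t' sh' th')).2.
apply: (@mulIf _ (h * h)); first by rewrite mulf_neq0 ?gt_eqF.
rewrite -[LHS]E1 -[RHS]E2 (addrAC x (h *: v)); congr (_ + _).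
by rewrite -!addrA; congr (_ + _); rewrite addrC.
Qed.

End Schwarz.

(** * Coordinate changes and smooth vector fields *)

Lemma mulmx_cV_inj {R : pzRingType} {a b : nat} (F G : 'M[R]_(a, b)) :
  (forall v : 'cV[R]_b, F *m v = G *m v) -> F = G.
Proof.
move=> E; apply/matrixP => i j.
by have := congr1 (fun w : 'cV[R]_a => w i 0) (E (delta_mx j 0)); rewrite -!colE !mxE.
Qed.

Section ChartTopology.
Context {R : realType} {m : nat} {M : topologicalType}.

Lemma chart_image_open (c : chart R m M) (W : set M) :
  open W -> open (cmap c @` (cdom c `&` W)).
Proof.
move=> oW; rewrite openE => x [p [cp Wp] <-].
have Ix : (cmap c @` cdom c) (cmap c p) by exists p.
have near1 : nbhs (cmap c p) (cmap c @` cdom c).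
  exact: (open_near (@cimg_open _ _ _ c) Ix).
have near2 : \forall x \near cmap c p, W (cinv c x).
  apply: (cinv_cont Ix); rewrite cmapK//; exact: open_near.
apply: filterS2 near1 near2 => _ [q cq <-]; rewrite cmapK// => Wq.
by exists q.
Qed.

Lemma chart_image_inv (c : chart R m M) (W : set M) x :
  (cmap c @` (cdom c `&` W)) x ->
  [/\ cdom c (cinv c x), W (cinv c x) & cmap c (cinv c x) = x].
Proof. by move=> [p [cp Wp] <-]; rewrite cmapK. Qed.

Lemma chart_near (c : chart R m M) (W : set M) p :
  open W -> cdom c p -> W p ->
  \forall x \near cmap c p, (cmap c @` (cdom c `&` W)) x.
Proof. by move=> oW cp Wp; apply: open_near; [exact: chart_image_open|exists p]. Qed.

End ChartTopology.
Arguments chart_image_open {R m M} c {W} _.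

Section Transitions.
Context {R : realType} {m : nat} {M : topologicalType} (A : manifold R m M).

(** It sends the components in the chart at p of a tangent vector at q to its
    components in the chart at r. *)
Definition transition_jac (r p q : M) : 'M[R]_m :=
  jac (cmap (chart_at A r) \o cinv (chart_at A p)) (cmap (chart_at A p) q).

Lemma transition_differentiable r p q :
  cdom (chart_at A p) q -> cdom (chart_at A r) q ->
  differentiable (cmap (chart_at A r) \o cinv (chart_at A p)) (cmap (chart_at A p) q).
Proof.
move=> pq rq; have [+ _] := chart_compat A p r 1.
by apply; exists q.
Qed.

Lemma transition_jacE r p q v :
  cdom (chart_at A p) q -> cdom (chart_at A r) q ->
  transition_jac r p q *m v =
  'D_v (cmap (chart_at A r) \o cinv (chart_at A p)) (cmap (chart_at A p) q).
Proof. by move=> pq rq; rewrite /transition_jac jacE//; exact: transition_differentiable. Qed.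

(** The chain rule: a directional derivative does not depend on the chart in
    which it is computed. *)
Lemma derive_chart {V : normedModType R} (F : M -> V) r p q v :
  cdom (chart_at A p) q -> cdom (chart_at A r) q ->
  differentiable (F \o cinv (chart_at A r)) (cmap (chart_at A r) q) ->
  'D_v (F \o cinv (chart_at A p)) (cmap (chart_at A p) q) =
  'D_(transition_jac r p q *m v) (F \o cinv (chart_at A r)) (cmap (chart_at A r) q).
Proof.
move=> pq rq dF; rewrite transition_jacE//.
set T := cmap (chart_at A r) \o cinv (chart_at A p).
have Tq : T (cmap (chart_at A p) q) = cmap (chart_at A r) q by rewrite /T /= cmapK.
rewrite -{1}Tq -derive_comp; last 2 first.
- exact: transition_differentiable.
- by rewrite Tq.
apply: near_eq_derive.
have := chart_near (@cdom_open _ _ _ (chart_at A r)) pq rq.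
apply: filterS => x /chart_image_inv[_ rx _].
by rewrite /T /= cmapK.
Qed.

Lemma transition_jac_id p q : cdom (chart_at A p) q -> transition_jac p p q = 1%:M.
Proof.
move=> pq; apply/matrixP => i j; rewrite !mxE.
have -> : 'D_(delta_mx j 0) (cmap (chart_at A p) \o cinv (chart_at A p))
    (cmap (chart_at A p) q) = delta_mx j 0 :> 'cV[R]_m.
  rewrite -[RHS](@derive_id _ 'cV[R]_m (cmap (chart_at A p) q)).
  apply: near_eq_derive.
  have := chart_near openT pq I.
  by apply: filterS => x /chart_image_inv[_ _ E]; rewrite /= E.
by rewrite mxE eqxx andbT.
Qed.

Lemma transition_jac_comp s r p q :
  cdom (chart_at A p) q -> cdom (chart_at A r) q -> cdom (chart_at A s) q ->
  transition_jac s r q *m transition_jac r p q = transition_jac s p q.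
Proof.
move=> pq rq sq; apply: mulmx_cV_inj => v.
rewrite -mulmxA [LHS](transition_jacE _ rq sq) [RHS](transition_jacE v pq sq).
by rewrite (@derive_chart _ (cmap (chart_at A s)) r p q)//; exact: transition_differentiable.
Qed.

Lemma transition_jacK r p q :
  cdom (chart_at A p) q -> cdom (chart_at A r) q ->
  transition_jac p r q *m transition_jac r p q = 1%:M.
Proof. by move=> pq rq; rewrite transition_jac_comp// transition_jac_id. Qed.

Lemma coord_fieldE p j q : coord_field A p j q = transition_jac q p q *m delta_mx j 0.
Proof. by rewrite -colE. Qed.

Lemma repE (X : M -> 'cV[R]_m) p q : rep A id X p q = transition_jac p q q *m X q.
Proof. by []. Qed.

End Transitions.

Section SmoothFields.
Context {R : realType} {m : nat} {M : topologicalType} (A : manifold R m M).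

Lemma smooth_fieldP (W : set M) (X : M -> 'cV[R]_m) : open W ->
  smooth_field A W X <->
  forall p, W p -> forall k i,
    ck k (cmap (chart_at A p) @` (cdom (chart_at A p) `&` W))
      (fun x => (rep A id X p (cinv (chart_at A p) x)) i 0 : R^o).
Proof.
move=> oW; rewrite /smooth_field /smooth_along /smooth.
have E p : cdom (chart_at A p) `&` W `&` id @^-1` cdom (chart_at A (id p))
    = cdom (chart_at A p) `&` W.
  by rewrite setIAC preimage_id setIid.
split=> H p Wp k.
  move=> i; have := H p Wp k; rewrite E.
  by move=> /(ck_mxP _ _ (chart_image_open (chart_at A p) oW)) /(_ i 0).
rewrite E; apply/ck_mxP; first exact: chart_image_open.
by move=> i j; rewrite (ord1 j); exact: H.
Qed.

Lemma smooth_fieldD W X Y : open W ->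
  smooth_field A W X -> smooth_field A W Y -> smooth_field A W (fun q => X q + Y q).
Proof.
move=> oW /(smooth_fieldP _ oW) hX /(smooth_fieldP _ oW) hY.
apply/smooth_fieldP => // p Wp k i.
apply: (ck_eq _ _ (ckD _ (hX p Wp k i) (hY p Wp k i))) => [|x _|];
  [exact: chart_image_open| |exact: chart_image_open].
by rewrite !repE mulmxDr [RHS]mxE.
Qed.

Lemma smooth_fieldZ W (c : M -> R) X : open W ->
  smooth_fun A W (c : M -> R^o) -> smooth_field A W X ->
  smooth_field A W (fun q => c q *: X q).
Proof.
move=> oW hc /(smooth_fieldP _ oW) hX.
apply/smooth_fieldP => // p Wp k i.
apply: (ck_eq _ _ (ckM _ (hc p Wp k) (hX p Wp k i))) => [|x _|];
  [exact: chart_image_open| |exact: chart_image_open].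
by rewrite !repE -scalemxAr [RHS]mxE.
Qed.

Lemma smooth_fun_cst W (c : R) : smooth_fun A W (fun=> c : R^o).
Proof. by move=> p Wp k; exact: ck_cst. Qed.

Lemma smooth_field_ext W X Y : open W -> (forall q, W q -> X q = Y q) ->
  smooth_field A W X -> smooth_field A W Y.
Proof.
move=> oW XY /(smooth_fieldP _ oW) hX; apply/smooth_fieldP => // p Wp k i.
apply: (ck_eq _ _ (hX p Wp k i)) => [|x /chart_image_inv[_ Wx _]].
  exact: chart_image_open.
by rewrite !repE XY.
Qed.

(** The vector field with constant components v in the chart at p. *)
Definition cst_field (p : M) (v : 'cV[R]_m) (q : M) : 'cV[R]_m :=
  transition_jac A q p q *m v.

Lemma rep_cst_field p v r q :
  cdom (chart_at A p) q -> cdom (chart_at A r) q ->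
  rep A id (cst_field p v) r q = transition_jac A r p q *m v.
Proof.
by move=> pq rq; rewrite repE mulmxA transition_jac_comp//; exact: chart_atP.
Qed.

(** In another chart, the components of this field are derivatives of the
    coordinate change composed with the inverse coordinate change. *)
Lemma cst_field_smooth p v W : open W -> W `<=` cdom (chart_at A p) ->
  smooth_field A W (cst_field p v).
Proof.
move=> oW Wp; apply/smooth_fieldP => // r Wr k i.
set c := chart_at A r; set c' := chart_at A p.
have oS : open (cmap c @` (cdom c `&` W)) by exact: chart_image_open.
have oT : open (cmap c' @` (cdom c' `&` cdom c)).
  by apply: chart_image_open; exact: (@cdom_open _ _ _ c).
have cT : ck k (cmap c @` (cdom c `&` W)) (cmap c' \o cinv c).
  apply: ck_sub (chart_compat A r p k) => _ [q [cq Wq] <-].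
  by exists q => //; split=> //; exact: Wp.
have cD : ck k (cmap c' @` (cdom c' `&` cdom c))
    (fun y => ('D_v (cmap c \o cinv c') y) i 0 : R^o).
  move: i; have [_ /(_ v) h] := chart_compat A p r k.+1.
  by move=> i; have := (ck_mxP k _ oT).1 h i 0.
have ST x : (cmap c @` (cdom c `&` W)) x ->
    (cmap c' @` (cdom c' `&` cdom c)) ((cmap c' \o cinv c) x).
  by move=> [q [cq Wq] <-]; exists q; [split=> //; exact: Wp|rewrite /= cmapK].
apply: (@ck_eq _ k _ R^o _ _ _ oS _ (ck_comp oS oT ST cT cD)) => _ [q [cq Wq] <-].
rewrite /= cmapK// rep_cst_field//; last exact: Wp.
by rewrite transition_jacE//; exact: Wp.
Qed.

End SmoothFields.

(** * The structure tensors at one point *)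

Section Gdot.
Context {R : realType} {m : nat}.
Implicit Types (g F : 'M[R]_m) (x y z : 'cV[R]_m).

Lemma gdotDl g x y z : gdot g (x + y) z = gdot g x z + gdot g y z.
Proof. by rewrite /gdot raddfD /= !mulmxDl mxE. Qed.

Lemma gdotDr g x y z : gdot g x (y + z) = gdot g x y + gdot g x z.
Proof. by rewrite /gdot mulmxDr mxE. Qed.

Lemma gdotNl g x y : gdot g (- x) y = - gdot g x y.
Proof. by rewrite /gdot raddfN /= !mulNmx mxE. Qed.

Lemma gdotNr g x y : gdot g x (- y) = - gdot g x y.
Proof. by rewrite /gdot mulmxN mxE. Qed.

Lemma gdotZl g c x y : gdot g (c *: x) y = c * gdot g x y.
Proof. by rewrite /gdot linearZ /= -!scalemxAl mxE. Qed.

Lemma gdotZr g c x y : gdot g x (c *: y) = c * gdot g x y.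
Proof. by rewrite /gdot -scalemxAr mxE. Qed.

Lemma gdot0l g y : gdot g 0 y = 0.
Proof. by rewrite -[0](scale0r 0) gdotZl mul0r. Qed.

Lemma gdot0r g x : gdot g x 0 = 0.
Proof. by rewrite -[0](scale0r 0) gdotZr mul0r. Qed.

Lemma gdotC g x y : g^T = g -> gdot g x y = gdot g y x.
Proof.
move=> gs; have -> : gdot g x y = (y^T *m g *m x)^T 0 0; last by rewrite mxE.
by rewrite !trmx_mul gs trmxK mulmxA.
Qed.

Lemma gdot_sumr g x n (y : 'I_n -> 'cV[R]_m) :
  gdot g x (\sum_i y i) = \sum_i gdot g x (y i).
Proof. by rewrite /gdot mulmx_sumr summxE. Qed.

Definition gdotE := (gdotDl, gdotDr, gdotNl, gdotNr, gdotZl, gdotZr, gdot0l, gdot0r).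

Lemma gdot_inj g x : g \in unitmx -> (forall z, gdot g x z = 0) -> x = 0.
Proof.
move=> gu H; have E : x^T *m g = 0.
  apply: mulmx_cV_inj => z; rewrite mul0mx; apply/matrixP => i j.
  by rewrite !ord1 [RHS]mxE; exact: H.
by apply: trmx_inj; rewrite trmx0 -(mulmxK gu x^T) E mul0mx.
Qed.

End Gdot.

Section HalfContact.
Context {R : realType} {m : nat}.
Implicit Types (g P Q : 'M[R]_m) (x y z : 'cV[R]_m).

(** For the characteristic vectors Ua = U and Ub = V, or Ua = V and Ub = U, these
    are the horizontal vectors. *)
Definition orth2 g (Ua Ub : 'cV[R]_m) x : Prop :=
  gdot g x Ua = 0 /\ gdot g x Ub = 0.

(** The data, at one point, carried by one of the two structure tensors: P is
    G and (Ua, Ub, Q, s) is (U, V, H, sigma), or P is H and (Ua, Ub, Q, s) is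
    (V, U, G, - sigma).  Here nP and nU stand for the covariant derivatives of
    P and Ua.  The last four fields express, in this order, the identity
    d(du) = 0, the vanishing of S on horizontal vectors, the vanishing of
    S(U, .) and the formula for du, with v and T in place of u and S if P is
    H. *)
Record half_contact g P Q (Ua Ub : 'cV[R]_m) (nP : 'cV[R]_m -> 'M[R]_m)
    (nU : 'cV[R]_m -> 'cV[R]_m) (s : 'cV[R]_m -> R) : Prop := HalfContact {
  hc_sym : g^T = g;
  hc_orth : gdot g Ub Ua = 0;
  hc_PUa : P *m Ua = 0;
  hc_PUb : P *m Ub = 0;
  hc_QUa : Q *m Ua = 0;
  hc_QUb : Q *m Ub = 0;
  hc_Pskew : forall x y, gdot g (P *m x) y = - gdot g x (P *m y);
  hc_Qskew : forall x y, gdot g (Q *m x) y = - gdot g x (Q *m y);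
  hc_PP : forall x, orth2 g Ua Ub x -> P *m (P *m x) = - x;
  hc_QP : forall x, Q *m (P *m x) = - (P *m (Q *m x));
  hc_nskew : forall w x y, gdot g (nP w *m x) y = - gdot g x (nP w *m y);
  hc_nPP : forall w y z, orth2 g Ua Ub y -> orth2 g Ua Ub z ->
    gdot g (nP w *m (P *m y)) z + gdot g (P *m (nP w *m y)) z = 0;
  hc_nPU : forall w, nP w *m Ua = - (P *m nU w);
  hc_closed : forall x y z, gdot g Ub x = 0 -> gdot g Ub y = 0 -> gdot g Ub z = 0 ->
    gdot g y (nP x *m z) + gdot g z (nP y *m x) + gdot g x (nP z *m y) =
    s x * gdot g y (Q *m z) + s y * gdot g z (Q *m x) + s z * gdot g x (Q *m y);
  hc_nij : forall x y z, orth2 g Ua Ub x -> orth2 g Ua Ub y -> orth2 g Ua Ub z ->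
    gdot g (nP (P *m x) *m y - nP (P *m y) *m x
            - P *m (nP x *m y) + P *m (nP y *m x)) z =
    gdot g (s (P *m x) *: (Q *m y) - s (P *m y) *: (Q *m x)
            - s x *: (P *m (Q *m y)) + s y *: (P *m (Q *m x))) z;
  hc_nijU : forall y, orth2 g Ua Ub y ->
    - (nP (P *m y) *m Ua) - P *m (nP Ua *m y) + P *m (nP y *m Ua) =
    - (s Ua *: (P *m (Q *m y)));
  hc_du : forall x y, orth2 g Ua Ub x -> orth2 g Ua Ub y ->
    gdot g (nU x) y - gdot g (nU y) x = 2 * gdot g x (P *m y) }.

Section Consequences.
Variables (g P Q : 'M[R]_m) (Ua Ub : 'cV[R]_m) (nP : 'cV[R]_m -> 'M[R]_m)
  (nU : 'cV[R]_m -> 'cV[R]_m) (s : 'cV[R]_m -> R).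
Hypothesis hc : half_contact g P Q Ua Ub nP nU s.

Local Notation hor := (orth2 g Ua Ub).
Local Notation "<< x , y >>" := (gdot g x y).

Let gC x y : <<x, y>> = <<y, x>>. Proof. exact/gdotC/(hc_sym hc). Qed.

Let hor_P x : hor (P *m x).
Proof.
by split; rewrite (hc_Pskew hc) ?(hc_PUa hc) ?(hc_PUb hc) gdot0r oppr0.
Qed.

Let PN x : P *m (- x) = - (P *m x). Proof. exact: mulmxN. Qed.

(* the inverse of P on horizontal vectors *)
Let horK x : hor x -> P *m (- (P *m x)) = x.
Proof. by move=> hx; rewrite PN (hc_PP hc hx) opprK. Qed.

(** Let E be the difference of the two sides.  It is skew in (y, z), it
    satisfies E(x, P y, z) = E(x, y, P z), and its cyclic sum vanishes.  By
    hc_nij the trilinear form E(P x, y, z) + E(x, y, P z) is symmetric in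
    (x, y); being also skew in (y, z), it is zero.  The cyclic identities at
    (P w, u, v) and (w, u, P v) then add up to 2 E(u, P v, w) = 0, and P is
    invertible on horizontal vectors. *)
Lemma nabla_tensor_horizontal x y z : hor x -> hor y -> hor z ->
  <<nP x *m y, z>> = s x * <<Q *m y, z>>.
Proof.
pose E x y z := <<nP x *m y, z>> - s x * <<Q *m y, z>>.
have Eskew u v w : E u w v = - E u v w.
  by rewrite /E (hc_nskew hc) (hc_Qskew hc) !(gC w); ring.
have EP u v w : hor v -> hor w -> E u (P *m v) w = E u v (P *m w).
  move=> hv hw; have := hc_nPP hc u hv hw; rewrite (hc_Pskew hc) => /eqP.
  rewrite subr_eq0 => /eqP e.
  by rewrite /E e (hc_QP hc) gdotNl (hc_Pskew hc) opprK.
have Ecyc u v w : hor u -> hor v -> hor w -> E u v w + E v w u + E w u v = 0.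
  move=> [_ hu] [_ hv] [_ hw].
  have := hc_closed hc; move=> /(_ u v w); rewrite !(gC Ub) => /(_ hu hv hw).
  rewrite /E (hc_nskew hc u v) (hc_nskew hc v w) (hc_nskew hc w u).
  rewrite (hc_Qskew hc v) (hc_Qskew hc w) (hc_Qskew hc u) => e; lra.
pose F u v w := E (P *m u) v w + E u v (P *m w).
have Fsym u v w : hor u -> hor v -> hor w -> F u v w = F v u w.
  move=> hu hv hw; have := hc_nij hc hu hv hw.
  rewrite !gdotE (hc_Pskew hc) (hc_Pskew hc (nP v *m u)).
  rewrite (hc_Pskew hc (Q *m v)) (hc_Pskew hc (Q *m u)).
  rewrite /F /E => e; lra.
have Fskew u v w : hor u -> hor v -> hor w -> F u w v = - F u v w.
  by move=> hu hv hw; rewrite /F (Eskew _ v w) (Eskew u _ w) EP//; ring.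
have F0 u v w : hor u -> hor v -> hor w -> F u v w = 0.
  move=> hu hv hw.
  have e1 := Fsym u v w hu hv hw; have e2 := Fskew v u w hv hu hw.
  have e3 := Fsym v w u hv hw hu; have e4 := Fskew w v u hw hv hu.
  have e5 := Fsym w u v hw hu hv; have e6 := Fskew u w v hu hw hv.
  lra.
have E0 u v w : hor u -> hor v -> hor w -> E u (P *m v) w = 0.
  move=> hu hv hw.
  have c1 := Ecyc (P *m w) u v (hor_P w) hu hv.
  have c2 := Ecyc w u (P *m v) hw hu (hor_P v).
  have f1 := F0 w u v hw hu hv; have f2 := F0 v w u hv hw hu.
  rewrite /F in f1 f2.
  have p1 := EP u v w hv hw; have p2 := EP v w u hw hu.
  lra.
by move=> hx hy hz; have := E0 x _ z hx (hor_P (- y)) hz; rewrite PN horK// /E; lra.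
Qed.

(** Both hc_nijU and the closedness identity at (Ua, u, v) compute
    g((nabla_Ua P) u, v); comparing them shows that (x, y) |-> g(nabla_x Ua, y)
    is skew on horizontal vectors, so it equals its skew part, which hc_du
    gives. *)
Lemma nabla_char_horizontal x y : hor x -> hor y -> <<nU x, y>> = <<x, P *m y>>.
Proof.
have skew u v : hor u -> hor v -> <<nU (P *m u), v>> = - <<nU v, P *m u>>.
  move=> hu hv.
  have PPv w : <<P *m w, P *m v>> = <<w, v>>.
    by rewrite (hc_Pskew hc) (hc_PP hc hv) gdotNr opprK.
  have := congr1 (fun w => <<w, P *m v>>) (hc_nijU hc hu).
  rewrite !(hc_nPU hc) mulmxN opprK !gdotE !PPv (hc_Pskew hc (nU u)).
  have [_ hub] := hu; have [_ hvb] := hv.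
  have := hc_closed hc; move=> /(_ Ua u v); rewrite !(gC Ub) (gC Ua Ub).
  move=> /(_ (hc_orth hc) hub hvb).
  rewrite !(hc_nPU hc) (hc_QUa hc) !gdotE mulr0.
  have -> : <<u, nP Ua *m v>> = - <<nP Ua *m u, v>> by rewrite (hc_nskew hc) opprK.
  have -> : <<Ua, nP v *m u>> = - <<nU v, P *m u>>.
    rewrite -[LHS]opprK -(hc_nskew hc) (hc_nPU hc) gdotNl opprK.
    by rewrite (hc_Pskew hc).
  have -> : <<u, Q *m v>> = - <<Q *m u, v>> by rewrite (hc_Qskew hc) opprK.
  have -> : <<Ua, Q *m u>> = 0.
    by rewrite -[LHS]opprK -(hc_Qskew hc) (hc_QUa hc) gdot0l oppr0.
  have -> : <<v, P *m nU u>> = - <<nU u, P *m v>>.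
    by rewrite gC (hc_Pskew hc).
  move=> e1 e2; lra.
move=> hx hy; have hPx : hor (- (P *m x)) by rewrite -PN; exact: hor_P.
have := skew _ _ hPx hy; rewrite horK// => e.
have := hc_du hc hx hy; lra.
Qed.

End Consequences.

Section TwoHalves.
Variables (g P Q : 'M[R]_m) (Ua Ub : 'cV[R]_m) (nP nQ : 'cV[R]_m -> 'M[R]_m)
  (nUa nUb : 'cV[R]_m -> 'cV[R]_m) (s s' : 'cV[R]_m -> R).
Hypotheses (hcP : half_contact g P Q Ua Ub nP nUa s)
  (hcQ : half_contact g Q P Ub Ua nQ nUb s').
Hypotheses (gu : g \in unitmx) (Ua1 : gdot g Ua Ua = 1) (Ub1 : gdot g Ub Ub = 1).

Local Notation hor := (orth2 g Ua Ub).
Local Notation "<< x , y >>" := (gdot g x y).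

Lemma orth2C x : orth2 g Ua Ub x <-> orth2 g Ub Ua x.
Proof. by split=> -[]. Qed.

(** A vector is zero if it is orthogonal to Ua, to Ub and to the horizontal
    vectors, since these span. *)
Lemma eq0_orth2 w : <<w, Ua>> = 0 -> <<w, Ub>> = 0 ->
  (forall z, hor z -> <<w, z>> = 0) -> w = 0.
Proof.
move=> wa wb wh; apply: (gdot_inj gu) => z.
have gC := gdotC _ _ (hc_sym hcP).
have := wh (z - <<z, Ua>> *: Ua - <<z, Ub>> *: Ub); rewrite !gdotE wa wb => <-.
  by ring.
split; rewrite !gdotE ?Ua1 ?Ub1 ?(gC Ua Ub) (hc_orth hcP); ring.
Qed.

(** The horizontal component is nabla_tensor_horizontal; the components along Ua
    and Ub are - g(nabla_x Ua, P y) = g(x, y) and - g(nabla_x Ub, P y) =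
    - g(x, Q P y), which the hypotheses on x and y make zero. *)
Lemma nabla_tensor_null x y : (forall w, nP w *m Ub = - (P *m nUb w)) ->
  hor x -> hor y -> <<x, y>> = 0 -> <<x, Q *m (P *m y)>> = 0 ->
  nP x *m y = s x *: (Q *m y).
Proof.
move=> nPUb hx hy xy xQPy; have gC := gdotC _ _ (hc_sym hcP).
have hP z : hor (P *m z).
  by split; rewrite (hc_Pskew hcP) ?(hc_PUa hcP) ?(hc_PUb hcP) gdot0r oppr0.
apply/subr0_eq; apply: eq0_orth2.
- rewrite !gdotE (hc_Qskew hcP) (hc_QUa hcP) (hc_nskew hcP) (hc_nPU hcP) !gdotE.
  rewrite opprK -[<<y, _>>]opprK -(hc_Pskew hcP) gC.
  by rewrite (nabla_char_horizontal hcP hx (hP y)) (hc_PP hcP hy) gdotNr xy; ring.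
- rewrite !gdotE (hc_Qskew hcP) (hc_QUb hcP) (hc_nskew hcP) nPUb !gdotE.
  rewrite opprK -[<<y, _>>]opprK -(hc_Pskew hcP) gC.
  rewrite (nabla_char_horizontal hcQ ((orth2C x).1 hx) ((orth2C _).1 (hP y))) xQPy.
  by ring.
- by move=> z hz; rewrite !gdotE (nabla_tensor_horizontal hcP)//; ring.
Qed.

(** As Q = P J, the contributions of nabla P and nabla Q to the horizontal part
    of P (nabla_x J) y are s(x) P y with opposite signs.  The components
    along Ua and Ub vanish by nabla_char_horizontal. *)
Lemma nabla_complex_null (J : 'M[R]_m) (nJ : 'cV[R]_m -> 'M[R]_m) x y :
  Q = P *m J -> (forall z, hor z -> hor (J *m z)) ->
  (forall z, hor z -> J *m (J *m z) = - z) ->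
  (forall w, nQ w = nP w *m J + P *m nJ w) ->
  (forall w z, <<nJ w *m z, Ua>> = <<nUb w, z>> - <<nUa w, J *m z>>) ->
  (forall w z, <<nJ w *m z, Ub>> = - <<nUa w, z>> - <<nUb w, J *m z>>) ->
  (forall w, s' w = - s w) ->
  hor x -> hor y -> nJ x *m y = 0.
Proof.
move=> QE hJ JJ nQE nJa nJb s'E hx hy; have gC := gdotC _ _ (hc_sym hcP).
have hy' := (orth2C y).1 hy; have hx' := (orth2C x).1 hx.
have hJy := hJ _ hy; have hJy' := (orth2C _).1 hJy.
have QJy : Q *m (J *m y) = - (P *m y).
  by rewrite QE -mulmxA JJ// mulmxN.
apply: eq0_orth2.
- rewrite nJa (nabla_char_horizontal hcQ hx' hy') (nabla_char_horizontal hcP hx hJy).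
  by rewrite mulmxA -QE subrr.
- rewrite nJb (nabla_char_horizontal hcP hx hy) (nabla_char_horizontal hcQ hx' hJy').
  by rewrite QJy gdotNr; ring.
- move=> z hz; have hz' := (orth2C z).1 hz.
  have hPz : hor (P *m z).
    by split; rewrite (hc_Pskew hcP) ?(hc_PUa hcP) ?(hc_PUb hcP) gdot0r oppr0.
  have := nabla_tensor_horizontal hcQ hx' hy' ((orth2C _).1 hPz).
  rewrite nQE s'E mulmxDl gdotDl -!mulmxA.
  rewrite (nabla_tensor_horizontal hcP hx hJy hPz) QJy gdotNl.
  rewrite (hc_Pskew hcP (nJ x *m y)) (hc_PP hcP hz) gdotNr => e; lra.
Qed.

End TwoHalves.
End HalfContact.

(** * Exterior derivatives in coordinates *)

Section LocalForms.
Context {R : realType} {m : nat}.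
Implicit Types (x y z w : 'cV[R]_m).

Lemma gdot_trmx (F : 'M[R]_m) x y : gdot F^T x y = gdot F y x.
Proof.
have -> : gdot F y x = (y^T *m F *m x)^T 0 0 by rewrite [RHS]mxE.
by rewrite !trmx_mul trmxK mulmxA.
Qed.

Lemma gdot_mxDl (F G : 'M[R]_m) x y : gdot (F + G) x y = gdot F x y + gdot G x y.
Proof. by rewrite /gdot mulmxDr mulmxDl mxE. Qed.

Lemma gdot_mxNl (F : 'M[R]_m) x y : gdot (- F) x y = - gdot F x y.
Proof. by rewrite /gdot mulmxN mulNmx mxE. Qed.

Lemma gdot_mxZl c (F : 'M[R]_m) x y : gdot (c *: F) x y = c * gdot F x y.
Proof. by rewrite /gdot -scalemxAr -scalemxAl mxE. Qed.

Lemma gdot_mulmx (F G : 'M[R]_m) x y : gdot (F *m G) x y = gdot F x (G *m y).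
Proof. by rewrite /gdot !mulmxA. Qed.

Lemma gdot_trmul (F G : 'M[R]_m) x y : gdot (G^T *m F) x y = gdot F (G *m x) y.
Proof. by rewrite /gdot trmx_mul !mulmxA. Qed.

Lemma gdot_col_row (c : 'cV[R]_m) (r : 'rV[R]_m) x y :
  gdot (c *m r) x y = (x^T *m c) 0 0 * ev r y.
Proof. by rewrite /gdot /ev mulmxA -mulmxA mxE big_ord1. Qed.

Lemma ev_trmx (c : 'cV[R]_m) x : ev c^T x = (x^T *m c) 0 0.
Proof.
have -> : (x^T *m c) 0 0 = (x^T *m c)^T 0 0 by rewrite [RHS]mxE.
by rewrite trmx_mul trmxK.
Qed.

Lemma derive_gdot (F : 'cV[R]_m -> 'M[R]_m) z w x y :
  differentiable F z ->
  'D_w (fun t => gdot (F t) x y : R^o) z = gdot ('D_w F z) x y.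
Proof.
move=> dF; rewrite /gdot -derive_mxE; last first.
  by apply: differentiable_mulmx => //; apply: differentiable_mulmx.
rewrite derive_mulmx //; last by apply: differentiable_mulmx.
rewrite derive_mulmx // !derive_cst mul0mx mulmx0 addr0 add0r //.
Qed.

Lemma derive_ev (r : 'cV[R]_m -> 'rV[R]_m) z w y :
  differentiable r z ->
  'D_w (fun t => ev (r t) y : R^o) z = ev ('D_w r z) y.
Proof.
move=> dr; rewrite /ev -derive_mxE; last exact: differentiable_mulmx.
by rewrite derive_mulmx // derive_cst mulmx0 addr0.
Qed.

(** Row i is the derivative in the direction of the i-th coordinate, so that this
    matrix minus its transpose is twice the exterior derivative. *)
Definition form_jac (a : 'cV[R]_m -> 'rV[R]_m) (z : 'cV[R]_m) : 'M[R]_m :=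
  \matrix_(i, j) ('D_(delta_mx i 0) a z) 0 j.

Lemma gdot_form_jac (a : 'cV[R]_m -> 'rV[R]_m) z x y :
  differentiable a z -> gdot (form_jac a z) x y = ev ('D_x a z) y.
Proof.
move=> da; rewrite /gdot /ev; congr ((_ *m _) 0 0); apply/matrixP => i j.
rewrite (derive_coord _ da) !mxE summxE ord1; apply: eq_bigr => k _.
by rewrite !mxE.
Qed.

(** The identity d(da) = 0: the second derivatives of a cancel in pairs. *)
Lemma closed_exterior_derivative (A : set 'cV[R]_m) (a : 'cV[R]_m -> 'rV[R]_m) z w x y :
  open A -> A z -> ck 2 A a ->
  let F := fun t => form_jac a t - (form_jac a t)^T in
  differentiable F z /\
  gdot ('D_w F z) x y + gdot ('D_x F z) y w + gdot ('D_y F z) w x = 0.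
Proof.
move=> oA Az ca F.
have da t : A t -> differentiable a t by exact: ca.1.
have dDa v t : A t -> differentiable (fun t => 'D_v a t) t by exact: (ca.2 v).1.
have dF : differentiable F z.
  apply/differentiable_mxP => i j.
  have -> : (fun t => F t i j : R^o) = (fun t => ('D_(delta_mx i 0) a t) 0 j : R^o)
      - (fun t => ('D_(delta_mx j 0) a t) 0 i : R^o).
    by apply/funext => t; rewrite !mxE.
  apply: differentiableB.
    exact: ((differentiable_mxP _ _).1 (dDa (delta_mx i 0) z Az) 0 j).
  exact: ((differentiable_mxP _ _).1 (dDa (delta_mx j 0) z Az) 0 i).
split=> //.
pose al v t : R^o := ev (a t) v.
have cal v : ck 2 A (al v).
  have caj j := (ck_mxP 2 a oA).1 ca 0 j.
  apply: (ck_eq oA _ (ck_sum oA (fun j => ckM oA (caj j) (ck_cst 2 A (v j 0 : R^o))))).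
  by move=> t At; rewrite /al /ev mxE.
have FE u v t : A t -> gdot (F t) u v = 'D_u (al v) t - 'D_v (al u) t.
  move=> At; rewrite gdot_mxDl gdot_mxNl gdot_trmx !gdot_form_jac; [|exact: da..].
  by rewrite /al !derive_ev//; exact: da.
have DFE u v t : gdot ('D_t F z) u v
    = 'D_t (fun t => 'D_u (al v) t : R^o) z - 'D_t (fun t => 'D_v (al u) t : R^o) z.
  rewrite -derive_gdot//.
  rewrite -deriveB; last 2 first.
  - by apply: diff_derivable; exact: ((cal v).2 u).1.
  - by apply: diff_derivable; exact: ((cal u).2 v).1.
  apply: near_eq_derive; apply: filterS (open_near oA Az) => t' At'.
  exact: FE.
have [H [HE Hs]] : exists H : 'cV[R]_m -> 'cV[R]_m -> 'cV[R]_m -> R,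
    (forall u v t, gdot ('D_t F z) u v = H t u v - H t v u) /\
    (forall t u v, H t u v = H u t v).
  exists (fun t u v => 'D_t (fun t => 'D_u (al v) t : R^o) z).
  by split=> [|t u v]; [exact: DFE|exact: derive_sym oA Az (cal v)].
transitivity (H w x y - H w y x + (H x y w - H x w y) + (H y w x - H y x w)).
  by congr (_ + _ + _); exact: HE.
rewrite (Hs x w) (Hs y x) (Hs w y); ring.
Qed.

End LocalForms.

(** * Covariant derivatives in coordinates *)

(** Proves an identity in an additive group of matrices, the entries of which
    are non-commutative products; each product is treated as an indeterminate. *)
Ltac mx_ring :=
  rewrite ?(mulmxDl, mulmxDr, mulmxBl, mulmxBr, mulNmx, mulmxN, mulmxA);
  repeat match goal with |- context [@mulmx ?R ?a ?b ?c ?A ?B] =>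
    let X := fresh "X" in set X := (@mulmx R a b c A B); clearbody X end;
  let i := fresh "i" in let j := fresh "j" in
  apply/matrixP => i j; rewrite !mxE; ring.

Lemma trmxD {R : pzRingType} {a b : nat} (F G : 'M[R]_(a, b)) : (F + G)^T = F^T + G^T.
Proof. exact: raddfD. Qed.

Lemma trmxN {R : pzRingType} {a b : nat} (F : 'M[R]_(a, b)) : (- F)^T = - F^T.
Proof. exact: raddfN. Qed.

Lemma derive_add {R : realType} {V W : normedModType R} (F G : V -> W) (z w : V) :
  differentiable F z -> differentiable G z ->
  'D_w (fun t => F t + G t) z = 'D_w F z + 'D_w G z.
Proof.
by move=> dF dG; rewrite -[fun t => _]/(F + G) deriveD//; exact: diff_derivable.
Qed.

Lemma derive_opp {R : realType} {V W : normedModType R} (F : V -> W) (z w : V) :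
  differentiable F z -> 'D_w (fun t => - F t) z = - 'D_w F z.
Proof. by move=> dF; rewrite -[fun t => _]/(- F) deriveN//; exact: diff_derivable. Qed.

Section CovariantDerivative.
Context {R : realType} {m : nat}.
Variables (conn : 'cV[R]_m -> 'M[R]_m) (z : 'cV[R]_m).
Implicit Types (w x y : 'cV[R]_m) (F G : 'cV[R]_m -> 'M[R]_m)
  (U : 'cV[R]_m -> 'cV[R]_m) (a : 'cV[R]_m -> 'rV[R]_m).

(** Covariant derivatives at z of an endomorphism, a vector field and a 1-form
    given in coordinates; conn w is the matrix y |-> Gamma(w, y). *)
Definition nabla_endo F w : 'M[R]_m :=
  'D_w F z + conn w *m F z - F z *m conn w.
Definition nabla_vec U w : 'cV[R]_m := 'D_w U z + conn w *m U z.
Definition nabla_form a w : 'rV[R]_m := 'D_w a z - a z *m conn w.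

Lemma nabla_endo_mul F G w : differentiable F z -> differentiable G z ->
  nabla_endo (fun t => F t *m G t) w = nabla_endo F w *m G z + F z *m nabla_endo G w.
Proof.
move=> dF dG; rewrite /nabla_endo derive_mulmx//.
move: ('D_w F z) ('D_w G z) => f g; mx_ring.
Qed.

Lemma nabla_vec_mul F U w : differentiable F z -> differentiable U z ->
  nabla_vec (fun t => F t *m U t) w = nabla_endo F w *m U z + F z *m nabla_vec U w.
Proof.
move=> dF dU; rewrite /nabla_endo /nabla_vec derive_mulmx//.
move: ('D_w F z) ('D_w U z) => f g; mx_ring.
Qed.

Lemma nabla_form_mul a F w : differentiable F z -> differentiable a z ->
  nabla_form (fun t => a t *m F t) w = nabla_form a w *m F z + a z *m nabla_endo F w.
Proof.
move=> dF da; rewrite /nabla_endo /nabla_form derive_mulmx//.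
move: ('D_w F z) ('D_w a z) => f g; mx_ring.
Qed.

Lemma nabla_outer U a w : differentiable U z -> differentiable a z ->
  nabla_endo (fun t => U t *m a t) w = nabla_vec U w *m a z + U z *m nabla_form a w.
Proof.
move=> dU da; rewrite /nabla_endo /nabla_form /nabla_vec derive_mulmx//.
move: ('D_w U z) ('D_w a z) => f g; mx_ring.
Qed.

Lemma nabla_endoD F G w : differentiable F z -> differentiable G z ->
  nabla_endo (fun t => F t + G t) w = nabla_endo F w + nabla_endo G w.
Proof.
move=> dF dG; rewrite /nabla_endo derive_add//.
move: ('D_w F z) ('D_w G z) => f g; mx_ring.
Qed.

Lemma nabla_scalar c w : nabla_endo (fun=> c%:M) w = 0.
Proof. by rewrite /nabla_endo derive_cst add0r mul_mx_scalar mul_scalar_mx subrr. Qed.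

Lemma nabla_endo_near F G w : (\near z, F z = G z) -> nabla_endo F w = nabla_endo G w.
Proof.
move=> FG; have FGz : F z = G z := nbhs_singleton FG.
by rewrite /nabla_endo (near_eq_derive w FG) FGz.
Qed.

Lemma nabla_vec_near U U' w : (\near z, U z = U' z) -> nabla_vec U w = nabla_vec U' w.
Proof.
move=> FG; have FGz : U z = U' z := nbhs_singleton FG.
by rewrite /nabla_vec (near_eq_derive w FG) FGz.
Qed.

Lemma nabla_form_near a a' w : (\near z, a z = a' z) -> nabla_form a w = nabla_form a' w.
Proof.
move=> FG; have FGz : a z = a' z := nbhs_singleton FG.
by rewrite /nabla_form (near_eq_derive w FG) FGz.
Qed.

Lemma nabla_vec0 w : nabla_vec (fun=> 0) w = 0.
Proof. by rewrite /nabla_vec derive_cst mulmx0 addr0. Qed.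

Lemma nabla_kernel F U w : differentiable F z -> differentiable U z ->
  (\forall t \near z, F t *m U t = 0) ->
  nabla_endo F w *m U z = - (F z *m nabla_vec U w).
Proof.
move=> dF dU FU; apply/eqP; rewrite -addr_eq0 -nabla_vec_mul//.
by rewrite (nabla_vec_near _ FU) nabla_vec0.
Qed.

Lemma nabla_formN a w : differentiable a z -> nabla_form (fun t => - a t) w = - nabla_form a w.
Proof.
move=> dU; rewrite /nabla_form derive_opp//.
move: ('D_w a z) => f; mx_ring.
Qed.

Section Metric.
Variable g : 'cV[R]_m -> 'M[R]_m.
Hypotheses (dg : differentiable g z) (gsym : \forall t \near z, (g t)^T = g t)
  (conn_metric : forall w, 'D_w g z = (conn w)^T *m g z + g z *m conn w).

(** A metric connection commutes with the lowering of indices. *)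
Lemma nabla_form_dual U a w : differentiable U z ->
  (\forall t \near z, (U t)^T *m g t = a t) ->
  nabla_form a w = (nabla_vec U w)^T *m g z.
Proof.
move=> dU Ua; rewrite -(nabla_form_near w Ua) /nabla_form /nabla_vec.
rewrite derive_mulmx//; last exact: differentiable_trmx.
rewrite derive_trmx// conn_metric; move: ('D_w U z) => f.
rewrite trmxD trmx_mul; mx_ring.
Qed.

(** For a metric connection, differentiating the skewness of F gives that of its
    covariant derivative. *)
Lemma nabla_endo_skew F w : differentiable F z ->
  (\forall t \near z, (g t *m F t)^T = - (g t *m F t)) ->
  (g z *m nabla_endo F w)^T = - (g z *m nabla_endo F w).
Proof.
move=> dF sk.
have gs : (g z)^T = g z := nbhs_singleton gsym.
have sk0 : (g z *m F z)^T = - (g z *m F z) := nbhs_singleton sk.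
have := near_eq_derive w sk.
have dgF : differentiable (fun t => g t *m F t) z by exact: differentiable_mulmx.
rewrite derive_trmx// derive_opp// derive_mulmx// conn_metric /nabla_endo; move: ('D_w F z) => f.
have skF : (F z)^T *m g z = - (g z *m F z) by rewrite -sk0 trmx_mul gs.
have sk1 : (F z)^T *m g z *m conn w = - (g z *m F z *m conn w) by rewrite skF mulNmx.
have sk2 : (conn w)^T *m ((F z)^T *m g z) = - ((conn w)^T *m (g z *m F z)).
  by rewrite skF mulmxN.
rewrite !(mulmxDl, mulmxDr, mulmxN, mulNmx, trmxD, trmxN, trmx_mul, trmxK) gs.
rewrite !mulmxA in sk1 sk2 *.
move: sk1 sk2.
repeat match goal with |- context [@mulmx ?R ?a ?b ?c ?A ?B] =>
    let X := fresh "X" in set X := (@mulmx R a b c A B); clearbody X end.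
move=> /matrixP e1 /matrixP e2 /matrixP e3; apply/matrixP => i j.
by move: (e1 i j) (e2 i j) (e3 i j); rewrite !mxE; lra.
Qed.

End Metric.

End CovariantDerivative.

(** * From structure equations on a coordinate domain to one point *)

Lemma ev_eq0 {R : realType} {m : nat} (r : 'rV[R]_m) (x : 'cV[R]_m) :
  ev r x = 0 -> r *m x = 0.
Proof. by rewrite [r *m x]mx11_scalar -/(ev r x) => ->; rewrite raddf0. Qed.

Lemma mul_col_ev {R : realType} {m : nat} (c : 'cV[R]_m) (r : 'rV[R]_m) (x : 'cV[R]_m) :
  c *m (r *m x) = ev r x *: c.
Proof. by rewrite [r *m x]mx11_scalar mul_mx_scalar. Qed.

Section HalfContactChart.
Context {R : realType} {m : nat}.
Variables (g P Q : 'cV[R]_m -> 'M[R]_m) (a b s : 'cV[R]_m -> 'rV[R]_m)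
  (Ua Ub : 'cV[R]_m -> 'cV[R]_m) (conn : 'cV[R]_m -> 'M[R]_m)
  (A : set 'cV[R]_m) (z : 'cV[R]_m).
Implicit Types (x y w : 'cV[R]_m).

(** The data of half_contact on a coordinate domain A around z, before
    differentiation. *)
Record half_contact_chart : Prop := HalfContactChart {
  hcc_open : open A;
  hcc_mem : A z;
  hcc_dg : differentiable g z;
  hcc_dP : differentiable P z;
  hcc_db : differentiable b z;
  hcc_dUa : differentiable Ua z;
  hcc_dUb : differentiable Ub z;
  hcc_a : ck 2 A a;
  hcc_sym : forall t, A t -> (g t)^T = g t;
  hcc_skew : forall t, A t -> (g t *m P t)^T = - (g t *m P t);
  hcc_PP : forall t, A t -> P t *m P t = - 1%:M + Ua t *m a t + Ub t *m b t;
  hcc_PUa : forall t, A t -> P t *m Ua t = 0;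
  hcc_PUb : forall t, A t -> P t *m Ub t = 0;
  hcc_Ua : forall t, A t -> (Ua t)^T *m g t = a t;
  hcc_Ub : forall t, A t -> (Ub t)^T *m g t = b t;
  hcc_bUb : forall t, A t -> b t *m Ub t = 1%:M;
  hcc_Qskew : (g z *m Q z)^T = - (g z *m Q z);
  hcc_QUa : Q z *m Ua z = 0;
  hcc_QUb : Q z *m Ub z = 0;
  hcc_QP : Q z *m P z = - (P z *m Q z);
  hcc_orth : gdot (g z) (Ub z) (Ua z) = 0;
  hcc_metric : forall w, 'D_w g z = (conn w)^T *m g z + g z *m conn w;
  hcc_torsion : forall w y, conn w *m y = conn y *m w;
  hcc_da : forall t, A t -> form_jac a t - (form_jac a t)^T =
    2 *: (g t *m P t) + (s t)^T *m b t - (b t)^T *m s t;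
  hcc_dbE : form_jac b z - (form_jac b z)^T =
    2 *: (g z *m Q z) - (s z)^T *m a z + (a z)^T *m s z;
  hcc_nij : forall x y w, orth2 (g z) (Ua z) (Ub z) x ->
    orth2 (g z) (Ua z) (Ub z) y -> orth2 (g z) (Ua z) (Ub z) w ->
    gdot (g z) ('D_(P z *m x) P z *m y - 'D_(P z *m y) P z *m x
            - P z *m ('D_x P z *m y) + P z *m ('D_y P z *m x)) w =
    gdot (g z) (ev (s z) (P z *m x) *: (Q z *m y) - ev (s z) (P z *m y) *: (Q z *m x)
            - ev (s z) x *: (P z *m (Q z *m y)) + ev (s z) y *: (P z *m (Q z *m x))) w;
  hcc_nijU : forall y, orth2 (g z) (Ua z) (Ub z) y ->
    - ('D_(P z *m y) P z *m Ua z) - P z *m ('D_(Ua z) P z *m y)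
      + P z *m ('D_y P z *m Ua z) = - (ev (s z) (Ua z) *: (P z *m (Q z *m y))) }.

Hypothesis hcc : half_contact_chart.

Let Anear : nbhs z A. Proof. exact: open_near (hcc_open hcc) (hcc_mem hcc). Qed.
Let Az : A z. Proof. exact: hcc_mem hcc. Qed.

Let da : differentiable a z. Proof. exact: (hcc_a hcc).1. Qed.

Let gnear : \forall t \near z, (g t)^T = g t.
Proof. by apply: filterS Anear => t; exact: hcc_sym. Qed.

Let conn0 : conn 0 = 0.
Proof. by apply: mulmx_cV_inj => y; rewrite (hcc_torsion hcc) mulmx0 mul0mx. Qed.

Lemma ev_dual x : ev (a z) x = gdot (g z) (Ua z) x.
Proof. by rewrite /ev -(hcc_Ua hcc Az). Qed.

Lemma ev_dualb x : ev (b z) x = gdot (g z) (Ub z) x.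
Proof. by rewrite /ev -(hcc_Ub hcc Az). Qed.

Lemma gdot_skew (F : 'M[R]_m) x y : (g z *m F)^T = - (g z *m F) ->
  gdot (g z) (F *m x) y = - gdot (g z) x (F *m y).
Proof.
move=> sk; rewrite -gdot_trmul -gdot_mulmx -gdot_mxNl -sk trmx_mul.
by rewrite (hcc_sym hcc Az).
Qed.

(** The connection is torsion-free, so its coefficients cancel in the Nijenhuis
    tensor. *)
Lemma nijenhuis_nabla x y :
  'D_(P z *m x) P z *m y - 'D_(P z *m y) P z *m x
     - P z *m ('D_x P z *m y) + P z *m ('D_y P z *m x) =
  nabla_endo conn z P (P z *m x) *m y - nabla_endo conn z P (P z *m y) *m x
     - P z *m (nabla_endo conn z P x *m y) + P z *m (nabla_endo conn z P y *m x).
Proof.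
rewrite /nabla_endo.
move: ('D_(P z *m x) P z) ('D_(P z *m y) P z) ('D_x P z) ('D_y P z) => d1 d2 d3 d4.
rewrite !(mulmxDl, mulNmx, mulmxDr, mulmxN) -!mulmxA.
rewrite (hcc_torsion hcc x (P z *m y)) (hcc_torsion hcc y (P z *m x)).
rewrite (hcc_torsion hcc y x) (hcc_torsion hcc (P z *m y) (P z *m x)) !mulmxA.
repeat match goal with |- context [@mulmx ?R ?a ?b ?c ?A ?B] =>
    let X := fresh "X" in set X := (@mulmx R a b c A B); clearbody X end.
by apply/matrixP => i j; rewrite !mxE; ring.
Qed.

(** This is d(da) = 0 on vectors killed by b, for da = g(., P .) + s /\ b.  The
    terms with a derivative of s carry a factor b and vanish; the others involve
    only db, where the terms in s /\ a cancel in the cyclic sum. *)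
Lemma closed_nabla x y w : ev (b z) x = 0 -> ev (b z) y = 0 -> ev (b z) w = 0 ->
  gdot (g z) y (nabla_endo conn z P x *m w) + gdot (g z) w (nabla_endo conn z P y *m x)
    + gdot (g z) x (nabla_endo conn z P w *m y) =
  ev (s z) x * gdot (g z) y (Q z *m w) + ev (s z) y * gdot (g z) w (Q z *m x)
    + ev (s z) w * gdot (g z) x (Q z *m y).
Proof.
have gs := hcc_sym hcc Az.
have dP := hcc_dP hcc; have dg := hcc_dg hcc.
move=> bx by_ bw.
have [dF cyc] := closed_exterior_derivative x y w (hcc_open hcc) Az (hcc_a hcc).
set F := (fun t => form_jac a t - (form_jac a t)^T) in dF cyc *.
(* s need not be differentiable; tau is, and it differs from s by a multiple
   of b, so that it can replace s in the product with b *)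
pose tau t := F t *m Ub t.
have dtau : differentiable tau z by exact: differentiable_mulmx (hcc_dUb hcc).
have tauE t : A t -> exists c, (s t)^T = tau t + c *: (b t)^T.
  move=> At; exists ((s t *m Ub t) 0 0).
  rewrite /tau /F (hcc_da hcc At) !mulmxDl mulNmx -!mulmxA -scalemxAl -mulmxA.
  rewrite (hcc_PUb hcc At) mulmx0 scaler0 add0r (hcc_bUb hcc At) mulmx1.
  by rewrite {1}[s t *m Ub t]mx11_scalar mul_mx_scalar subrK.
have FE : \forall t \near z, F t = 2 *: (g t *m P t) + tau t *m b t - (tau t *m b t)^T.
  apply: filterS Anear => t At; have [c sE] := tauE t At.
  rewrite {1}/F (hcc_da hcc At) -[s t]trmxK sE trmxK trmx_mul.
  rewrite !(mulmxDl, mulmxDr, trmxD, linearZ) /= trmxK.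
  rewrite -?scalemxAl -?scalemxAr.
  set X := 2 *: _; set Y := c *: _; set Z := tau t *m _.
  by set W := _ *m (tau t)^T; apply/matrixP => i j; rewrite !mxE; ring.
have dtb : differentiable (fun t => tau t *m b t) z.
  by apply: differentiable_mulmx => //; exact: (hcc_db hcc).
have dgP : differentiable (fun t => g t *m P t) z by exact: differentiable_mulmx.
have DFE u : 'D_u F z = 2 *: 'D_u (fun t => g t *m P t) z
    + 'D_u (fun t => tau t *m b t) z - ('D_u (fun t => tau t *m b t) z)^T.
  rewrite (near_eq_derive u FE) derive_add; last 2 first.
  - apply: differentiableD => //; exact: differentiableZ.
  - by apply: differentiableN; exact: differentiable_trmx.
  rewrite derive_opp; last exact: differentiable_trmx.
  rewrite derive_trmx// derive_add//; last exact: differentiableZ.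
  by rewrite deriveZ//; exact: diff_derivable.
have DtbE u p q : ev (b z) p = 0 -> ev (b z) q = 0 ->
    gdot ('D_u (fun t => tau t *m b t) z) p q = (p^T *m tau z) 0 0 * ev ('D_u b z) q.
  move=> bp bq; rewrite derive_mulmx//; last exact: (hcc_db hcc).
  by rewrite gdot_mxDl !gdot_col_row bq mulr0 add0r.
have DgPE u p q : gdot ('D_u (fun t => g t *m P t) z) p q =
    gdot (g z) p (nabla_endo conn z P u *m q)
    + gdot (g z) (conn u *m p) (P z *m q) - gdot (g z) (P z *m p) (conn u *m q).
  rewrite derive_mulmx// (hcc_metric hcc) /nabla_endo; move: ('D_u P z) => f.
  rewrite (gdot_skew p _ (hcc_skew hcc Az)) opprK.
  rewrite mulmxDl !gdot_mxDl -!mulmxA gdot_trmul !gdot_mulmx -!mulmxA.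
  by rewrite !mulmxDl mulNmx !gdotE -!mulmxA; ring.
have tauS p : ev (b z) p = 0 -> (p^T *m tau z) 0 0 = ev (s z) p.
  move=> bp; have [c sE] := tauE z Az.
  rewrite -[s z]trmxK ev_trmx sE mulmxDr [RHS]mxE -scalemxAr [X in _ + X]mxE.
  by rewrite -(ev_trmx (b z)^T) trmxK bp mulr0 addr0.
have dbE p q : ev ('D_p b z) q - ev ('D_q b z) p =
   2 * gdot (g z) p (Q z *m q) - ev (s z) p * ev (a z) q + ev (a z) p * ev (s z) q.
  have := congr1 (fun F => gdot F p q) (hcc_dbE hcc).
  rewrite gdot_mxDl gdot_mxNl gdot_trmx !gdot_form_jac; [|exact: (hcc_db hcc)..].
  move=> ->; rewrite !gdot_mxDl gdot_mxNl gdot_mxZl !gdot_col_row gdot_mulmx.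
  by rewrite -!ev_trmx !trmxK.
have term u p q : ev (b z) p = 0 -> ev (b z) q = 0 -> gdot ('D_u F z) p q =
   2 * (gdot (g z) p (nabla_endo conn z P u *m q)
    + gdot (g z) (conn u *m p) (P z *m q) - gdot (g z) (P z *m p) (conn u *m q))
   + ev (s z) p * ev ('D_u b z) q - ev (s z) q * ev ('D_u b z) p.
  move=> bp bq; rewrite DFE !gdot_mxDl gdot_mxNl gdot_mxZl gdot_trmx.
  by rewrite DgPE !DtbE// !tauS.
have gC p q : gdot (g z) p q = gdot (g z) q p by exact: gdotC.
have [E [T [TE EE cycT]]] : exists (E : 'cV[R]_m -> 'cV[R]_m -> R) T,
    [/\ forall u p q, ev (b z) p = 0 -> ev (b z) q = 0 -> T u p q =
         2 * (gdot (g z) p (nabla_endo conn z P u *m q)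
           + gdot (g z) (conn u *m p) (P z *m q) - gdot (g z) (P z *m p) (conn u *m q))
         + ev (s z) p * E u q - ev (s z) q * E u p,
       forall p q, E p q - E q p = 2 * gdot (g z) p (Q z *m q)
         - ev (s z) p * ev (a z) q + ev (a z) p * ev (s z) q &
       T x y w + T y w x + T w x y = 0].
  exists (fun u p => ev ('D_u b z) p), (fun u p q => gdot ('D_u F z) p q).
  by split.
rewrite (TE x y w)// (TE y w x)// (TE w x y)// in cycT.
have e1 := congr1 (fun c => ev (s z) y * c) (EE x w).
have e2 := congr1 (fun c => ev (s z) w * c) (EE y x).
have e3 := congr1 (fun c => ev (s z) x * c) (EE w y).
move: cycT e1 e2 e3.
rewrite (hcc_torsion hcc y x) (hcc_torsion hcc w x) (hcc_torsion hcc w y).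
rewrite !(gC (P z *m _)).
have Qsk p q : gdot (g z) p (Q z *m q) = - gdot (g z) q (Q z *m p).
  by rewrite gC (gdot_skew _ _ (hcc_Qskew hcc)).
rewrite (Qsk x w) (Qsk y x) (Qsk w y).
clear -hcc; move=> *; lra.
Qed.

Lemma half_contact_at :
  half_contact (g z) (P z) (Q z) (Ua z) (Ub z) (nabla_endo conn z P)
    (nabla_vec conn z Ua) (ev (s z)).
Proof.
have dP := hcc_dP hcc; have dg := hcc_dg hcc.
have dUa := hcc_dUa hcc; have dUb := hcc_dUb hcc.
split.
- exact: (hcc_sym hcc Az).
- exact: hcc_orth.
- exact: (hcc_PUa hcc Az).
- exact: (hcc_PUb hcc Az).
- exact: hcc_QUa.
- exact: hcc_QUb.
- by move=> x y; apply: gdot_skew; exact: (hcc_skew hcc Az).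
- by move=> x y; apply: gdot_skew; exact: hcc_Qskew.
- move=> x [xa xb]; rewrite mulmxA (hcc_PP hcc Az) !mulmxDl mulNmx mul1mx -!mulmxA.
  have -> : a z *m x = 0.
    by apply: ev_eq0; rewrite ev_dual gdotC// (hcc_sym hcc Az).
  have -> : b z *m x = 0.
    by apply: ev_eq0; rewrite ev_dualb gdotC// (hcc_sym hcc Az).
  by rewrite !mulmx0 !addr0.
- by move=> x; rewrite mulmxA (hcc_QP hcc) mulNmx mulmxA.
- move=> w x y; apply: gdot_skew; apply: nabla_endo_skew => //.
    exact: (hcc_metric hcc).
  by apply: filterS Anear => t; exact: (hcc_skew hcc).
- move=> w y x [ya yb] [xa xb].
  have E : \forall t \near z, P t *m P t = (- 1)%:M + Ua t *m a t + Ub t *m b t.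
    by apply: filterS Anear => t At; rewrite (hcc_PP hcc At) raddfN.
  have db := hcc_db hcc.
  have dUaa : differentiable (fun t => Ua t *m a t) z by exact: differentiable_mulmx.
  have dUbb : differentiable (fun t => Ub t *m b t) z by exact: differentiable_mulmx.
  have dc : differentiable (fun=> (- 1)%:M : 'M[R]_m) z by exact: differentiable_cst.
  have dca : differentiable (fun t => (- 1)%:M + Ua t *m a t : 'M[R]_m) z.
    exact: differentiableD dc dUaa.
  have := nabla_endo_near conn w E.
  rewrite nabla_endo_mul// nabla_endoD// nabla_endoD// nabla_scalar add0r !nabla_outer//.
  move=> /(congr1 (fun F => gdot (g z) (F *m y) x)).
  have ay : a z *m y = 0 by apply: ev_eq0; rewrite ev_dual gdotC// (hcc_sym hcc Az).
  have by0 : b z *m y = 0 by apply: ev_eq0; rewrite ev_dualb gdotC// (hcc_sym hcc Az).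
  move: (nabla_endo conn z P w) (nabla_vec conn z Ua w) (nabla_vec conn z Ub w).
  move: (nabla_form conn z a w) (nabla_form conn z b w) => na nb nP nUa nUb.
  rewrite !mulmxDl -!mulmxA ay by0 !mulmx0 !add0r !gdotE => ->.
  rewrite (mul_col_ev (Ua z)) (mul_col_ev (Ub z)) !gdotE.
  by rewrite ![gdot _ _ x]gdotC ?(hcc_sym hcc Az)// xa xb !mulr0 addr0.
- by move=> w; apply: nabla_kernel => //; apply: filterS Anear; exact: (hcc_PUa hcc).
- move=> x y w xb yb wb; apply: closed_nabla; rewrite ev_dualb //.
- by move=> x y w hx hy hw; rewrite -nijenhuis_nabla; exact: (hcc_nij hcc).
- move=> y hy; rewrite -(hcc_nijU hcc hy).
  have := nijenhuis_nabla (Ua z) y.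
  have nP0 : nabla_endo conn z P 0 = 0.
    by rewrite /nabla_endo derive0 conn0 mulmx0 mul0mx oppr0 !addr0.
  by rewrite (hcc_PUa hcc Az) nP0 derive0 mul0mx !sub0r => ->.
- move=> x y [_ xb] [_ yb].
  have E : \forall t \near z, (Ua t)^T *m g t = a t by apply: filterS Anear; exact: (hcc_Ua hcc).
  have nE p q : gdot (g z) (nabla_vec conn z Ua p) q = ev ('D_p a z) q - ev (a z) (conn p *m q).
    rewrite /gdot -(nabla_form_dual dg (hcc_metric hcc) p dUa E) /nabla_form mulmxBl mxE.
    by congr (_ + _); rewrite mxE -mulmxA.
  have /(congr1 (fun F => gdot F x y)) := hcc_da hcc Az.
  rewrite !gdot_mxDl !gdot_mxNl gdot_trmx gdot_mxZl !gdot_form_jac// !gdot_col_row.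
  rewrite -!ev_trmx !trmxK gdot_mulmx !ev_dualb.
  rewrite ![gdot _ (Ub z) _]gdotC ?(hcc_sym hcc Az)// xb yb !nE (hcc_torsion hcc y x).
  move: (ev ('D_x a z) y) (ev ('D_y a z) x) => u v e; lra.
Qed.

End HalfContactChart.

(** * Expressions of tensors in a chart *)

Section ChartExpressions.
Context {R : realType} {m : nat} {M : topologicalType} (A : manifold R m M) (P : M).

Local Notation phi := (cmap (chart_at A P)).
Local Notation psi := (cinv (chart_at A P)).
Local Notation dom := (cdom (chart_at A P)).
Local Notation T q := (transition_jac A P q q).
Local Notation T' q := (transition_jac A q P q).

(** Expressions, in the chart at P, of a bilinear form, an endomorphism, a
    vector field and a 1-form. *)
Definition loc_metric (g : M -> 'M[R]_m) (t : 'cV[R]_m) : 'M[R]_m :=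
  (T' (psi t))^T *m g (psi t) *m T' (psi t).
Definition loc_endo (F : M -> 'M[R]_m) (t : 'cV[R]_m) : 'M[R]_m :=
  T (psi t) *m F (psi t) *m T' (psi t).
Definition loc_vec (X : M -> 'cV[R]_m) (t : 'cV[R]_m) : 'cV[R]_m :=
  T (psi t) *m X (psi t).
Definition loc_form (a : M -> 'rV[R]_m) (t : 'cV[R]_m) : 'rV[R]_m :=
  a (psi t) *m T' (psi t).

Lemma TK q : dom q -> T q *m T' q = 1%:M.
Proof. by move=> dq; apply: transition_jacK => //; exact: chart_atP. Qed.

Lemma TK' q : dom q -> T' q *m T q = 1%:M.
Proof. by move=> dq; apply: transition_jacK => //; exact: chart_atP. Qed.

Lemma T_id : T P = 1%:M.
Proof. by apply: transition_jac_id; exact: chart_atP. Qed.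

Let psiP : psi (phi P) = P. Proof. by rewrite cmapK//; exact: chart_atP. Qed.

Lemma loc_metric_at g : loc_metric g (phi P) = g P.
Proof. by rewrite /loc_metric psiP T_id trmx1 mul1mx mulmx1. Qed.

Lemma loc_endo_at F : loc_endo F (phi P) = F P.
Proof. by rewrite /loc_endo psiP T_id mul1mx mulmx1. Qed.

Lemma loc_vec_at X : loc_vec X (phi P) = X P.
Proof. by rewrite /loc_vec psiP T_id mul1mx. Qed.

Lemma loc_form_at a : loc_form a (phi P) = a P.
Proof. by rewrite /loc_form psiP T_id mulmx1. Qed.

Section Pointwise.
Variables (t : 'cV[R]_m) (dt : dom (psi t)).

Lemma loc_endo_mul F G :
  loc_endo (fun q => F q *m G q) t = loc_endo F t *m loc_endo G t.
Proof.
rewrite /loc_endo; move: (T _) (T' _) (TK' dt) => S S' SK.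
by rewrite -!mulmxA (mulmxA S') SK mul1mx.
Qed.

Lemma loc_vec_mul F X : loc_vec (fun q => F q *m X q) t = loc_endo F t *m loc_vec X t.
Proof.
rewrite /loc_endo /loc_vec; move: (T _) (T' _) (TK' dt) => S S' SK.
by rewrite -!mulmxA (mulmxA S') SK mul1mx.
Qed.

Lemma loc_form_mul a F : loc_form (fun q => a q *m F q) t = loc_form a t *m loc_endo F t.
Proof.
rewrite /loc_endo /loc_form; move: (T _) (T' _) (TK' dt) => S S' SK.
by rewrite -!mulmxA (mulmxA S') SK mul1mx.
Qed.

Lemma loc_outer X a : loc_endo (fun q => X q *m a q) t = loc_vec X t *m loc_form a t.
Proof.
by rewrite /loc_endo /loc_form /loc_vec; move: (T _) (T' _) => S S'; rewrite !mulmxA.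
Qed.

Lemma loc_pair a X : a (psi t) *m X (psi t) = loc_form a t *m loc_vec X t.
Proof.
rewrite /loc_form /loc_vec; move: (T _) (T' _) (TK' dt) => S S' SK.
by rewrite -!mulmxA (mulmxA S') SK mul1mx.
Qed.

Lemma loc_metric_mul g F :
  loc_metric (fun q => g q *m F q) t = loc_metric g t *m loc_endo F t.
Proof.
rewrite /loc_metric /loc_endo; move: (T _) (T' _) (TK' dt) => S S' SK.
by rewrite -!mulmxA (mulmxA S') SK mul1mx.
Qed.

Lemma loc_dual X g : loc_form (fun q => (X q)^T *m g q) t = (loc_vec X t)^T *m loc_metric g t.
Proof.
rewrite /loc_form /loc_vec /loc_metric; move: (T _) (T' _) (TK' dt) => S S' SK.
by rewrite trmx_mul -!mulmxA (mulmxA S^T) -trmx_mul SK trmx1 mul1mx.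
Qed.

End Pointwise.

Lemma loc_metricE g t i j :
  loc_metric g t i j =
  gdot (g (psi t)) (cst_field A P (delta_mx i 0) (psi t)) (cst_field A P (delta_mx j 0) (psi t)).
Proof.
rewrite /gdot /cst_field /loc_metric; move: (T' _) (g _) => S h.
rewrite trmx_mul trmx_delta mulmxA -colE [RHS]mxE -!mulmxA -rowE [RHS]mxE.
by rewrite !mulmxA.
Qed.

Lemma loc_formE a t j : loc_form a t 0 j = ev (a (psi t)) (cst_field A P (delta_mx j 0) (psi t)).
Proof. by rewrite /ev /cst_field /loc_form; move: (T' _) => S; rewrite mulmxA -colE [RHS]mxE. Qed.

Lemma loc_endoE F t i j :
  loc_endo F t i j = (rep A id (fun q => F q *m cst_field A P (delta_mx j 0) q) P (psi t)) i 0.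
Proof.
rewrite repE /cst_field /loc_endo; move: (T _) (T' _) => S S'.
by rewrite !mulmxA -colE [RHS]mxE.
Qed.

Section Smoothness.
Variables (W : set M) (oW : open W) (WP : W P) (Wd : W `<=` dom).
Local Notation O := (phi @` (dom `&` W)).

Lemma loc_vec_smooth k X : smooth_field A W X -> ck k O (loc_vec X).
Proof.
move=> /(smooth_fieldP A X oW) h; apply/ck_mxP; first exact: chart_image_open.
by move=> i j; rewrite (ord1 j); exact: h.
Qed.

Lemma loc_endo_smooth k F : smooth_endo A W F -> ck k O (loc_endo F).
Proof.
move=> h; apply/ck_mxP; first exact: chart_image_open.
move=> i j.
have /(smooth_fieldP A _ oW) hj := h W (cst_field A P (delta_mx j 0)) oW (fun _ => id)
  (cst_field_smooth (p := P) (delta_mx j 0) oW Wd).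
apply: (ck_eq (chart_image_open _ oW) _ (hj P WP k i)) => t _.
by rewrite loc_endoE.
Qed.

Lemma loc_form_smooth k a : smooth_form A W a -> ck k O (loc_form a).
Proof.
move=> h; apply/ck_mxP; first exact: chart_image_open.
move=> i j; rewrite (ord1 i).
have hj := h W (cst_field A P (delta_mx j 0)) oW (fun _ => id)
  (cst_field_smooth (p := P) (delta_mx j 0) oW Wd).
apply: (ck_eq (chart_image_open _ oW) _ (hj P WP k)) => t _.
by rewrite loc_formE.
Qed.

Lemma loc_metric_smooth k g :
  (forall W X Y, open W -> smooth_field A W X -> smooth_field A W Y ->
    smooth_fun A W (fun q => gdot (g q) (X q) (Y q) : R^o)) ->
  ck k O (loc_metric g).
Proof.
move=> h; apply/ck_mxP; first exact: chart_image_open.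
move=> i j.
have hj := h W _ _ oW (cst_field_smooth (p := P) (delta_mx i 0) oW Wd)
  (cst_field_smooth (p := P) (delta_mx j 0) oW Wd).
apply: (ck_eq (chart_image_open _ oW) _ (hj P WP k)) => t _.
by rewrite loc_metricE.
Qed.

Lemma loc_mem : O (phi P).
Proof. by exists P => //; split=> //; exact: chart_atP. Qed.

End Smoothness.

Section Nijenhuis.
Variables (F : M -> 'M[R]_m) (X Y : M -> 'cV[R]_m).
Hypotheses (dF : differentiable (loc_endo F) (phi P))
  (dX : differentiable (loc_vec X) (phi P)) (dY : differentiable (loc_vec Y) (phi P)).

Let near_mul (Z : M -> 'cV[R]_m) :
  \forall t \near phi P, loc_endo F t *m loc_vec Z t = loc_vec (fun q => F q *m Z q) t.
Proof.
apply: filterS (chart_near openT (chart_atP A P) I) => t /chart_image_inv[dt _ _].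
by rewrite loc_vec_mul.
Qed.

Let derive_FZ (Z : M -> 'cV[R]_m) w : differentiable (loc_vec Z) (phi P) ->
  dir A (rep A id (fun q => F q *m Z q) P) P w
  = 'D_w (loc_endo F) (phi P) *m Z P + F P *m 'D_w (loc_vec Z) (phi P).
Proof.
move=> dZ; rewrite -[in RHS](loc_endo_at F) -[in RHS](loc_vec_at Z) -derive_mulmx//.
by rewrite (near_eq_derive w (near_mul Z)).
Qed.

(** The Nijenhuis tensor in coordinates; in particular it depends on the two
    fields only through their values at P. *)
Lemma nijenhuisE : nijenhuis A F X Y P =
  'D_(F P *m X P) (loc_endo F) (phi P) *m Y P
  - 'D_(F P *m Y P) (loc_endo F) (phi P) *m X P
  - F P *m ('D_(X P) (loc_endo F) (phi P) *m Y P)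
  + F P *m ('D_(Y P) (loc_endo F) (phi P) *m X P).
Proof.
rewrite /nijenhuis /bracket !derive_FZ//.
have dirE Z w : dir A (rep A id Z P) P w = 'D_w (loc_vec Z) (phi P) by [].
rewrite !dirE.
move: ('D_(F P *m X P) (loc_endo F) (phi P)) ('D_(F P *m Y P) (loc_endo F) (phi P)).
move: ('D_(X P) (loc_endo F) (phi P)) ('D_(Y P) (loc_endo F) (phi P)).
move: ('D_(F P *m X P) (loc_vec Y) (phi P)) ('D_(F P *m Y P) (loc_vec X) (phi P)).
move: ('D_(X P) (loc_vec Y) (phi P)) ('D_(Y P) (loc_vec X) (phi P)).
by move=> d1 d2 d3 d4 d5 d6 d7 d8; mx_ring.
Qed.

End Nijenhuis.

End ChartExpressions.

(** * The Levi-Civita connection and exterior derivatives in a chart *)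

Section ConnectionMatrix.
Context {R : realType} {m : nat} {M : topologicalType} (A : manifold R m M)
  (g : M -> 'M[R]_m) (P : M).
Implicit Types (w y : 'cV[R]_m).

Local Notation phi := (cmap (chart_at A P)).
Local Notation lg := (loc_metric A P g).

(** The matrix y |-> Gamma(w, y) of Christoffel symbols at P. *)
Definition conn_at w : 'M[R]_m :=
  \matrix_(k, j) \sum_i christoffel A g P k i j * w i 0.

Lemma nabla_alongE {d : nat} {N : topologicalType} (B : manifold R d N) (f : N -> M)
    (p : N) (v : 'cV[R]_d) (Y : N -> 'cV[R]_m) : f p = P ->
  nabla_along A g B f v Y p = dir B (rep A f Y p) p v + conn_at (tmap B A f p *m v) *m Y p.
Proof.
move=> fp; rewrite /nabla_along fp; congr (_ + _); apply/matrixP => k j.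
rewrite !mxE exchange_big /=; apply: eq_bigr => l _.
rewrite !mxE mulr_suml; apply: eq_bigr => i _.
by rewrite (ord1 j).
Qed.

Lemma nablaE (v : 'cV[R]_m) (Y : M -> 'cV[R]_m) :
  nabla A g v Y P = 'D_v (loc_vec A P Y) (phi P) + conn_at v *m Y P.
Proof.
rewrite /nabla (@nabla_alongE _ _ A id P)//; congr (_ + conn_at _ *m _).
by rewrite -[LHS]/(transition_jac A P P P *m v) T_id mul1mx.
Qed.

Hypotheses (gsym : forall p, (g p)^T = g p) (gunit : forall p, g p \in unitmx)
  (dg : differentiable lg (phi P)).

Let D c a b : R := ('D_(delta_mx c 0) lg (phi P)) a b.

Let christoffelE k i j : christoffel A g P k i j =
  2^-1 * \sum_l invmx (g P) k l * (D i j l + D j i l - D l i j).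
Proof.
have DE c a b : dir A (fun q => gdot (g q) (coord_field A P a q) (coord_field A P b q) : R^o)
    P (delta_mx c 0) = D c a b.
  apply: esym; apply: etrans (derive_mxE (delta_mx c 0) a b dg) _.
  have -> : (fun t => lg t a b : R^o) = (fun q => gdot (g q) (coord_field A P a q)
      (coord_field A P b q) : R^o) \o cinv (chart_at A P); last by [].
  by apply/funext => t; rewrite loc_metricE /= !coord_fieldE.
rewrite /christoffel; congr (_ * _); apply: eq_bigr => l _.
by rewrite !DE.
Qed.

Let Dsym c a b : D c a b = D c b a.
Proof.
have E : (fun t => (lg t)^T) = lg.
  by apply/funext => t; rewrite /loc_metric !trmx_mul trmxK gsym mulmxA.
by rewrite /D -{1}E (derive_trmx _ dg) mxE.
Qed.

Let christoffel_sym k i j : christoffel A g P k i j = christoffel A g P k j i.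
Proof.
rewrite !christoffelE; congr (_ * _); apply: eq_bigr => h _; congr (_ * _).
by rewrite (Dsym h i j) (addrC (D i j h)).
Qed.

Lemma conn_torsion w y : conn_at w *m y = conn_at y *m w.
Proof.
apply/matrixP => k j; rewrite !mxE.
under eq_bigr do rewrite mxE mulr_suml.
rewrite exchange_big /=; apply: eq_bigr => i _.
rewrite mxE mulr_suml; apply: eq_bigr => l _.
by rewrite (ord1 j) [RHS]mulrAC (christoffel_sym k i l).
Qed.

Let metric_half w : g P *m conn_at w =
  \matrix_(a, j) (2^-1 * \sum_i (D i j a + D j i a - D a i j) * w i 0).
Proof.
have -> : conn_at w = invmx (g P) *m
    \matrix_(a, j) (2^-1 * \sum_i (D i j a + D j i a - D a i j) * w i 0).
  apply/matrixP => k j; rewrite !mxE.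
  under eq_bigr do rewrite christoffelE -mulrA mulr_suml.
  rewrite -mulr_sumr exchange_big mulr_sumr /=; apply: eq_bigr => l _.
  rewrite mxE mulrCA; congr (_ * _); rewrite mulr_sumr.
  by apply: eq_bigr => i _; rewrite mulrA.
by rewrite mulKVmx.
Qed.

(** The Christoffel symbols solve the linear system that expresses that g is
    parallel. *)
Lemma conn_metric w : 'D_w lg (phi P) = (conn_at w)^T *m g P + g P *m conn_at w.
Proof.
have -> : (conn_at w)^T *m g P = (g P *m conn_at w)^T by rewrite trmx_mul gsym.
rewrite !metric_half; apply/matrixP => a j.
rewrite (derive_coord _ dg) summxE !mxE -mulrDr -big_split /= mulr_sumr.
apply: eq_bigr => i _; rewrite mxE -/(D i a j).
rewrite (Dsym i j a) (Dsym a i j) (Dsym j i a) (Dsym a j i) (Dsym j a i).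
move: (D i a j) (D j a i) (D a j i) (D j i a) (D a i j) => x1 x2 x3 x4 x5.
by field.
Qed.

End ConnectionMatrix.

Section ExteriorDerivative.
Context {R : realType} {m : nat} {M : topologicalType} (A : manifold R m M) (P : M).

Local Notation phi := (cmap (chart_at A P)).
Local Notation psi := (cinv (chart_at A P)).
Local Notation dom := (cdom (chart_at A P)).
Local Notation E i := (cst_field A P (delta_mx i 0)).

Lemma dir_cst_field {V : normedModType R} (F : M -> V) q v : dom q ->
  differentiable (F \o cinv (chart_at A q)) (cmap (chart_at A q) q) ->
  dir A F q (cst_field A P v q) = 'D_v (F \o psi) (phi q).
Proof.
by move=> dq dF; rewrite /dir -derive_chart//; exact: chart_atP.
Qed.

(** Coordinate fields commute.  Since the bracket at q is computed in the chart
    at q, this is the symmetry of the second derivative of the coordinate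
    change. *)
Lemma bracket_cst_field q v w : dom q ->
  bracket A (cst_field A P v) (cst_field A P w) q = 0.
Proof.
move=> dq; have cq := chart_atP A q.
set S := dom `&` cdom (chart_at A q).
have oS : open (phi @` S) by apply: chart_image_open; exact: (@cdom_open _ _ _ (chart_at A q)).
have Sq : (phi @` S) (phi q) by exists q.
have cT k : ck k (phi @` S) (cmap (chart_at A q) \o psi) by exact: chart_compat.
have oD : open dom by exact: (@cdom_open _ _ _ (chart_at A P)).
have repD u : differentiable (rep A id (cst_field A P u) q \o cinv (chart_at A q))
    (cmap (chart_at A q) q).
  have /(smooth_fieldP A _ oD) /(_ q dq 1) h := cst_field_smooth u oD (fun _ => id).
  by apply/differentiable_mxP => i j; rewrite (ord1 j); apply: (h i).1; exists q.
have dirE u u' : dir A (rep A id (cst_field A P u) q) q (cst_field A P u' q) =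
    'D_u' (fun t => 'D_u (cmap (chart_at A q) \o psi) t) (phi q).
  rewrite (dir_cst_field u' dq (repD u)).
  apply: near_eq_derive; apply: filterS (open_near oS Sq) => _ [q' [dq' cq'] <-].
  by rewrite /= cmapK// rep_cst_field// transition_jacE.
rewrite /bracket !dirE; apply/eqP; rewrite subr_eq0; apply/eqP/matrixP => i j.
have dD u : differentiable (fun t => 'D_u (cmap (chart_at A q) \o psi) t) (phi q).
  exact: ((cT 2).2 u).1.
have compE u t : (phi @` S) t -> ('D_u (cmap (chart_at A q) \o psi) t) i j =
    'D_u (fun t => (cmap (chart_at A q) (psi t)) i j : R^o) t.
  by move=> St; apply: derive_mxE; exact: (cT 1).1.
have second u u' : ('D_u (fun t => 'D_u' (cmap (chart_at A q) \o psi) t) (phi q)) i j =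
    'D_u (fun t => 'D_u' (fun t => (cmap (chart_at A q) (psi t)) i j : R^o) t : R^o) (phi q).
  rewrite (derive_mxE _ _ _ (dD u')); apply: near_eq_derive.
  by apply: filterS (open_near oS Sq) => t; exact: compE.
apply: etrans (second v w) _; apply: esym; apply: etrans (second w v) _.
exact: derive_sym oS Sq ((ck_mxP 2 _ oS).1 (cT 2) i j).
Qed.

(** The factor 2 comes from the convention for the exterior derivative. *)
Lemma ext_d_cst_field (W : set M) (a : M -> 'rV[R]_m) q i j :
  open W -> W q -> W `<=` dom -> smooth_form A W a ->
  differentiable (loc_form A P a) (phi q) ->
  2 * ext_d A a (E i) (E j) q =
  (form_jac (loc_form A P a) (phi q) - (form_jac (loc_form A P a) (phi q))^T) i j.
Proof.
move=> oW Wq Wd sa da; have dq := Wd q Wq.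
have evE u h : dir A (fun q' => ev (a q') (E h q') : R^o) q (cst_field A P u q) =
    ('D_u (loc_form A P a) (phi q)) 0 h.
  rewrite (dir_cst_field u dq); last first.
    have hs := sa W (E h) oW (fun _ => id) (cst_field_smooth (p := P) (delta_mx h 0) oW Wd).
    by apply: (hs q Wq 1).1; exists q => //; split=> //; exact: chart_atP.
  apply: esym; apply: etrans (derive_mxE u 0 h da) _.
  have -> : (fun t => loc_form A P a t 0 h : R^o)
      = (fun q' => ev (a q') (E h q') : R^o) \o psi; last by [].
  by apply/funext => t; rewrite loc_formE.
rewrite /ext_d !evE bracket_cst_field// /ev mulmx0 mxE subr0 mulrA divff ?mul1r//.
by rewrite !mxE.
Qed.

End ExteriorDerivative.

(** * Normal complex contact manifolds *)

Lemma gdot_mx_inj {R : realType} {m : nat} (F F' : 'M[R]_m) :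
  (forall x y, gdot F x y = gdot F' x y) -> F = F'.
Proof.
move=> E; apply: mulmx_cV_inj => y; apply: trmx_inj; apply: mulmx_cV_inj => x.
apply: trmx_inj; apply/matrixP => i j; rewrite !ord1.
by have := E x y; rewrite /gdot !trmx_mul !trmxK !mulmxA.
Qed.

Section ComplexStructure.
Context {R : realType} {k : nat}.

Local Notation J := (stdJ R k).

Lemma stdJ_square : J *m J = - 1%:M.
Proof.
rewrite /stdJ mulmx_block !mul0mx !mulmx0 !addr0 !add0r mulNmx mulmxN !mul1mx.
by rewrite (scalar_mx_block k k (1 : R)) opp_block_mx !oppr0.
Qed.

Lemma stdJK (x : 'cV[R]_(k + k)) : J *m (J *m x) = - x.
Proof. by rewrite mulmxA stdJ_square mulNmx mul1mx. Qed.

Context {M : topologicalType} (A : complex_manifold R k M).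

Lemma transition_jac_stdJ r p q :
  cdom (chart_at A p) q -> cdom (chart_at A r) q ->
  transition_jac A r p q *m J = J *m transition_jac A r p q.
Proof.
move=> pq rq; apply: (@transition_holo _ _ _ A p r (cmap (chart_at A p) q)).
by exists q.
Qed.

Lemma smooth_field_stdJ W X : open W -> smooth_field A W X ->
  smooth_field A W (fun q => J *m X q).
Proof.
move=> oW /(smooth_fieldP A _ oW) hX; apply/(smooth_fieldP A _ oW) => p Wp h i.
have oS := chart_image_open (chart_at A p) oW.
have hs l : ck h (cmap (chart_at A p) @` (cdom (chart_at A p) `&` W))
    (fun x => J i l * (rep A id X p (cinv (chart_at A p) x)) l 0 : R^o).
  exact: ckM oS (ck_cst h _ (J i l : R^o)) (hX p Wp h l).
apply: (ck_eq oS _ (ck_sum oS hs)) => t /chart_image_inv[dt _ _].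
rewrite !repE mulmxA transition_jac_stdJ//; last exact: chart_atP.
by rewrite -mulmxA [RHS]mxE.
Qed.

Variable P : M.

Lemma loc_endo_stdJ t : cdom (chart_at A P) (cinv (chart_at A P) t) ->
  loc_endo A P (fun=> J) t = J.
Proof.
move=> dt; rewrite /loc_endo transition_jac_stdJ//; last exact: chart_atP.
by rewrite -mulmxA TK// mulmx1.
Qed.

End ComplexStructure.

Section ContactAtPoint.
Context {R : realType} {k : nat} {M : topologicalType} (A : complex_manifold R k M)
  (g : M -> 'M[R]_(k + k)) (C : contact_data R k M) (ind : nat).
Hypotheses (hg : semi_riemannian A g ind) (hherm : hermitian_metric g)
  (hcm : contact_metric A g C) (hnormal : normal_contact A g C).
Variables (i : cover_index C).
Hypothesis (oC : open (cover_set i)).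

Local Notation J := (stdJ R k).
Local Notation G := (tensor_G i).
Local Notation H := (tensor_H i).
Local Notation U := (field_U i).
Local Notation V := (field_V i).
Local Notation u := (form_u i).
Local Notation v := (form_v i).
Local Notation "<< x , y >>_ q" := (gdot (g q) x y) (at level 0, q at level 2).

Section Algebra.
Variables (q : M) (Cq : cover_set i q).

Let gs : (g q)^T = g q. Proof. exact: (Defs.metric_sym hg). Qed.
Let gC x y : <<x, y>>_q = <<y, x>>_q. Proof. exact: gdotC. Qed.

Lemma gdot_stdJ x y : <<J *m x, y>>_q = - <<x, J *m y>>_q.
Proof. by rewrite -gdotNr -[RHS]hherm mulmxN stdJK opprK. Qed.

Lemma U_dual : (U q)^T *m g q = u q.
Proof.
apply: mulmx_cV_inj => x; apply/matrixP => a b; rewrite !ord1.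
exact: (U_metric_dual hcm x Cq).
Qed.

Lemma gdotU x : <<U q, x>>_q = ev (u q) x.
Proof. exact: (U_metric_dual hcm x Cq). Qed.

Lemma gdotV x : <<V q, x>>_q = ev (v q) x.
Proof. by rewrite /field_V gdotNl gdot_stdJ opprK gdotU /ev /form_v mulmxA. Qed.

Lemma V_dual : (V q)^T *m g q = v q.
Proof.
by apply: mulmx_cV_inj => x; apply/matrixP => a b; rewrite !ord1; exact: gdotV.
Qed.

Lemma G_V : G q *m V q = 0.
Proof.
rewrite /field_V mulmxN mulmxA (GJ_anticomm hcm Cq) mulNmx opprK -mulmxA.
by rewrite (G_U hcm Cq) mulmx0.
Qed.

Lemma H_U : H q *m U q = 0.
Proof.
by rewrite /tensor_H (GJ_anticomm hcm Cq) mulNmx -mulmxA (G_U hcm Cq) mulmx0 oppr0.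
Qed.

Lemma H_V : H q *m V q = 0.
Proof. by rewrite /field_V /tensor_H mulmxN -mulmxA stdJK mulmxN opprK (G_U hcm Cq). Qed.

Lemma HG_anticomm : H q *m G q = - (G q *m H q).
Proof.
rewrite /tensor_H -mulmxA -[J *m G q]opprK -(GJ_anticomm hcm Cq).
by rewrite mulmxN mulmxA.
Qed.

Lemma skew_mx (F : 'M[R]_(k + k)) : (forall x y, <<F *m x, y>>_q = - <<x, F *m y>>_q) ->
  (g q *m F)^T = - (g q *m F).
Proof.
move=> sk; apply: gdot_mx_inj => x y.
by rewrite gdot_trmx gdot_mxNl !gdot_mulmx gC sk.
Qed.

Lemma H_skew x y : <<H q *m x, y>>_q = - <<x, H q *m y>>_q.
Proof.
rewrite /tensor_H -mulmxA (G_skew hcm _ _ Cq) gdot_stdJ opprK.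
by rewrite mulmxA -[J *m G q]opprK -(GJ_anticomm hcm Cq) mulNmx gdotNr.
Qed.

Lemma VU_orth : <<V q, U q>>_q = 0.
Proof. by rewrite gC; case: (UV_dual hcm Cq). Qed.

End Algebra.


Section AtPoint.
Variables (P : M) (CP : cover_set i P).

Local Notation phi := (cmap (chart_at A P)).
Local Notation psi := (cinv (chart_at A P)).
Local Notation dom := (cdom (chart_at A P)).
Local Notation E x := (cst_field A P x).
Local Notation W := (dom `&` cover_set i).
Local Notation O := (phi @` (dom `&` W)).
Local Notation lg := (loc_metric A P g).
Local Notation lG := (loc_endo A P G).
Local Notation lH := (loc_endo A P H).
Local Notation lu := (loc_form A P u).
Local Notation lv := (loc_form A P v).
Local Notation lU := (loc_vec A P U).
Local Notation lV := (loc_vec A P V).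

Let oW : open W. Proof. by apply: openI => //; exact: cdom_open. Qed.
Let WC : W `<=` cover_set i. Proof. by move=> ? []. Qed.
Let Wd : W `<=` dom. Proof. by move=> ? []. Qed.
Let WP : W P. Proof. by split => //; exact: chart_atP. Qed.
Let oO : open O. Proof. exact: chart_image_open. Qed.
Let OP : O (phi P). Proof. exact: loc_mem. Qed.

Let sU : smooth_field A W U.
Proof.
apply/(smooth_fieldP A _ oW) => p Wp h j.
have := (smooth_fieldP A _ oC).1 (@U_smooth _ _ _ _ _ _ hcm i) p (WC Wp) h j.
by apply: ck_sub => _ [q [cq Wq] <-]; exists q => //; split=> //; exact: WC.
Qed.

Let sV : smooth_field A W V.
Proof.
have sJU := smooth_field_stdJ oW sU.
have sZ := smooth_fieldZ oW (smooth_fun_cst A (W := W) (- 1)) sJU.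
by apply: smooth_field_ext oW _ sZ => q _; rewrite scaleN1r.
Qed.

Let su : smooth_form A W u.
Proof. by move=> W' X oW' W'W; apply: (@u_smooth _ _ _ _ _ _ hcm i W' X oW') => q /W'W/WC. Qed.

Let sv : smooth_form A W v.
Proof.
move=> W' X oW' W'W /(smooth_field_stdJ oW') sX p Wp h.
have := su oW' W'W sX Wp h; congr ck.
by apply/funext => t /=; rewrite /ev /form_v mulmxA.
Qed.

Let sG : smooth_endo A W G.
Proof. by move=> W' X oW' W'W; apply: (@G_smooth _ _ _ _ _ _ hcm i W' X oW') => q /W'W/WC. Qed.

Let sH : smooth_endo A W H.
Proof.
move=> W' X oW' W'W /(smooth_field_stdJ oW') /(sG oW' W'W).
by apply: smooth_field_ext => // q _; rewrite /tensor_H mulmxA.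
Qed.

Let ck1_diff {V' W' : normedModType R} (S : set V') (F : V' -> W') t :
  ck 1 S F -> S t -> differentiable F t.
Proof. by move=> [h _]; exact: h. Qed.

Let dg : differentiable lg (phi P).
Proof.
exact: ck1_diff (loc_metric_smooth oW WP Wd 1 (metric_smooth hg)) OP.
Qed.
Let dG : differentiable lG (phi P).
Proof. exact: ck1_diff (loc_endo_smooth oW WP Wd 1 sG) OP. Qed.
Let dH : differentiable lH (phi P).
Proof. exact: ck1_diff (loc_endo_smooth oW WP Wd 1 sH) OP. Qed.
Let dU : differentiable lU (phi P).
Proof. exact: ck1_diff (loc_vec_smooth oW WP 1 sU) OP. Qed.
Let dV : differentiable lV (phi P).
Proof. exact: ck1_diff (loc_vec_smooth oW WP 1 sV) OP. Qed.
Let du t : O t -> differentiable lu t.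
Proof. exact: ck1_diff (loc_form_smooth oW WP Wd 1 su). Qed.
Let dv t : O t -> differentiable lv t.
Proof. exact: ck1_diff (loc_form_smooth oW WP Wd 1 sv). Qed.

(* sigma in the coordinate frame of the chart at P *)
Let s (t : 'cV[R]_(k + k)) : 'rV[R]_(k + k) :=
  \row_j sigma A g i (psi t) (E (delta_mx j 0) (psi t)).

Let sE x : ev (s (phi P)) x = sigma A g i P x.
Proof.
have psiP : psi (phi P) = P by rewrite cmapK//; exact: chart_atP.
have EP y : E y P = y by rewrite /cst_field T_id mul1mx.
rewrite /ev mxE; under eq_bigr do rewrite mxE psiP EP.
rewrite /sigma [in RHS]nablaE (derive_coord _ dU) gdotDl.
have -> : conn_at A g P x *m U P = \sum_j x j 0 *: (conn_at A g P (delta_mx j 0) *m U P).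
  rewrite (conn_torsion (Defs.metric_sym hg) dg) {1}[x]matrix_sum_delta mulmx_sumr.
  apply: eq_bigr => j _; rewrite big_ord1 -scalemxAr.
  by rewrite (conn_torsion (Defs.metric_sym hg) dg).
rewrite -gdotDl -big_split /= gdotC; last exact: (Defs.metric_sym hg).
rewrite gdot_sumr; apply: eq_bigr => j _.
rewrite -scalerDr gdotZr gdotC; last exact: (Defs.metric_sym hg).
by rewrite nablaE mulrC.
Qed.

Let ext_u t : O t -> form_jac lu t - (form_jac lu t)^T =
  2 *: (lg t *m lG t) + (s t)^T *m lv t - (lv t)^T *m s t.
Proof.
move=> Ot; have := Ot => -[q [dq Wq] qt]; apply/matrixP => a b; rewrite -qt in Ot *.
rewrite -(ext_d_cst_field a b oW Wq Wd su (du Ot)).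
rewrite (du_eq hcm oW WC (cst_field_smooth (delta_mx a 0) oW Wd)
  (cst_field_smooth (delta_mx b 0) oW Wd) Wq).
have qE : psi (phi q) = q by rewrite cmapK.
have gGE : <<E (delta_mx a 0) q, G q *m E (delta_mx b 0) q>>_q = (lg (phi q) *m lG (phi q)) a b.
  rewrite -loc_metric_mul ?qE// loc_metricE qE.
  by rewrite gdot_mulmx.
have outer (c r : 'rV[R]_(k + k)) : (c^T *m r) a b = c 0 a * r 0 b.
  by rewrite mxE big_ord1 mxE.
have sab c : (s (phi q)) 0 c = sigma A g i q (E (delta_mx c 0) q) by rewrite mxE qE.
have mE (X Y Z : 'M[R]_(k + k)) : (2 *: X + Y - Z) a b = 2 * X a b + Y a b - Z a b.
  by rewrite !mxE.
rewrite gGE /wedge1 mE !outer !sab !loc_formE qE mulrDr (mulrA 2 2^-1) divff// mul1r.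
by rewrite -[RHS]addrA; congr (_ + (_ - _)); rewrite mulrC.
Qed.

Let ext_v t : O t -> form_jac lv t - (form_jac lv t)^T =
  2 *: (lg t *m lH t) - (s t)^T *m lu t + (lu t)^T *m s t.
Proof.
move=> Ot; have := Ot => -[q [dq Wq] qt]; apply/matrixP => a b; rewrite -qt in Ot *.
rewrite -(ext_d_cst_field a b oW Wq Wd sv (dv Ot)).
rewrite (dv_eq hcm oW WC (cst_field_smooth (delta_mx a 0) oW Wd)
  (cst_field_smooth (delta_mx b 0) oW Wd) Wq).
have qE : psi (phi q) = q by rewrite cmapK.
have gHE : <<E (delta_mx a 0) q, H q *m E (delta_mx b 0) q>>_q = (lg (phi q) *m lH (phi q)) a b.
  rewrite -loc_metric_mul ?qE// loc_metricE qE.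
  by rewrite gdot_mulmx.
have outer (c r : 'rV[R]_(k + k)) : (c^T *m r) a b = c 0 a * r 0 b.
  by rewrite mxE big_ord1 mxE.
have sab c : (s (phi q)) 0 c = sigma A g i q (E (delta_mx c 0) q) by rewrite mxE qE.
have mE (X Y Z : 'M[R]_(k + k)) : (2 *: X - Y + Z) a b = 2 * X a b - Y a b + Z a b.
  by rewrite !mxE.
rewrite gHE /wedge1 mE !outer !sab !loc_formE qE mulrBr (mulrA 2 2^-1) divff// mul1r.
by rewrite opprB -[RHS]addrA [X in _ = _ + X]addrC; congr (_ + (_ - _)); exact: mulrC.
Qed.

Local Notation hor := (orth2 (g P) (U P) (V P)).

(** The horizontal projection of a field with constant components; it extends a
    given horizontal vector at P, as the vanishing of S and T is only assumed
    for horizontal fields. *)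
Let hext x q := E x q + (- ev (u q) (E x q)) *: U q + (- ev (v q) (E x q)) *: V q.

Let smooth_evN a x : smooth_form A W a ->
  smooth_fun A W (fun q => - ev (a q) (E x q) : R^o).
Proof.
move=> sa p Wp h; have oS := chart_image_open (chart_at A p) oW.
have := ckM oS (ck_cst h _ (- 1 : R^o)) (sa W _ oW (fun _ => id) (cst_field_smooth x oW Wd) p Wp h).
by apply: ck_eq => // t _ /=; rewrite mulN1r.
Qed.

Let hext_smooth x : smooth_field A W (hext x).
Proof.
apply: smooth_fieldD => //; first apply: smooth_fieldD => //.
- exact: cst_field_smooth oW Wd.
- by apply: smooth_fieldZ => //; exact: smooth_evN.
- by apply: smooth_fieldZ => //; exact: smooth_evN.
Qed.

Let hext_hor x q : W q -> horizontal g i q (hext x q).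
Proof.
move=> Wq; have Cq := WC Wq.
have [uU uV vU vV UV0] := UV_dual hcm Cq.
have gC y y' : <<y, y'>>_q = <<y', y>>_q by apply: gdotC; exact: (Defs.metric_sym hg).
split; rewrite /hext !gdotDl !gdotZl.
  by rewrite (VU_orth Cq) (gC _ (U q)) !(gdotU Cq) uU; ring.
by rewrite UV0 (gC _ (V q)) !(gdotV Cq) vV; ring.
Qed.

Let gC y y' : <<y, y'>>_P = <<y', y>>_P.
Proof. by apply: gdotC; exact: (Defs.metric_sym hg). Qed.

Let hor_ev x : hor x -> ev (u P) x = 0 /\ ev (v P) x = 0.
Proof. by move=> [xU xV]; rewrite -(gdotU CP) -(gdotV CP) !(gC _ x). Qed.

Let cstP x : E x P = x. Proof. by rewrite /cst_field T_id mul1mx. Qed.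

Let hextP x : hor x -> hext x P = x.
Proof.
by move=> /hor_ev[ux vx]; rewrite /hext cstP ux vx !oppr0 !scale0r !addr0.
Qed.

Let hext_diff x : differentiable (loc_vec A P (hext x)) (phi P).
Proof. exact: ck1_diff (loc_vec_smooth oW WP 1 (hext_smooth x)) OP. Qed.

Local Notation conn := (conn_at A g P).

Let OE t : O t -> dom (psi t) /\ cover_set i (psi t).
Proof. by move=> /chart_image_inv[dt [_ Ct] _]. Qed.

Let lsym t : (lg t)^T = lg t.
Proof. by rewrite /loc_metric !trmx_mul trmxK (Defs.metric_sym hg) mulmxA. Qed.

Let lskew F t : dom (psi t) -> (g (psi t) *m F (psi t))^T = - (g (psi t) *m F (psi t)) ->
  (lg t *m loc_endo A P F t)^T = - (lg t *m loc_endo A P F t).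
Proof.
move=> dt sk; rewrite -loc_metric_mul// /loc_metric.
move: (transition_jac _ _ _ _) (g _ *m F _) sk => S K sk.
by rewrite !trmx_mul trmxK sk mulNmx mulmxN mulmxA.
Qed.

Let lsquare F t : dom (psi t) -> F (psi t) *m F (psi t)
    = - 1%:M + U (psi t) *m u (psi t) + V (psi t) *m v (psi t) ->
  loc_endo A P F t *m loc_endo A P F t = - 1%:M + lU t *m lu t + lV t *m lv t.
Proof.
move=> dt sq; rewrite -loc_endo_mul// -!loc_outer /loc_endo sq.
rewrite !mulmxDr !mulmxDl mulmxN mulmx1 mulNmx TK//.
Qed.

Let lvec0 F X t : dom (psi t) -> F (psi t) *m X (psi t) = 0 ->
  loc_endo A P F t *m loc_vec A P X t = 0.
Proof. by move=> dt E0; rewrite -loc_vec_mul// /loc_vec E0 mulmx0. Qed.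

Let ldual X a t : dom (psi t) -> (X (psi t))^T *m g (psi t) = a (psi t) ->
  (loc_vec A P X t)^T *m lg t = loc_form A P a t.
Proof. by move=> dt E0; rewrite -loc_dual// /loc_form E0. Qed.

Let lunit a X t : dom (psi t) -> ev (a (psi t)) (X (psi t)) = 1 ->
  loc_form A P a t *m loc_vec A P X t = 1%:M.
Proof. by move=> dt E1; rewrite -loc_pair// [LHS]mx11_scalar -[X in X%:M]/(ev _ _) E1. Qed.

Let at_ := (loc_metric_at A P g, loc_endo_at A P, loc_vec_at A P, loc_form_at A P).

Let skewG : (g P *m G P)^T = - (g P *m G P).
Proof. by apply: skew_mx => x y; exact: (G_skew hcm x y CP). Qed.
Let skewH : (g P *m H P)^T = - (g P *m H P).
Proof. by apply: skew_mx => x y; exact: (H_skew CP). Qed.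

Local Notation DG w := ('D_w lG (phi P)).
Local Notation DH w := ('D_w lH (phi P)).

Let nijG x y w : hor x -> hor y -> hor w ->
  <<DG (G P *m x) *m y - DG (G P *m y) *m x
     - G P *m (DG x *m y) + G P *m (DG y *m x), w>>_P =
  <<sigma A g i P (G P *m x) *: (H P *m y) - sigma A g i P (G P *m y) *: (H P *m x)
     - sigma A g i P x *: (G P *m (H P *m y))
     + sigma A g i P y *: (G P *m (H P *m x)), w>>_P.
Proof.
have [d dE] : exists d, forall w, DG w = d w by exists (fun w => DG w).
move=> hx hy [wU wV]; rewrite !dE.
have [S0 _] := (hnormal oW WC).1 _ _ (hext_smooth x) (hext_smooth y)
  (hext_hor x) (hext_hor y) P WP.
have [_ vx] := hor_ev hx; have [_ vy] := hor_ev hy.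
move: S0; rewrite /tensor_S !hextP// vx vy !scale0r subr0 scaler0 addr0.
rewrite (nijenhuisE dG (hext_diff x) (hext_diff y)) !hextP// !dE.
move=> /(congr1 (fun z => <<z, w>>_P)); rewrite !gdotDl !gdotNl !gdotZl gdot0l.
by rewrite (gC (U P)) (gC (V P)) wU wV => e; lra.
Qed.

Let sigma0 : sigma A g i P 0 = 0.
Proof. by rewrite -sE /ev mulmx0 mxE. Qed.

Let nijU y : hor y ->
  - (DG (G P *m y) *m U P) - G P *m (DG (U P) *m y) + G P *m (DG y *m U P)
  = - (sigma A g i P (U P) *: (G P *m (H P *m y))).
Proof.
have [d dE] : exists d, forall w, DG w = d w by exists (fun w => DG w).
move=> hy; rewrite !dE; have [S0 _] := (hnormal oW WC).2 _ (hext_smooth y) P WP.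
have [_ vy] := hor_ev hy.
have [_ _ vU _ _] := UV_dual hcm CP.
move: S0; rewrite /tensor_S !hextP//.
rewrite (nijenhuisE dG dU (hext_diff y)) !hextP// (G_U hcm CP) derive0 mul0mx sub0r.
rewrite !dE (H_U CP).
have -> : <<U P, G P *m y>>_P = 0.
  by rewrite -[LHS]opprK -(G_skew hcm _ _ CP) (G_U hcm CP) gdot0l oppr0.
have -> : <<U P, H P *m y>>_P = 0.
  by rewrite -[LHS]opprK -(H_skew CP) (H_U CP) gdot0l oppr0.
rewrite vU sigma0 mulmx0 mulr0 !scale0r !scaler0 !subr0 !addr0 scaler0 addr0.
by move/eqP; rewrite addr_eq0 => /eqP.
Qed.

Let nijH x y w : hor x -> hor y -> hor w ->
  <<DH (H P *m x) *m y - DH (H P *m y) *m x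
     - H P *m (DH x *m y) + H P *m (DH y *m x), w>>_P =
  <<- sigma A g i P (H P *m x) *: (G P *m y) - - sigma A g i P (H P *m y) *: (G P *m x)
     - - sigma A g i P x *: (H P *m (G P *m y))
     + - sigma A g i P y *: (H P *m (G P *m x)), w>>_P.
Proof.
have [d dE] : exists d, forall w, DH w = d w by exists (fun w => DH w).
move=> hx hy [wU wV]; rewrite !dE.
have [_ T0] := (hnormal oW WC).1 _ _ (hext_smooth x) (hext_smooth y)
  (hext_hor x) (hext_hor y) P WP.
have [ux _] := hor_ev hx; have [uy _] := hor_ev hy.
move: T0; rewrite /tensor_T !hextP// ux uy !scale0r subr0 scaler0 addr0.
rewrite (nijenhuisE dH (hext_diff x) (hext_diff y)) !hextP// !dE.
have HGE z : H P *m (G P *m z) = - (G P *m (H P *m z)).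
  by rewrite mulmxA (HG_anticomm CP) mulNmx mulmxA.
rewrite !HGE; move: (V P) wV => Vp wV.
move=> /(congr1 (fun z => <<z, w>>_P)); rewrite !gdotDl !gdotNl !gdotZl !gdotNl gdot0l.
by rewrite (gC (U P)) (gC Vp) wU wV => e; lra.
Qed.

Let nijV y : hor y ->
  - (DH (H P *m y) *m V P) - H P *m (DH (V P) *m y) + H P *m (DH y *m V P)
  = - (- sigma A g i P (V P) *: (H P *m (G P *m y))).
Proof.
have [d dE] : exists d, forall w, DH w = d w by exists (fun w => DH w).
move=> hy; rewrite !dE; have [_ T0] := (hnormal oW WC).2 _ (hext_smooth y) P WP.
have [uy _] := hor_ev hy.
have [_ uV _ _ _] := UV_dual hcm CP.
move: T0; rewrite /tensor_T !hextP//.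
rewrite (nijenhuisE dH dV (hext_diff y)) !hextP// (H_V CP) derive0 mul0mx sub0r.
rewrite !dE (G_V CP).
have -> : <<V P, G P *m y>>_P = 0.
  by rewrite -[LHS]opprK -(G_skew hcm _ _ CP) (G_V CP) gdot0l oppr0.
have -> : <<V P, H P *m y>>_P = 0.
  by rewrite -[LHS]opprK -(H_skew CP) (H_V CP) gdot0l oppr0.
have -> : H P *m (G P *m y) = - (G P *m (H P *m y)).
  by rewrite mulmxA (HG_anticomm CP) mulNmx mulmxA.
rewrite uV sigma0 mulmx0 mulr0 !scale0r !scaler0 !subr0 !addr0 scaler0 addr0.
rewrite scaleNr scalerN !opprK.
by move/eqP; rewrite addr_eq0 => /eqP.
Qed.

Lemma half_chart_G : half_contact_chart lg lG lH lu lv s lU lV conn O (phi P).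
Proof.
split.
- exact: oO.
- exact: OP.
- exact: dg.
- exact: dG.
- exact: dv OP.
- exact: dU.
- exact: dV.
- exact: (loc_form_smooth oW WP Wd 2 su).
- by move=> t _; exact: lsym.
- move=> t /OE[dt Ct]; apply: lskew => //; apply: skew_mx => x y.
  exact: (G_skew hcm x y Ct).
- by move=> t /OE[dt Ct]; apply: lsquare => //; exact: (G_square hcm Ct).
- by move=> t /OE[dt Ct]; apply: lvec0 => //; exact: (G_U hcm Ct).
- by move=> t /OE[dt Ct]; apply: lvec0 => //; exact: G_V.
- by move=> t /OE[dt Ct]; apply: ldual => //; exact: U_dual.
- by move=> t /OE[dt Ct]; apply: ldual => //; exact: V_dual.
- by move=> t /OE[dt Ct]; apply: lunit => //; case: (UV_dual hcm Ct).
- by rewrite !at_.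
- by rewrite !at_ H_U.
- by rewrite !at_ H_V.
- by rewrite !at_ HG_anticomm.
- by rewrite !at_ (VU_orth CP).
- by move=> w; rewrite !at_; apply: conn_metric => //; [exact: (Defs.metric_sym hg)|exact: (metric_nondeg hg)].
- by move=> w y; apply: conn_torsion => //; exact: (Defs.metric_sym hg).
- exact: ext_u.
- exact: ext_v OP.
- by rewrite !at_ => x y w hx hy hw; rewrite !sE; exact: nijG.
- by rewrite !at_ => y hy; rewrite !sE; exact: nijU.
Qed.

Let evN (r : 'rV[R]_(k + k)) x : ev (- r) x = - ev r x.
Proof. by rewrite /ev mulNmx mxE. Qed.

Lemma half_chart_H :
  half_contact_chart lg lH lG lv lu (fun t => - s t) lV lU conn O (phi P).
Proof.
split.
- exact: oO.
- exact: OP.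
- exact: dg.
- exact: dH.
- exact: du OP.
- exact: dV.
- exact: dU.
- exact: (loc_form_smooth oW WP Wd 2 sv).
- by move=> t _; exact: lsym.
- move=> t /OE[dt Ct]; apply: lskew => //; apply: skew_mx => x y.
  exact: (H_skew Ct).
- move=> t /OE[dt Ct]; rewrite [RHS]addrAC; apply: lsquare => //; exact: (H_square hcm Ct).
- by move=> t /OE[dt Ct]; apply: lvec0 => //; exact: H_V.
- by move=> t /OE[dt Ct]; apply: lvec0 => //; exact: H_U.
- by move=> t /OE[dt Ct]; apply: ldual => //; exact: V_dual.
- by move=> t /OE[dt Ct]; apply: ldual => //; exact: U_dual.
- by move=> t /OE[dt Ct]; apply: lunit => //; case: (UV_dual hcm Ct).
- by rewrite !at_.
- by rewrite !at_ G_V.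
- by rewrite !at_ (G_U hcm CP).
- by rewrite !at_ HG_anticomm// opprK.
- by rewrite !at_ gC (VU_orth CP).
- by move=> w; rewrite !at_; apply: conn_metric => //; [exact: (Defs.metric_sym hg)|exact: (metric_nondeg hg)].
- by move=> w y; apply: conn_torsion => //; exact: (Defs.metric_sym hg).
- by move=> t Ot; rewrite ext_v// trmxN mulNmx mulmxN opprK.
- by rewrite ext_u// trmxN mulNmx mulmxN opprK.
- by rewrite !at_ => x y w /orth2C hx /orth2C hy /orth2C hw; rewrite !evN !sE; exact: nijH.
- by rewrite !at_ => y /orth2C hy; rewrite !evN !sE; exact: nijV.
Qed.

(** The covariant derivatives at P of G, H, J, U and V.  In a holomorphic chart J
    has constant components, hence the form of nablaJ. *)
Definition nablaG := nabla_endo conn (phi P) lG.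
Definition nablaH := nabla_endo conn (phi P) lH.
Definition nablaJ w : 'M[R]_(k + k) := conn w *m J - J *m conn w.
Definition nablaU := nabla_vec conn (phi P) lU.
Definition nablaV := nabla_vec conn (phi P) lV.

Lemma half_G : half_contact (g P) (G P) (H P) (U P) (V P) nablaG nablaU (sigma A g i P).
Proof.
have := half_contact_at half_chart_G; rewrite !at_.
by have -> : ev (s (phi P)) = sigma A g i P by apply/funext => x; exact: sE.
Qed.

Lemma half_H :
  half_contact (g P) (H P) (G P) (V P) (U P) nablaH nablaV (fun x => - sigma A g i P x).
Proof.
have := half_contact_at half_chart_H; rewrite !at_.
by have -> : ev (- s (phi P)) = fun x => - sigma A g i P x
  by apply/funext => x; rewrite evN sE.
Qed.

Let Onear : nbhs (phi P) O. Proof. exact: open_near oO OP. Qed.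

Let U1 : <<U P, U P>>_P = 1.
Proof. by rewrite (gdotU CP); case: (UV_dual hcm CP). Qed.
Let V1 : <<V P, V P>>_P = 1.
Proof. by rewrite (gdotV CP); case: (UV_dual hcm CP). Qed.

Let hor_J x : hor x -> hor (J *m x).
Proof.
have JV : J *m V P = U P by rewrite /field_V mulmxN stdJK opprK.
have JU : J *m U P = - V P by rewrite /field_V opprK.
by move=> [xU xV]; split; rewrite gdot_stdJ ?JU ?JV ?xU ?oppr0// gdotNr xV !oppr0.
Qed.

Let nablaH_J w : nablaH w = nablaG w *m J + G P *m nablaJ w.
Proof.
have E1 : \forall t \near phi P, lH t = lG t *m J.
  apply: filterS Onear => t /OE[dt _]; rewrite /tensor_H.
  by rewrite (loc_endo_mul dt G (fun=> J)) loc_endo_stdJ.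
rewrite /nablaH (nabla_endo_near _ _ E1) nabla_endo_mul//.
by rewrite !at_ /nabla_endo derive_cst add0r.
Qed.

Let nabla_u w x : ev (nabla_form conn (phi P) lu w) x = <<nablaU w, x>>_P.
Proof.
have E1 : \forall t \near phi P, (lU t)^T *m lg t = lu t.
  by apply: filterS Onear => t /OE[dt Ct]; apply: ldual => //; exact: U_dual.
have mE w' : 'D_w' lg (phi P) = (conn w')^T *m lg (phi P) + lg (phi P) *m conn w'.
  by rewrite at_; apply: conn_metric => //; [exact: (Defs.metric_sym hg)|exact: (metric_nondeg hg)].
by rewrite (nabla_form_dual dg mE w dU E1) at_.
Qed.

Let nabla_v w x : ev (nabla_form conn (phi P) lv w) x = <<nablaV w, x>>_P.
Proof.
have E1 : \forall t \near phi P, (lV t)^T *m lg t = lv t.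
  by apply: filterS Onear => t /OE[dt Ct]; apply: ldual => //; exact: V_dual.
have mE w' : 'D_w' lg (phi P) = (conn w')^T *m lg (phi P) + lg (phi P) *m conn w'.
  by rewrite at_; apply: conn_metric => //; [exact: (Defs.metric_sym hg)|exact: (metric_nondeg hg)].
by rewrite (nabla_form_dual dg mE w dV E1) at_.
Qed.

Let luJ t : dom (psi t) -> lv t = lu t *m J.
Proof.
by move=> dt; rewrite -[in RHS](loc_endo_stdJ dt) -(loc_form_mul dt u (fun=> J)).
Qed.

Let nJE : nabla_endo conn (phi P) (fun=> J) = nablaJ.
Proof. by apply/funext => w; rewrite /nabla_endo derive_cst add0r. Qed.

Let nJU w x : <<nablaJ w *m x, U P>>_P = <<nablaV w, x>>_P - <<nablaU w, J *m x>>_P.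
Proof.
have E1 : \forall t \near phi P, lv t = lu t *m J.
  by apply: filterS Onear => t /OE[dt _]; exact: luJ.
rewrite -nabla_v -nabla_u (nabla_form_near _ _ E1) nabla_form_mul//; last exact: du OP.
rewrite nJE !at_ gC (gdotU CP) /ev mulmxDl [X in _ = X - _]mxE -!mulmxA.
by rewrite addrAC subrr add0r.
Qed.

Let nJV w x : <<nablaJ w *m x, V P>>_P = - <<nablaU w, x>>_P - <<nablaV w, J *m x>>_P.
Proof.
have E1 : \forall t \near phi P, - lu t = lv t *m J.
  apply: filterS Onear => t /OE[dt _].
  by rewrite luJ// -mulmxA stdJ_square mulmxN mulmx1.
have := nabla_form_near conn w E1.
rewrite nabla_formN; last exact: du OP.
rewrite nabla_form_mul//; last exact: dv OP.
move=> /(congr1 (fun r => ev r x)); rewrite evN nabla_u nJE !at_ => ->.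
rewrite gC (gdotV CP) -nabla_v /ev mulmxDl [X in _ = X - _]mxE -!mulmxA.
by rewrite addrAC subrr add0r.
Qed.

Let nGV w : nablaG w *m V P = - (G P *m nablaV w).
Proof.
have := @nabla_kernel _ _ conn (phi P) lG lV w dG dV; rewrite !at_; apply.
by apply: filterS Onear => t /OE[dt Ct]; apply: lvec0 => //; exact: G_V.
Qed.

Let nHU w : nablaH w *m U P = - (H P *m nablaU w).
Proof.
have := @nabla_kernel _ _ conn (phi P) lH lU w dH dU; rewrite !at_; apply.
by apply: filterS Onear => t /OE[dt Ct]; apply: lvec0 => //; exact: H_U.
Qed.

Let gunit : g P \in unitmx. Proof. exact: (metric_nondeg hg). Qed.

Lemma nablaG_null x y : hor x -> hor y -> <<x, y>>_P = 0 ->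
  <<x, H P *m (G P *m y)>>_P = 0 -> nablaG x *m y = sigma A g i P x *: (H P *m y).
Proof. exact: (nabla_tensor_null half_G half_H gunit U1 V1 nGV). Qed.

Lemma nablaH_null x y : hor x -> hor y -> <<x, y>>_P = 0 ->
  <<x, G P *m (H P *m y)>>_P = 0 -> nablaH x *m y = - sigma A g i P x *: (G P *m y).
Proof.
move=> hx hy; apply: (nabla_tensor_null half_H half_G gunit V1 U1 nHU).
- exact/orth2C.
- exact/orth2C.
Qed.

Lemma nablaJ_null x y : hor x -> hor y -> nablaJ x *m y = 0.
Proof.
apply: (nabla_complex_null half_G half_H gunit U1 V1 (J := J)) => //.
by move=> z _; exact: stdJK.
Qed.

Let tensor_JE (a : 'I_3) :
  tensor_J i a = (fun p => if a == 0 then J else if a == 1 then G p else H p).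
Proof.
apply/funext => p; rewrite /tensor_J (tnth_nth 0).
by case: a => [[|[|[|//]]] ?].
Qed.

Lemma tensor_J_differentiable a : differentiable (loc_endo A P (tensor_J i a)) (phi P).
Proof.
rewrite tensor_JE; case: eqP => _; last by case: eqP.
have E1 : \forall t \near phi P, J = loc_endo A P (fun=> J) t.
  by apply: filterS Onear => t /OE[dt _]; rewrite loc_endo_stdJ.
exact: differentiable_near E1 (differentiable_cst _ _).
Qed.

Lemma tensor_J_square a x : hor x -> tensor_J i a P *m (tensor_J i a P *m x) = - x.
Proof.
move=> hx; rewrite tensor_JE; case: eqP => _; first exact: stdJK.
case: eqP => _; first exact: (hc_PP half_G hx).
by apply: (hc_PP half_H); exact/orth2C.
Qed.

(** On such a subspace E, the components along U and V vanish, and only the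
    multiples of H y and G y, which belong to E, are left in the formulas for
    nabla G and nabla H. *)
Lemma nabla_tensor_J_null (E : {vspace 'cV[R]_(k + k)}) a x y :
  (forall z, z \in E -> hor z) ->
  (forall z z', z \in E -> z' \in E -> <<z, z'>>_P = 0) ->
  (forall b z, z \in E -> tensor_J i b P *m z \in E) ->
  x \in E -> y \in E ->
  nabla_endo conn (phi P) (loc_endo A P (tensor_J i a)) x *m y \in E.
Proof.
move=> Ehor Enull EJ xE yE.
have GE z : z \in E -> G P *m z \in E by move=> /(EJ 1); rewrite tensor_JE.
have HE z : z \in E -> H P *m z \in E by move=> /(EJ 2%:R); rewrite tensor_JE.
have hx := Ehor _ xE; have hy := Ehor _ yE.
rewrite tensor_JE; case: eqP => _; last case: eqP => _.
- have E1 : \forall t \near phi P, loc_endo A P (fun=> J) t = J.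
    by apply: filterS Onear => t /OE[dt _]; exact: loc_endo_stdJ.
  by rewrite (nabla_endo_near _ _ E1) nJE nablaJ_null// mem0v.
- rewrite nablaG_null//; first by rewrite memvZ// HE.
  + exact: Enull.
  + by apply: Enull => //; exact/HE/GE.
- rewrite nablaH_null//; first by rewrite memvZ// GE.
  + exact: Enull.
  + by apply: Enull => //; exact/GE/HE.
Qed.

End AtPoint.
End ContactAtPoint.

(** * Pull-back along a map, and subspaces *)

Section PullBack.
Context {R : realType} {d m : nat} {N M : topologicalType}
  (B : manifold R d N) (A : manifold R m M) (g : M -> 'M[R]_m) (f : N -> M).
Hypothesis sf : smooth_map B A f.
Variable p : N.

Local Notation P := (f p).
Local Notation phiN := (cmap (chart_at B p)).
Local Notation psiN := (cinv (chart_at B p)).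
Local Notation phi := (cmap (chart_at A P)).
Local Notation S := (cdom (chart_at B p) `&` f @^-1` cdom (chart_at A P)).
Local Notation F := (phi \o f \o psiN).

Let oS : open (phiN @` S).
Proof.
apply: chart_image_open; apply: open_comp; last exact: cdom_open.
by move=> x _; exact: sf.1.
Qed.

Let Sp : (phiN @` S) (phiN p).
Proof. by exists p => //; split; exact: chart_atP. Qed.

Let cF k : ck k (phiN @` S) F. Proof. exact: sf.2. Qed.

Let dF t : (phiN @` S) t -> differentiable F t.
Proof. exact: (cF 1).1. Qed.

Lemma tmapE v : tmap B A f p *m v = 'D_v F (phiN p).
Proof. by rewrite /tmap jacE//; exact: dF. Qed.

Let nearS : nbhs (phiN p) (phiN @` S). Proof. exact: open_near. Qed.

(** The chain rule, in the charts at p and at f p. *)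
Lemma rep_push (Y : N -> 'cV[R]_d) q : S q ->
  rep A f (push B A f Y) p q = jac F (phiN q) *m rep B id Y p q.
Proof.
move=> [pq Pq]; have Sq : (phiN @` S) (phiN q) by exists q.
have [_ sq] := sf; have dq := chart_atP B q; have dfq := chart_atP A (f q).
have dfq' : differentiable (cmap (chart_at A (f q)) \o f \o cinv (chart_at B q))
    (cmap (chart_at B q) q).
  by apply: (sq q 1).1; exists q.
rewrite repE /rep /push !mulmxA; congr (_ *m _); apply: mulmx_cV_inj => v.
rewrite -!mulmxA /tmap (jacE v dfq').
rewrite -/(transition_jac A P (f q) (f q)) transition_jacE//.
rewrite (jacE _ (dF Sq)).
apply: etrans (derive_chart (F := phi \o f) v dq pq (dF Sq)).
set T := cmap (chart_at A P) \o cinv (chart_at A (f q)).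
set h := cmap (chart_at A (f q)) \o f \o cinv (chart_at B q).
have hq : h (cmap (chart_at B q) q) = cmap (chart_at A (f q)) (f q) by rewrite /h /= cmapK.
have dT : differentiable T (h (cmap (chart_at B q) q)).
  by rewrite hq; exact: transition_differentiable.
rewrite -hq -(derive_comp v dfq' dT); apply: near_eq_derive.
have oq : open (f @^-1` cdom (chart_at A (f q))).
  apply: open_comp; last exact: cdom_open.
  by move=> x _; exact: sf.1.
apply: filterS (chart_near oq dq dfq) => t /chart_image_inv[_ ft _].
by rewrite /h /T /= cmapK.
Qed.

Let jacF_diff : differentiable (jac F) (phiN p).
Proof.
apply/differentiable_mxP => i j.
have -> : (fun t => jac F t i j : R^o) = (fun t => ('D_(delta_mx j 0) F t : 'cV[R]_m) i 0).
  by apply/funext => t; rewrite mxE.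
exact: ((differentiable_mxP _ _).1 (((cF 2).2 (delta_mx j 0)).1 _ Sp) i 0).
Qed.

Let near_rep_push (Y : N -> 'cV[R]_d) : \forall t \near phiN p,
  rep A f (push B A f Y) p (psiN t) = jac F t *m loc_vec B p Y t.
Proof.
apply: filterS nearS => _ [q Sq <-].
by rewrite /loc_vec cmapK ?rep_push//; case: Sq.
Qed.

Let psiNp : psiN (phiN p) = p. Proof. by rewrite cmapK//; exact: chart_atP. Qed.

Lemma rep_push_differentiable (Y : N -> 'cV[R]_d) : smooth_field B setT Y ->
  differentiable (rep A f (push B A f Y) p \o psiN) (phiN p).
Proof.
move=> sY; have dY : differentiable (loc_vec B p Y) (phiN p).
  apply: (loc_vec_smooth openT I 1 sY).1.
  by exists p => //; split=> //; exact: chart_atP.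
apply: (@differentiable_near _ _ _ (fun t => jac F t *m loc_vec B p Y t)).
  by apply: filterS (near_rep_push Y) => t E; rewrite /= E.
exact: differentiable_mulmx.
Qed.

Let jacF_sym v w : 'D_v (jac F) (phiN p) *m w = 'D_w (jac F) (phiN p) *m v.
Proof.
have E u u' : 'D_u (jac F) (phiN p) *m u' = 'D_u (fun t => 'D_u' F t) (phiN p).
  have -> : 'D_u (jac F) (phiN p) *m u' = 'D_u (fun t => jac F t *m u') (phiN p).
    by rewrite derive_mulmx// derive_cst mulmx0 addr0.
  by apply: near_eq_derive; apply: filterS nearS => t St; rewrite jacE//; exact: dF.
apply: etrans (E v w) _; apply: esym; apply: etrans (E w v) _; apply: esym.
apply/matrixP => i j.
have dD u : differentiable (fun t => 'D_u F t) (phiN p) by exact: ((cF 2).2 u).1.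
have second u u' : ('D_u (fun t => 'D_u' F t) (phiN p)) i j =
    'D_u (fun t => 'D_u' (fun t => F t i j : R^o) t : R^o) (phiN p).
  rewrite (derive_mxE _ _ _ (dD u')); apply: near_eq_derive.
  by apply: filterS nearS => t St; rewrite derive_mxE//; exact: dF.
apply: etrans (second v w) _; apply: esym; apply: etrans (second w v) _.
exact: derive_sym oS Sp ((ck_mxP 2 _ oS).1 (cF 2) i j).
Qed.

(** The derivative of the differential of f is symmetric, and so are the
    Christoffel symbols; only the derivatives of X and Y remain, and they form
    the bracket. *)
Lemma nabla_along_torsion (X Y : N -> 'cV[R]_d) :
  (forall w y, conn_at A g P w *m y = conn_at A g P y *m w) ->
  smooth_field B setT X -> smooth_field B setT Y ->
  nabla_along A g B f (X p) (push B A f Y) p - nabla_along A g B f (Y p) (push B A f X) p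
  = push B A f (bracket B X Y) p.
Proof.
move=> tor sX sY.
have dL Z : smooth_field B setT Z -> differentiable (loc_vec B p Z) (phiN p).
  move=> sZ; apply: (loc_vec_smooth openT I 1 sZ).1.
  by exists p => //; split=> //; exact: chart_atP.
have dirE Z v : smooth_field B setT Z -> dir B (rep A f (push B A f Z) p) p v
    = 'D_v (jac F) (phiN p) *m Z p + tmap B A f p *m dir B (rep B id Z p) p v.
  move=> sZ; rewrite /dir (near_eq_derive v (near_rep_push Z)).
  by rewrite derive_mulmx//; [rewrite loc_vec_at|exact: dL].
have [H [D [HD Hs DE]]] : exists (H : 'cV[R]_d -> 'cV[R]_d -> 'cV[R]_m)
    (D : (N -> 'cV[R]_d) -> 'cV[R]_d -> 'cV[R]_d),
    [/\ forall Z v, smooth_field B setT Z -> dir B (rep A f (push B A f Z) p) p v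
         = H v (Z p) + tmap B A f p *m D Z v,
       forall v w, H v w = H w v & forall Z v, dir B (rep B id Z p) p v = D Z v].
  exists (fun v w => 'D_v (jac F) (phiN p) *m w), (fun Z v => dir B (rep B id Z p) p v).
  by split.
rewrite !(nabla_alongE A g B _ _ (erefl P)) (HD _ _ sX) (HD _ _ sY) /push /bracket !DE.
rewrite (Hs (X p)) (tor (_ *m X p)).
move: (H _ _) (conn_at A g P _) => h c.
mx_ring.
Qed.

(** The Leibniz rule; with E = J_a it separates the derivative of J_a from that
    of the section. *)
Lemma nabla_along_endo (E : M -> 'M[R]_m) (Y : N -> 'cV[R]_m) v :
  differentiable (loc_endo A P E) (phi P) ->
  differentiable (rep A f Y p \o psiN) (phiN p) ->
  nabla_along A g B f v (fun q => E (f q) *m Y q) p =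
  nabla_endo (conn_at A g P) (phi P) (loc_endo A P E) (tmap B A f p *m v) *m Y p
  + E P *m nabla_along A g B f v Y p.
Proof.
move=> dE dY.
have Fp : F (phiN p) = phi P by rewrite /= psiNp.
have E1 : \forall t \near phiN p,
    rep A f (fun q => E (f q) *m Y q) p (psiN t)
    = loc_endo A P E (F t) *m (rep A f Y p \o psiN) t.
  apply: filterS nearS => _ [q [dq dfq] <-].
  rewrite /= cmapK// /rep /loc_endo cmapK//.
  rewrite -/(transition_jac A P (f q) (f q)).
  by rewrite -!mulmxA; congr (_ *m (_ *m _)); rewrite mulmxA TK'// mul1mx.
have dEF : differentiable (fun t => loc_endo A P E (F t)) (phiN p).
  by apply: (@differentiable_comp _ _ _ _ F); [exact: dF|rewrite Fp].
rewrite !(nabla_alongE A g B _ _ (erefl P)) /nabla_endo loc_endo_at.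
rewrite {1}/dir (near_eq_derive v E1) derive_mulmx//.
rewrite derive_comp; [|exact: dF|by rewrite Fp].
rewrite -tmapE Fp loc_endo_at.
have -> : (rep A f Y p \o psiN) (phiN p) = Y p.
  have T1 : to_chart A P P = 1%:M by exact: T_id.
  by rewrite /= psiNp /rep T1 mul1mx.
rewrite -/(dir B (rep A f Y p) p v).
move: ('D_(tmap B A f p *m v) (loc_endo A P E) (phi P)) (dir B _ _ _) => d1 d2.
mx_ring.
Qed.

End PullBack.

Section Subspaces.
Context {R : realType} {m : nat}.
Implicit Types (b : 'M[R]_m) (E F : {vspace 'cV[R]_m}) (x y : 'cV[R]_m).

Lemma perp_gdot b E x y : x \in perp b E -> y \in E -> gdot b y x = 0.
Proof.
move=> xE yE; rewrite (coord_vbasis yE) /gdot linear_sum /= !mulmx_suml summxE.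
rewrite big1 // => j _; rewrite linearZ /= -!scalemxAl mxE.
have : (x \in lker (linfun (mulmx ((tnth (vbasis E) j)^T *m b) : 'cV[R]_m -> 'cV[R]_1))).
  by move: xE; rewrite /perp memvE => /subv_bigcapP /(_ j isT); rewrite -memvE.
rewrite memv_ker lfunE /= (tnth_nth 0) => /eqP ->.
by rewrite mxE mulr0.
Qed.

Lemma daddv_pi_eq0 E F x : (E :&: F)%VS = 0%VS -> x \in F -> daddv_pi E F x = 0.
Proof.
move=> EF xF; have FE : (F :&: E)%VS = 0%VS by rewrite capvC.
have xEF : x \in (E + F)%VS by rewrite -[x]add0r memv_add ?mem0v.
have := daddv_pi_add EF xEF; rewrite (daddv_pi_id FE xF).
by move=> /eqP; rewrite -subr_eq0 addrK => /eqP.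
Qed.

Lemma memv_span_enum r (X : 'I_r -> 'cV[R]_m) E x :
  basis_of E [seq X i | i <- enum 'I_r] -> x \in E ->
  exists c : 'I_r -> R, x = \sum_i c i *: X i.
Proof.
move=> /span_basis EX; rewrite -EX.
have -> : [seq X i | i <- enum 'I_r] = [tuple of [seq X i | i <- ord_tuple r]].
  by [].

move=> /coord_span ->.
exists (fun j => coord [tuple of [seq X i | i <- ord_tuple r]] j x).
apply: eq_bigr => j _; congr (_ *: _).
by rewrite -tnth_nth tnth_map tnth_ord_tuple.
Qed.

End Subspaces.

(** * Screen real null submanifolds *)

Section ScreenReal.
Context {R : realType} {d r k : nat} {N M : topologicalType}
  (B : manifold R d N) (A : complex_manifold R k M) (g : M -> 'M[R]_(k + k))
  (C : contact_data R k M) (f : N -> M) (D : @screen_data R (k + k) N) (ind : nat).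
Hypotheses (hg : semi_riemannian A g ind) (hherm : hermitian_metric g)
  (hcm : contact_metric A g C) (hnormal : normal_contact A g C)
  (oC : forall i : cover_index C, open (cover_set i))
  (hsub : submanifold B A f) (hscreen : is_screen B A g f r D)
  (hreal : screen_real B A g C f D).
Variable p : N.

Local Notation TM := (tangent B A f p).
Local Notation Rad := (radical B A g f p).
Local Notation scr := (screen D p).
Local Notation str := (screen_tr D p).
Local Notation ltr := (null_tr D p).
Local Notation "<< x , y >>" := (gdot (g (f p)) x y).

Let gC x y : <<x, y>> = <<y, x>>.
Proof. by apply: gdotC; exact: (Defs.metric_sym hg). Qed.

Let rad_tangent x : x \in Rad -> x \in TM.
Proof. by rewrite memv_cap => /andP[]. Qed.

Let rad_orth x y : x \in Rad -> y \in TM -> <<y, x>> = 0.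
Proof. by rewrite memv_cap => /andP[_ xn] yT; exact: perp_gdot xn yT. Qed.

Let str_normal x : x \in str -> x \in normal_bundle B A g f p.
Proof.
move=> xs; have [<- _] := screen_tr_compl hscreen p.
by rewrite -[x]add0r memv_add ?mem0v.
Qed.

Let str_orth x y : x \in str -> y \in TM -> <<y, x>> = 0.
Proof. by move=> xs yT; exact: perp_gdot (str_normal xs) yT. Qed.

Let scr_tangent x : x \in scr -> x \in TM.
Proof.
move=> xs; have [<- _] := screen_compl hscreen p.
by rewrite -[x]add0r memv_add ?mem0v.
Qed.

Let tangent_split x : x \in TM -> exists y z, [/\ y \in Rad, z \in scr & x = y + z].
Proof.
have [<- _] := screen_compl hscreen p.
by move=> /memv_addP[y yR [z zs ->]]; exists y, z.
Qed.

(* the null transversal part is detected by pairing with Rad TM *)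
Let ltr_orth x : x \in ltr -> (forall y, y \in Rad -> <<y, x>> = 0) -> x = 0.
Proof.
have [W [xi [nu [_ Wp _ _ /(_ p Wp)]]]] := null_tr_frame hscreen p.
move=> [bxi bnu _ xinu _] /(memv_span_enum bnu)[c ->] H.
apply: big1 => j _; suff -> : c j = 0 by rewrite scale0r.
have xij : xi j p \in Rad.
  rewrite -(span_basis bxi); apply: memv_span; apply/mapP.
  by exists j => //; rewrite mem_enum.
rewrite -(H _ xij) gdot_sumr (bigD1 j)//= gdotZr xinu eqxx mulr1 big1 ?addr0//.
by move=> l /negPf lj; rewrite gdotZr xinu eq_sym lj mulr0.
Qed.

Let tangent_str x : x \in TM -> x \in str -> x = 0.
Proof.
move=> xT xs; apply/eqP; rewrite -memv0.
have [_ <-] := screen_tr_compl hscreen p.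
by rewrite memv_cap xs andbT memv_cap xT str_normal.
Qed.

Let disjoint_tangent : (TM :&: (ltr + str))%VS = 0%VS.
Proof.
apply/eqP; rewrite -subv0; apply/subvP => x; rewrite memv_cap => /andP[xT].
move=> /memv_addP[n nl [w ws xE]].
have n0 : n = 0.
  apply: (ltr_orth nl) => y yR.
  have -> : n = x - w by rewrite xE addrK.
  by rewrite gdotDr gdotNr (str_orth ws (rad_tangent yR)) gC (rad_orth yR xT) subr0.
by rewrite memv0; apply/eqP/tangent_str; rewrite // xE n0 add0r.
Qed.

Let disjoint_str : (str :&: (TM + ltr))%VS = 0%VS.
Proof.
apply/eqP; rewrite -subv0; apply/subvP => x; rewrite memv_cap => /andP[xs].
move=> /memv_addP[t tT [n nl xE]].
have n0 : n = 0.
  apply: (ltr_orth nl) => y yR.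
  have -> : n = x - t by rewrite xE [t + n]addrC addrK.
  by rewrite gdotDr gdotNr (str_orth xs (rad_tangent yR)) gC (rad_orth yR tT) subr0.
by rewrite memv0; apply/eqP/tangent_str; rewrite // xE n0 addr0.
Qed.

Section Patch.
Variables (i : cover_index C) (Ci : cover_set i (f p)).

Let hor_tangent x : x \in TM ->
  orth2 (g (f p)) (field_U i (f p)) (field_V i (f p)) x.
Proof. by move=> xT; have [Us Vs _] := hreal Ci; split; exact: str_orth. Qed.

Let J_rad a x : x \in Rad -> tensor_J i a (f p) *m x \in Rad.
Proof.
have [_ _ /(_ a)[RE _]] := hreal Ci => xR.
have := memv_img (linfun (mulmx (tensor_J i a (f p)) : 'cV[R]_(k + k) -> 'cV[R]_(k + k))) xR.
by rewrite RE lfunE.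
Qed.

Let J_scr a x : x \in scr -> tensor_J i a (f p) *m x \in str.
Proof.
have [_ _ /(_ a)[_ /subvP sE]] := hreal Ci => xs.
have := sE _ (memv_img (linfun (mulmx (tensor_J i a (f p)) : 'cV[R]_(k + k) -> 'cV[R]_(k + k))) xs).
by rewrite lfunE.
Qed.

Let push_tangent (X : N -> 'cV[R]_d) : push B A f X p \in TM.
Proof.
have := memv_img (linfun (mulmx (tmap B A f p) : 'cV[R]_d -> 'cV[R]_(k + k))) (memvf (X p)).
by rewrite lfunE.
Qed.

(** The covariant derivatives of J_a contribute a radical vector, which the
    projection to S(TM^perp) kills, as it kills J_a rho; what remains of the
    bracket is J_a s, and J_a J_a s = - s. *)
Lemma B_hs_sub a X1 X2 : radical_section B A g f X1 -> radical_section B A g f X2 ->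
  exists rho s, [/\ rho \in Rad, s \in scr, push B A f (bracket B X1 X2) p = rho + s &
    B_hs B A g f D i a X1 X2 p - B_hs B A g f D i a X2 X1 p = - s].
Proof.
move=> [sX1 rX1] [sX2 rX2].
have [rho [s [rhoR ss bE]]] := tangent_split (push_tangent (bracket B X1 X2)).
exists rho, s; split => //.
have [sf _ _] := hsub.
have dg : differentiable (loc_metric A (f p) g) (cmap (chart_at A (f p)) (f p)).
  have oD : open (cdom (chart_at A (f p))) by exact: cdom_open.
  apply: (loc_metric_smooth oD (chart_atP A (f p)) (fun _ => id) 1 (metric_smooth hg)).1.
  by apply: loc_mem; exact: chart_atP.
have dJ := tensor_J_differentiable hcm (@oC i) Ci a.
pose K := nabla_endo (conn_at A g (f p)) (cmap (chart_at A (f p)) (f p))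
  (loc_endo A (f p) (tensor_J i a)).
have KR x y : x \in Rad -> y \in Rad -> K x *m y \in Rad.
  apply: (nabla_tensor_J_null hg hherm hcm hnormal (@oC i) Ci).
  - by move=> z /rad_tangent; exact: hor_tangent.
  - by move=> z z' zR z'R; apply: rad_orth => //; exact: rad_tangent.
  - by move=> b z; exact: J_rad.
have LE X Y : smooth_field B setT Y ->
    nabla_along A g B f (X p) (fun q => tensor_J i a (f q) *m push B A f Y q) p
    = K (push B A f X p) *m push B A f Y p
      + tensor_J i a (f p) *m nabla_along A g B f (X p) (push B A f Y) p.
  by move=> sY; apply: nabla_along_endo => //; exact: rep_push_differentiable.
rewrite /B_hs /h_s /tangential_part /screen_tr_part -linearB -mulmxBr -linearB /=.
rewrite (LE X1 X2 sX2) (LE X2 X1 sX1).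
have tor := nabla_along_torsion sf (conn_torsion (Defs.metric_sym hg) dg) sX1 sX2.
rewrite opprD addrACA -mulmxBr tor bE mulmxDr addrA linearD /=.
have ER : K (push B A f X1 p) *m push B A f X2 p - K (push B A f X2 p) *m push B A f X1 p
    + tensor_J i a (f p) *m rho \in Rad.
  by rewrite memvD ?memvB ?KR ?J_rad.
rewrite (daddv_pi_eq0 disjoint_str); last first.
  by rewrite -[X in X \in _]addr0 memv_add ?mem0v//; exact: rad_tangent.
rewrite add0r (daddv_pi_id disjoint_str (J_scr a ss)).
rewrite (tensor_J_square hg hherm hcm hnormal (@oC i) Ci); last first.
  exact: hor_tangent (scr_tangent ss).
by rewrite (daddv_pi_id disjoint_tangent)// memvN; exact: scr_tangent.
Qed.

End Patch.

End ScreenReal.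

Theorem theorem4p7 (R : realType) (n q d r : nat) (Mbar N : topologicalType)
  (A : complex_manifold R n.*2.+1 Mbar) (g : Mbar -> 'M[R]_(n.*2.+1 + n.*2.+1))
  (C : contact_data R n.*2.+1 Mbar)
  (B : manifold R d N) (f : N -> Mbar) (D : screen_data) (a : 'I_3)
  (hq0 : (0 < q)%N) (hqn : (q < n)%N)
  (hcontact : complex_contact A C)
  (hmetric : semi_riemannian A g (4 * q)) (hherm : hermitian_metric g)
  (hcm : contact_metric A g C) (hnormal : normal_contact A g C)
  (hnull : null_submanifold B A g f r) (hscreen : is_screen B A g f r D)
  (hreal : screen_real B A g C f D) :
  radical_integrable B A g f <->
  (forall X1 X2 : N -> 'cV[R]_d,
     radical_section B A g f X1 -> radical_section B A g f X2 ->
     forall (i : cover_index C) (p : N), cover_set i (f p) ->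
     B_hs B A g f D i a X1 X2 p = B_hs B A g f D i a X2 X1 p).
Proof.
have [oC _ _ _ _] := hcontact.
have [hsub _ _] := hnull.
have difference X1 X2 (h1 : radical_section B A g f X1) (h2 : radical_section B A g f X2) i p
    (Ci : cover_set i (f p)) :=
  B_hs_sub hmetric hherm hcm hnormal oC hsub hscreen hreal Ci a h1 h2.
split=> [hint X1 X2 h1 h2 i p Ci|heq X1 X2 h1 h2 p].
  have [rho [s [rhoR ss bE dE]]] := difference X1 X2 h1 h2 i p Ci.
  suff s0 : s = 0 by apply/eqP; rewrite -subr_eq0 dE s0 oppr0.
  apply/eqP; rewrite -memv0; have [_ <-] := screen_compl hscreen p.
  rewrite memv_cap ss andbT -[s](addKr rho) -bE addrC.
  by rewrite memvB// hint.
have [i Ci] := cover_all hcontact (f p).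
have [rho [s [rhoR ss bE dE]]] := difference X1 X2 h1 h2 i p Ci.
suff s0 : s = 0 by rewrite bE s0 addr0.
by apply/eqP; rewrite -oppr_eq0 -dE (heq X1 X2 h1 h2 i p Ci) subrr.
Qed.
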